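(* Let $k$ be a commutative ring, $(\mathcal{O},\mu)$ an operad with multiplication in $k$-modules and $\mathcal{M}$ a cyclic unital comp module over $\mathcal{O}$. For every $\varphi$ in the normalised cochain complex $\bar{\mathcal{O}}^\bullet$, the homotopy formula $$\mathcal{L}_\varphi=[B+b,\ \iota_\varphi+S_\varphi]-\iota_{\delta\varphi}-S_{\delta\varphi}$$ holds on the normalised chain complex $\bar{\mathcal{M}}_\bullet$. In particular, for any cocycle $\varphi\in\bar{\mathcal{O}}^\bullet$, the induced maps on homology $H_\bullet(\mathcal{M})$ satisfy $$\mathcal{L}_\varphi=[B,\iota_\varphi],$$ that is, the pair $(H^\bullet(\mathcal{O}),H_\bullet(\mathcal{M}))$ defines a noncommutative differential calculus. Here, for $\varphi\in\bar{\mathcal{O}}(p)$, the graded commutators are $[B+b,\iota_\varphi+S_\varphi]=(B+b)(\iota_\varphi+S_\varphi)-(-1)^p(\iota_\varphi+S_\varphi)(B+b)$ and $[B,\iota_\varphi]=B\iota_\varphi-(-1)^p\iota_\varphi B$.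
   Context: Unadorned tensor products are over $k$. Operad with multiplication. An operad (non-$\Sigma$, in $k$-modules) is a sequence $\{\mathcal{O}(n)\}_{n\ge0}$ of $k$-modules with $k$-bilinear operations $\circ_i:\mathcal{O}(p)\otimes\mathcal{O}(q)\to\mathcal{O}(p+q-1)$ and an identity $\mathbb{1}\in\mathcal{O}(1)$ such that for $\varphi\in\mathcal{O}(p)$, $\psi\in\mathcal{O}(q)$, $\chi\in\mathcal{O}(r)$: $\varphi\circ_i\psi=0$ if $p<i$ or $p=0$; $$(\varphi\circ_i\psi)\circ_j\chi=\begin{cases}(\varphi\circ_j\chi)\circ_{i+r-1}\psi & j<i,\\ \varphi\circ_i(\psi\circ_{j-i+1}\chi) & i\le j<q+i,\\ (\varphi\circ_{j-q+1}\chi)\circ_i\psi & j\ge q+i;\end{cases}$$ and $\varphi\circ_i\mathbb{1}=\mathbb{1}\circ_1\varphi=\varphi$ for $i\le p$. It is an operad with multiplication if there are $\mu\in\mathcal{O}(2)$ and $e\in\mathcal{O}(0)$ (the unit) with $\mu\circ_1\mu=\mu\circ_2\mu$ and $\mu\circ_1e=\mu\circ_2e=\mathbb{1}$. Cyclic unital comp module over $\mathcal{O}$. This is a sequence $\{\mathcal{M}(n)\}_{n\ge0}$ of $k$-modules with $k$-linear maps $\bullet_i:\mathcal{O}(p)\otimes\mathcal{M}(n)\to\mathcal{M}(n-p+1)$, defined for $1\le i\le n-p+1$ when $0\le p\le n$ (declared zero if $p>n$), and for $i=0$ when $0\le p\le n+1$ (declared zero if $p>n+1$), together with $k$-linear maps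 $t:\mathcal{M}(n)\to\mathcal{M}(n)$ (with $t=\mathrm{id}$ on $\mathcal{M}(0)$), such that for $\varphi\in\mathcal{O}(p)$, $\psi\in\mathcal{O}(q)$, $x\in\mathcal{M}(n)$ and all indices $i,j\geq 0$ for which the operations are defined: if $p>0$, $$\varphi\bullet_i(\psi\bullet_jx)=\begin{cases}\psi\bullet_j(\varphi\bullet_{i+q-1}x)& j<i,\\ (\varphi\circ_{j-i+1}\psi)\bullet_ix& j-p<i\le j,\\ \psi\bullet_{j-p+1}(\varphi\bullet_ix)& 0\le i\le j-p;\end{cases}$$ if $p=0$, $$\varphi\bullet_i(\psi\bullet_jx)=\begin{cases}\psi\bullet_j(\varphi\bullet_{i+q-1}x)& j<i,\\ \psi\bullet_{j+1}(\varphi\bullet_ix)& 0\le i\le j;\end{cases}$$ $\mathbb{1}\bullet_ix=x$ for $i=0,\dots,n$; $\ t(\varphi\bullet_ix)=\varphi\bullet_{i+1}t(x)$ for $i=0,\dots,n-p$; and $t^{n+1}=\mathrm{id}$ on $\mathcal{M}(n)$. Structure on $\mathcal{O}^\bullet$, $\mathcal{O}^n:=\mathcal{O}(n)$. For $\varphi\in\mathcal{O}(p)$, $\psi\in\mathcal{O}(q)$ put $\varphi\,\bar\circ\,\psi:=\sum_{i=1}^p(-1)^{(q-1)(i-1)}\varphi\circ_i\psi$, $\{\varphi,\psi\}:=\varphi\,\bar\circ\,\psi-(-1)^{(p-1)(q-1)}\psi\,\bar\circ\,\varphi$, $\varphi\smile\psi:=(\mu\circ_2\varphi)\circ_1\psi$,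 $\delta\varphi:=\{\mu,\varphi\}$; $H^\bullet(\mathcal{O}):=H(\mathcal{O}^\bullet,\delta)$. It is well known that $\mathcal{O}^\bullet$ is a cosimplicial $k$-module (with codegeneracies $\varphi\mapsto\varphi\circ_ie$) and that $\smile$ and $\{\cdot,\cdot\}$ make $H^\bullet(\mathcal{O})$ a Gerstenhaber algebra. $\bar{\mathcal{O}}^\bullet$ is the intersection of the kernels of the codegeneracies: $\bar{\mathcal{O}}(p)=\{\varphi\in\mathcal{O}(p):\varphi\circ_ie=0,\ 1\le i\le p\}$. Structure on $\mathcal{M}_\bullet$, $\mathcal{M}_n:=\mathcal{M}(n)$. The boundary $b:\mathcal{M}_n\to\mathcal{M}_{n-1}$ is $b(x)=\sum_{i=0}^{n-1}(-1)^i\mu\bullet_ix+(-1)^n\mu\bullet_0t(x)$ ($b=0$ on $\mathcal{M}_0$), with homology $H_\bullet(\mathcal{M})$. $\bar{\mathcal{M}}_\bullet$ is the quotient of $\mathcal{M}_\bullet$ by the subcomplex spanned by the images of the degeneracies $s_j=e\bullet_{j+1}(\cdot)$, $0\le j\le n$, on $\mathcal{M}(n)$; it computes the same homology. On $\bar{\mathcal{M}}_\bullet$ the cyclic differential is $B(x)=\sum_{i=0}^n(-1)^{in}e\bullet_0t^i(x)\in\bar{\mathcal{M}}_{n+1}$, $x\in\bar{\mathcal{M}}_n$. For $\varphi\in\mathcal{O}(p)$, $x\in\mathcal{M}(n)$: the cap product is $\iota_\varphi x:=\varphi\frown x:=(\mu\circ_2\varphi)\bullet_0x\in\mathcal{M}(n-p)$;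 the Lie derivative $\mathcal{L}_\varphi x\in\mathcal{M}(n-p+1)$ is $$\mathcal{L}_\varphi x:=\sum_{i=1}^{n-p+1}(-1)^{(p-1)(i-1)}\varphi\bullet_ix+\sum_{i=1}^p(-1)^{n(i-1)+p-1}\varphi\bullet_0t^{i-1}(x)\quad(p<n+1),$$ $\mathcal{L}_\varphi x:=(-1)^{p-1}\varphi\bullet_0\sum_{i=0}^n(-1)^{in}t^i(x)$ for $p=n+1$, and $\mathcal{L}_\varphi:=0$ for $p>n+1$; and the operator $S_\varphi:\mathcal{M}(n)\to\mathcal{M}(n-p+2)$ is $$S_\varphi(x):=\sum_{j=1}^{n-p+1}\sum_{i=j}^{n-p+1}(-1)^{n(j-1)+(p-1)(i-1)}\,e\bullet_0\big(\varphi\bullet_it^{j-1}(x)\big)\quad(0\le p\le n),\qquad S_\varphi:=0\quad(p>n).$$ Noncommutative differential calculus. A Gerstenhaber algebra is a graded commutative $k$-algebra $(V=\bigoplus_{p\in\mathbb{N}}V^p,\smile)$ with a graded Lie bracket $\{\cdot,\cdot\}:V^{p+1}\otimes V^{q+1}\to V^{p+q+1}$ on $V[1]=\bigoplus_pV^{p+1}$ such that $\{\chi,\varphi\smile\psi\}=\{\chi,\varphi\}\smile\psi+(-1)^{pq}\varphi\smile\{\chi,\psi\}$ for $\chi\in V^{p+1}$, $\varphi\in V^q$. A Gerstenhaber module over $V$ is a graded $(V,\smile)$-module $(\Omega=\bigoplus_{n\in\mathbb{N}}\Omega_n,\frown)$, $V^p\frown\Omega_n\subseteq\Omega_{n-p}$,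 with a graded Lie algebra module structure $\mathcal{L}:V^{p+1}\otimes\Omega_n\to\Omega_{n-p}$ over $(V[1],\{\cdot,\cdot\})$ such that $\psi\frown\mathcal{L}_\varphi(x)=\{\psi,\varphi\}\frown x+(-1)^{pq}\mathcal{L}_\varphi(\psi\frown x)$ for $\varphi\in V^{p+1}$, $\psi\in V^q$. It is a Batalin–Vilkovisky module if there is a $k$-linear $B:\Omega_n\to\Omega_{n+1}$ with $BB=0$ and $\mathcal{L}_\varphi(x)=B(\varphi\frown x)-(-1)^p\varphi\frown B(x)$ for $\varphi\in V^p$. A pair $(V,\Omega)$ of a Gerstenhaber algebra and a Batalin–Vilkovisky module over it is a noncommutative differential calculus. In the claim, the structure on $(H^\bullet(\mathcal{O}),H_\bullet(\mathcal{M}))$ is the one induced by $\smile,\{\cdot,\cdot\},\frown,\mathcal{L},B$. *)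

(* Defs.v *)
From HB Require Import structures.
From mathcomp Require Import all_boot all_order all_algebra.
From mathcomp Require Import boolp.

Set Implicit Arguments.
Unset Strict Implicit.
Unset Printing Implicit Defensive.

Import GRing.Theory.
Local Open Scope ring_scope.
Local Open Scope quotient_scope.

Section QuotientModule.
Context {k : pzRingType} {V : lmodType k}.
Variable W : submodClosed V.

(* [Quotient.quot] expects a [zmodClosed] predicate, which MathComp does not
   derive from [submodClosed]. *)
Definition submod_zmod : {pred V} := [pred x | x \in W].

Lemma submod_zmod_closed : zmod_closed submod_zmod.
Proof. exact: GRing.submod_closedB (submodClosedP W). Qed.

HB.instance Definition _ :=
  GRing.isZmodClosed.Build V submod_zmod submod_zmod_closed.

Definition quotmod : Type := @Quotient.quot V submod_zmod.
HB.instance Definition _ := GRing.Zmodule.on quotmod.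
HB.instance Definition _ := EqQuotient.on quotmod.

Definition qscale (a : k) (x : quotmod) : quotmod := \pi_quotmod (a *: repr x).

Lemma qpiP (x y : V) : reflect (\pi_quotmod x = \pi_quotmod y) (x - y \in W).
Proof.
by rewrite -[_ \in W]/(x - y \in submod_zmod) Quotient.idealrBE; apply: eqP.
Qed.

Lemma qpiD (x y : V) : \pi_quotmod (x + y) = \pi_quotmod x + \pi_quotmod y.
Proof. exact: (raddfD (\pi_(@Quotient.quot V submod_zmod))). Qed.

Lemma qpi_scale (a : k) (x : V) :
  qscale a (\pi_quotmod x) = \pi_quotmod (a *: x).
Proof.
apply/qpiP; rewrite -scalerBr rpredZ //.
by apply/qpiP; rewrite reprK.
Qed.

Lemma qscaleA a b x : qscale a (qscale b x) = qscale (a * b) x.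
Proof.
by elim/quotW: x => x; rewrite (qpi_scale b) (qpi_scale a) (qpi_scale (a * b)) scalerA.
Qed.

Lemma qscale1 : left_id 1 qscale.
Proof. by elim/quotW => x; rewrite qpi_scale scale1r. Qed.

Lemma qscaleDr : right_distributive qscale +%R.
Proof.
move=> a; elim/quotW=> x; elim/quotW=> y.
by rewrite -qpiD !qpi_scale scalerDr qpiD.
Qed.

Lemma qscaleDl x : {morph qscale^~ x : a b / a + b}.
Proof. by elim/quotW: x => x a b; rewrite !qpi_scale scalerDl qpiD. Qed.

HB.instance Definition _ := GRing.Zmodule_isLmodule.Build k quotmod
  qscaleA qscale1 qscaleDr qscaleDl.

End QuotientModule.

Section Subquotient.
Context {k : pzRingType} {V : lmodType k}.
Variables Z B : submodClosed V.

Record subq_sub : Type := SubqSub { subq_val : V; _ : subq_val \in Z }.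
HB.instance Definition _ := [isSub for subq_val].
HB.instance Definition _ := [Choice of subq_sub by <:].
HB.instance Definition _ := [SubChoice_isSubLmodule of subq_sub by <:].

Definition subq_den : {pred subq_sub} := [pred z | val z \in B].

Lemma subq_den_closed : submod_closed subq_den.
Proof.
split=> [|a u v]; rewrite !inE; first by rewrite raddf0 rpred0.
by move=> Bu Bv; rewrite raddfD /= rpredD // rpredZ.
Qed.

HB.instance Definition _ :=
  GRing.isSubmodClosed.Build k subq_sub subq_den
    (GRing.submod_closed_semi subq_den_closed).

(* The module Z / (Z :&: B). *)
Definition subquot : lmodType k := quotmod subq_den.

Definition represents (h : subquot) (x : V) : Prop :=
  exists2 z : subq_sub, val z = x & \pi_(quotmod subq_den) z = h.

(* Class of x; it is 0 when x is not in Z. *)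
Definition subq_class (x : V) : subquot :=
  \pi_(quotmod subq_den) (insubd (0 : subq_sub) x).

Definition subq_repr (h : subquot) : V := val (repr (h : quotmod subq_den)).

End Subquotient.

(* A homogeneous map between graded modules is given by all of its components,
   the components between degrees that do not match being 0.  For instance an
   element of degree -1 is represented by 0, in any degree. *)

Section Graded.
Context {k : comPzRingType}.
Implicit Types U V W : nat -> lmodType k.

Record graded_linear U V (deg : nat -> nat -> bool)
    (f : forall n m, U n -> V m) : Prop := GradedLinear {
  gl_deg : forall n m x, ~~ deg n m -> f n m x = 0;
  gl_linear : forall n m, linear (f n m) }.

Record graded_bilinear U V W (deg : nat -> nat -> nat -> bool)
    (f : forall p q r, U p -> V q -> W r) : Prop := GradedBilinear {
  gb_deg : forall p q r u v, ~~ deg p q r -> f p q r u v = 0;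
  gb_linearl : forall p q r (v : V q), linear (fun u : U p => f p q r u v);
  gb_linearr : forall p q r (u : U p), linear (f p q r u) }.

End Graded.

Arguments gb_linearl {k U V W deg f} _ p q r v.
Arguments gb_linearr {k U V W deg f} _ p q r u.

(* [ocomp r i f g] is the component in degree r of the partial composition of
   f and g at position i >= 1; position 0 carries no condition. *)
Record operad (k : comPzRingType) := Operad {
  operad_mod :> nat -> lmodType k;
  ocomp : forall p q r : nat, nat -> operad_mod p -> operad_mod q -> operad_mod r;
  oid : operad_mod 1;
  ocomp_bilinear : forall i,
    graded_bilinear (fun p q r => p + q == r.+1)%N (fun p q r => @ocomp p q r i);
  ocomp_out : forall p q r i (f : operad_mod p) (g : operad_mod q),
    (p < i)%N || (p == 0)%N -> ocomp r i f g = 0;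
  ocompA_lt : forall p q r s t u i j
      (f : operad_mod p) (g : operad_mod q) (h : operad_mod r),
    (p + q = s.+1)%N -> (s + r = u.+1)%N -> (p + r = t.+1)%N ->
    (1 <= j < i)%N ->
    ocomp u j (ocomp s i f g) h = ocomp u (i + r).-1 (ocomp t j f h) g;
  ocompA_in : forall p q r s t u i j
      (f : operad_mod p) (g : operad_mod q) (h : operad_mod r),
    (p + q = s.+1)%N -> (s + r = u.+1)%N -> (q + r = t.+1)%N ->
    (1 <= i <= j)%N -> (j < q + i)%N ->
    ocomp u j (ocomp s i f g) h = ocomp u i f (ocomp t (j - i).+1 g h);
  ocompA_gt : forall p q r s t u i j
      (f : operad_mod p) (g : operad_mod q) (h : operad_mod r),
    (p + q = s.+1)%N -> (s + r = u.+1)%N -> (p + r = t.+1)%N ->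
    (1 <= i)%N -> (q + i <= j)%N ->
    ocomp u j (ocomp s i f g) h = ocomp u i (ocomp t (j - q).+1 f h) g;
  ocomp1r : forall p i (f : operad_mod p), (1 <= i <= p)%N -> ocomp p i f oid = f;
  ocomp1l : forall p (f : operad_mod p), ocomp p 1 oid f = f
}.
Arguments ocomp {k} o {p q} r i f g.
Arguments oid {k} o.

Record mult_operad (k : comPzRingType) := MultOperad {
  mult_operad_operad :> operad k;
  omu : mult_operad_operad 2;
  ounit : mult_operad_operad 0;
  omuA : ocomp _ 3 1 omu omu = ocomp _ 3 2 omu omu;
  omu1l : ocomp _ 1 1 omu ounit = oid _;
  omu1r : ocomp _ 1 2 omu ounit = oid _
}.
Arguments omu {k} m.
Arguments ounit {k} m.

(* [bul m i f x] is the component in degree m of the action of f on x at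
   position i.  When the degrees match, i.e. m = n - p + 1, the position i is
   one at which the action is defined exactly when i <= m; for p = n + 1 this
   leaves i = 0 only.  In [bulA_gt], the case p = 0 is the second case of the
   separate relation for p = 0. *)
Record cyclic_comp_module (k : comPzRingType) (O : operad k) := CyclicCompModule {
  ccm_mod :> nat -> lmodType k;
  bul : forall p n m : nat, nat -> O p -> ccm_mod n -> ccm_mod m;
  cyc : forall n : nat, ccm_mod n -> ccm_mod n;
  bul_bilinear : forall i,
    graded_bilinear (fun p n m => n.+1 == p + m)%N (fun p n m => @bul p n m i);
  bul_out : forall p n m i (f : O p) (x : ccm_mod n), (m < i)%N -> bul m i f x = 0;
  cyc_linear : forall n, linear (@cyc n);
  bulA_lt : forall p q n l m s i j (f : O p) (g : O q) (x : ccm_mod n),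
    (n.+1 = q + l)%N -> (l.+1 = p + m)%N -> (n.+1 = p + s)%N ->
    (j <= l)%N -> (i <= m)%N -> (j < i)%N ->
    bul m i f (bul l j g x) = bul m j g (bul s (i + q).-1 f x);
  bulA_in : forall p q n l m s i j (f : O p) (g : O q) (x : ccm_mod n),
    (n.+1 = q + l)%N -> (l.+1 = p + m)%N -> (p + q = s.+1)%N ->
    (j <= l)%N -> (i <= m)%N -> (i <= j < i + p)%N ->
    bul m i f (bul l j g x) = bul m i (ocomp O s (j - i).+1 f g) x;
  bulA_gt : forall p q n l m s i j (f : O p) (g : O q) (x : ccm_mod n),
    (n.+1 = q + l)%N -> (l.+1 = p + m)%N -> (n.+1 = p + s)%N ->
    (j <= l)%N -> (i <= m)%N -> (i + p <= j)%N ->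
    bul m i f (bul l j g x) = bul m (j - p).+1 g (bul s i f x);
  bul1 : forall n i (x : ccm_mod n), (i <= n)%N -> bul n i (oid O) x = x;
  cyc_bul : forall p n m i (f : O p) (x : ccm_mod n),
    (n.+1 = p + m)%N -> (i < m)%N -> cyc (bul m i f x) = bul m i.+1 f (cyc x);
  cyc0 : forall x : ccm_mod 0, cyc x = x;
  cyc_iter : forall n (x : ccm_mod n), iter n.+1 (@cyc n) x = x
}.
Arguments bul {k O} c {p n} m i f x.
Arguments cyc {k O} c {n} x.

(* In signs, p.+1 stands for p - 1, which has the same parity, and i.-1 is only
   used for i >= 1. *)

Section Operations.
Context {k : comPzRingType} (O : mult_operad k) (M : cyclic_comp_module O).

Definition ocirc p q r (f : O p) (g : O q) : O r :=
  \sum_(1 <= i < p.+1) (-1) ^+ (q.+1 * i.-1) *: ocomp O r i f g.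

Definition obrk p q r (f : O p) (g : O q) : O r :=
  ocirc r f g - (-1) ^+ (p.+1 * q.+1) *: ocirc r g f.

Definition ocup p q r (f : O p) (g : O q) : O r :=
  ocomp O r 1 (ocomp O p.+1 2 (omu O) f) g.

Definition odelta p r (f : O p) : O r := obrk r (omu O) f.

Definition normalised p (f : O p) : Prop :=
  forall i, (1 <= i <= p)%N -> ocomp O p.-1 i f (ounit O) = 0.

Definition cb n m (x : M n) : M m :=
  \sum_(0 <= i < n) (-1) ^+ i *: bul M m i (omu O) x
    + (-1) ^+ n *: bul M m 0 (omu O) (cyc M x).

Definition cB n m (x : M n) : M m :=
  \sum_(0 <= i < n.+1) (-1) ^+ (i * n) *: bul M m 0 (ounit O) (iter i (cyc M) x).

Definition ccap p n m (f : O p) (x : M n) : M m :=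
  bul M m 0 (ocomp O p.+1 2 (omu O) f) x.

(* For p = n + 1 the first sum is empty and the second one is
   (-1)^(p-1) f .0 (\sum_(0 <= i <= n) (-1)^(i n) t^i x); for p > n + 1
   everything is 0 by [bul_bilinear]. *)
Definition clie p n m (f : O p) (x : M n) : M m :=
  \sum_(1 <= i < (n.+1 - p).+1) (-1) ^+ (p.+1 * i.-1) *: bul M m i f x
    + \sum_(1 <= i < p.+1)
        (-1) ^+ (n * i.-1 + p.+1) *: bul M m 0 f (iter i.-1 (cyc M) x).

(* For p > n the sums are empty. *)
Definition cS p n m (f : O p) (x : M n) : M m :=
  \sum_(1 <= j < (n.+1 - p).+1) \sum_(j <= i < (n.+1 - p).+1)
    (-1) ^+ (n * j.-1 + p.+1 * i.-1) *:
      bul M m 0 (ounit O) (bul M (n.+1 - p) i f (iter j.-1 (cyc M) x)).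

Lemma sum_linear (U V : lmodType k) I (r : seq I) (c : I -> k) (F : I -> U -> V) :
  (forall i, linear (F i)) -> linear (fun x => \sum_(i <- r) c i *: F i x).
Proof.
move=> lF a u v; rewrite scaler_sumr -big_split; apply: eq_bigr => i _ /=.
by rewrite lF scalerDr !scalerA mulrC.
Qed.

Lemma odelta_linear p r : linear (@odelta p r).
Proof.
move=> a u v; rewrite /odelta /obrk /ocirc.
have l1 i := gb_linearr (ocomp_bilinear O i) 2 p r (omu O).
have l2 i := gb_linearl (ocomp_bilinear O i) p 2 r (omu O).
rewrite (sum_linear _ _ l1) (sum_linear _ _ l2).
rewrite scalerDr scalerBr !scalerA mulrC opprD -!scalerA !addrA; congr (_ - _).
by rewrite -!addrA; congr (_ + _); rewrite addrC.
Qed.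

Lemma cb_linear n m : linear (@cb n m).
Proof.
move=> a u v; rewrite /cb.
have l i := gb_linearr (bul_bilinear M i) 2 n m (omu O).
rewrite (sum_linear _ _ l) (cyc_linear (n := n)) l.
by rewrite !scalerDr !scalerA mulrC !addrA; congr (_ + _); rewrite addrAC.
Qed.

Definition cocycles n : {pred O n} := [pred f | odelta n.+1 f == 0].

(* For n = 0 the map [odelta] from degree n.-1 to degree n is 0. *)
Definition coboundaries n : {pred O n} :=
  [pred f | `[< exists g : O n.-1, f = odelta n g >]].

(* For n = 0 the map [cb] from degree n to degree n.-1 is 0. *)
Definition cycles n : {pred M n} := [pred x | cb n.-1 x == 0].

Definition boundaries n : {pred M n} :=
  [pred x | `[< exists y : M n.+1, x = cb n y >]].

Definition degenerate n : {pred M n} :=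
  [pred x | `[< exists y : 'I_n -> M n.-1,
                  x = \sum_(j < n) bul M n j.+1 (ounit O) (y j) >]].

Lemma ker_closed (U V : lmodType k) (F : U -> V) : linear F ->
  subsemimod_closed [pred x | F x == 0].
Proof.
move=> lF; apply/GRing.submod_closed_semi.
have F0 : F 0 = 0 by have := lF (-1) 0 0; rewrite addr0 !scaleN1r oppr0 addNr.
split=> [|a u v]; rewrite !inE ?F0 // => /eqP Fu /eqP Fv.
by rewrite lF Fu Fv scaler0 addr0.
Qed.

Lemma im_closed (U V : lmodType k) (F : U -> V) : linear F ->
  subsemimod_closed [pred x : V | `[< exists y : U, x = F y >]].
Proof.
move=> lF; apply/GRing.submod_closed_semi.
have F0 : F 0 = 0 by have := lF (-1) 0 0; rewrite addr0 !scaleN1r oppr0 addNr.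
split=> [|a u v]; rewrite !inE; first by apply/asboolP; exists 0.
by move=> /asboolP[u' ->] /asboolP[v' ->]; apply/asboolP; exists (a *: u' + v'); rewrite lF.
Qed.

Lemma degenerate_closed n : subsemimod_closed (@degenerate n).
Proof.
apply/GRing.submod_closed_semi.
have l i := gb_linearr (bul_bilinear M i) 0 n.-1 n (ounit O).
have l0 i : bul M n i (ounit O) (0 : M n.-1) = 0.
  by have := l i (-1) 0 0; rewrite addr0 !scaleN1r oppr0 addNr.
split=> [|a u v]; rewrite !inE.
  by apply/asboolP; exists (fun=> 0); rewrite big1.
move=> /asboolP[u' ->] /asboolP[v' ->]; apply/asboolP.
exists (fun j => a *: u' j + v' j); rewrite scaler_sumr -big_split.
by apply: eq_bigr => j _; rewrite l.
Qed.

HB.instance Definition _ n := GRing.isSubmodClosed.Build k (O n) (@cocycles n)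
  (ker_closed (@odelta_linear n n.+1)).
HB.instance Definition _ n := GRing.isSubmodClosed.Build k (O n) (@coboundaries n)
  (im_closed (@odelta_linear n.-1 n)).
HB.instance Definition _ n := GRing.isSubmodClosed.Build k (M n) (@cycles n)
  (ker_closed (@cb_linear n n.-1)).
HB.instance Definition _ n := GRing.isSubmodClosed.Build k (M n) (@boundaries n)
  (im_closed (@cb_linear n.+1 n)).
HB.instance Definition _ n := GRing.isSubmodClosed.Build k (M n) (@degenerate n)
  (@degenerate_closed n).

Definition HO n : lmodType k := subquot (@cocycles n) (@coboundaries n).
Definition HM n : lmodType k := subquot (@cycles n) (@boundaries n).

(* The map on HM induced by a chain map. *)
Definition Hmap n m (F : M n -> M m) (h : HM n) : HM m :=
  subq_class _ _ (F (subq_repr h)).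

Definition Mbar n : lmodType k := quotmod (@degenerate n).

Definition Mpi n (x : M n) : Mbar n := \pi_(quotmod (@degenerate n)) x.

(* The map on Mbar induced by a map which preserves degenerate chains. *)
Definition qmap n m (F : M n -> M m) (x : Mbar n) : Mbar m :=
  Mpi (F (repr (x : quotmod (@degenerate n)))).

Definition descends (F : forall n m, M n -> M m) : Prop :=
  forall n m x, x \in @degenerate n -> F n m x \in @degenerate m.

(* The direct sum of the Mbar n consists of the finitely supported families. *)
Definition Mtot : Type := forall n, Mbar n.

Definition finsupp (x : Mtot) : Prop :=
  exists N, forall n, (N <= n)%N -> x n = 0.

Definition op_add (F G : Mtot -> Mtot) : Mtot -> Mtot := fun x m => F x m + G x m.

Definition op_sub (F G : Mtot -> Mtot) : Mtot -> Mtot := fun x m => F x m - G x m.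

(* The graded commutator of F with an operator G of parity p, for F odd. *)
Definition op_comm p (F G : Mtot -> Mtot) : Mtot -> Mtot :=
  fun x m => F (G x) m - (-1) ^+ p *: G (F x) m.

(* In each degree m, the component of x in the only degree that can contribute
   to it; when this degree is negative, the truncated one contributes 0. *)
Definition tb : Mtot -> Mtot := fun x m => qmap (@cb m.+1 m) (x m.+1).
Definition tB : Mtot -> Mtot := fun x m => qmap (@cB m.-1 m) (x m.-1).
Definition tcap p (f : O p) : Mtot -> Mtot :=
  fun x m => qmap (ccap m f) (x (p + m)%N).
Definition tlie p (f : O p) : Mtot -> Mtot :=
  fun x m => qmap (clie m f) (x (p + m).-1).
Definition tS p (f : O p) : Mtot -> Mtot :=
  fun x m => qmap (cS m f) (x (p + m).-2).

End Operations.

Arguments odelta {k} O {p} r f.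
Arguments normalised {k} O {p} f.
Arguments cocycles {k} O n.
Arguments degenerate {k O} M n.
Arguments cb {k O} M {n} m x.
Arguments cB {k O} M {n} m x.
Arguments ccap {k O} M {p n} m f x.
Arguments clie {k O} M {p n} m f x.
Arguments cS {k O} M {p n} m f x.
Arguments tb {k O} M.
Arguments tB {k O} M.
Arguments tcap {k O} M {p} f.
Arguments tlie {k O} M {p} f.
Arguments tS {k O} M {p} f.

(* In signs, c.+1 stands for the shifted degree c - 1 of an element of V c. *)

Record gerstenhaber_algebra (k : comPzRingType) (V : nat -> lmodType k) :=
    GerstenhaberAlgebra {
  ga_one : V 0;
  ga_cup : forall p q r : nat, V p -> V q -> V r;
  ga_brk : forall p q r : nat, V p -> V q -> V r;
  ga_cup_bilinear : graded_bilinear (fun p q r => r == p + q)%N ga_cup;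
  ga_brk_bilinear : graded_bilinear (fun p q r => p + q == r.+1)%N ga_brk;
  ga_cupA : forall p q r u (f : V p) (g : V q) (h : V r),
    ga_cup u (ga_cup (p + q)%N f g) h = ga_cup u f (ga_cup (q + r)%N g h);
  ga_cup1l : forall p (f : V p), ga_cup p ga_one f = f;
  ga_cup1r : forall p (f : V p), ga_cup p f ga_one = f;
  ga_cupC : forall p q r (f : V p) (g : V q),
    ga_cup r f g = (-1) ^+ (p * q) *: ga_cup r g f;
  ga_brkC : forall p q r (f : V p) (g : V q),
    ga_brk r f g = - ((-1) ^+ (p.+1 * q.+1) *: ga_brk r g f);
  ga_jacobi : forall p q r u (f : V p) (g : V q) (h : V r),
    ga_brk u f (ga_brk (q + r).-1 g h)
      = ga_brk u (ga_brk (p + q).-1 f g) h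
        + (-1) ^+ (p.+1 * q.+1) *: ga_brk u g (ga_brk (p + r).-1 f h);
  ga_leibniz : forall c p q u (h : V c) (f : V p) (g : V q),
    ga_brk u h (ga_cup (p + q)%N f g)
      = ga_cup u (ga_brk (c + p).-1 h f) g
        + (-1) ^+ (c.+1 * p) *: ga_cup u f (ga_brk (c + q).-1 h g)
}.
Arguments ga_cup {k V} g {p q} r _ _ : rename.
Arguments ga_brk {k V} g {p q} r _ _ : rename.

Record gerstenhaber_module (k : comPzRingType) (V : nat -> lmodType k)
    (A : gerstenhaber_algebra V) (Om : nat -> lmodType k) := GerstenhaberModule {
  gm_cap : forall p n m : nat, V p -> Om n -> Om m;
  gm_lie : forall p n m : nat, V p -> Om n -> Om m;
  gm_cap_bilinear : graded_bilinear (fun p n m => n == p + m)%N gm_cap;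
  gm_lie_bilinear : graded_bilinear (fun p n m => n.+1 == p + m)%N gm_lie;
  gm_capA : forall p q n m (f : V p) (g : V q) (x : Om n),
    gm_cap m (ga_cup A (p + q)%N f g) x = gm_cap m f (gm_cap (n - q)%N g x);
  gm_cap1 : forall n (x : Om n), gm_cap n (ga_one A) x = x;
  gm_lie_brk : forall p q n m (f : V p) (g : V q) (x : Om n),
    gm_lie m (ga_brk A (p + q).-1 f g) x
      = gm_lie m f (gm_lie (n.+1 - q)%N g x)
        - (-1) ^+ (p.+1 * q.+1) *: gm_lie m g (gm_lie (n.+1 - p)%N f x);
  gm_mixed : forall p q n m (f : V p) (g : V q) (x : Om n),
    gm_cap m g (gm_lie (n.+1 - p)%N f x)
      = gm_cap m (ga_brk A (q + p).-1 g f) x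
        + (-1) ^+ (p.+1 * q) *: gm_lie m f (gm_cap (n - q)%N g x)
}.
Arguments gm_cap {k V A Om} g {p n} m _ _ : rename.
Arguments gm_lie {k V A Om} g {p n} m _ _ : rename.

Record bv_module (k : comPzRingType) (V : nat -> lmodType k)
    (A : gerstenhaber_algebra V) (Om : nat -> lmodType k) := BVModule {
  bv_gm :> gerstenhaber_module A Om;
  bv_B : forall n m : nat, Om n -> Om m;
  bv_B_linear : graded_linear (fun n m => m == n.+1) bv_B;
  bv_BB : forall n m (x : Om n), bv_B m (bv_B n.+1 x) = 0;
  bv_lie : forall p n m (f : V p) (x : Om n),
    gm_lie bv_gm m f x
      = bv_B m (gm_cap bv_gm (n - p)%N f x)
        - (-1) ^+ p *: gm_cap bv_gm m f (bv_B n.+1 x)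
}.
Arguments bv_B {k V A Om} b {n} m _ : rename.

Record nc_calculus (k : comPzRingType) (V Om : nat -> lmodType k) := NcCalculus {
  nc_alg : gerstenhaber_algebra V;
  nc_mod : bv_module nc_alg Om
}.

(* The operations of the calculus are induced by those on (co)chains.  Since
   the cyclic differential lives on Mbar, [ind_B] says that the canonical map
   from the homology of M to that of Mbar sends [bv_B h] to the class of the
   cyclic differential of the image of a cycle representing h. *)
Record induced_calculus (k : comPzRingType) (O : mult_operad k)
    (M : cyclic_comp_module O) (C : nc_calculus (HO O) (HM M)) : Prop :=
    InducedCalculus {
  ind_cup : forall p q r (a : HO O p) (b : HO O q) (f : O p) (g : O q),
    represents a f -> represents b g ->
    represents (ga_cup (nc_alg C) r a b) (ocup r f g);
  ind_brk : forall p q r (a : HO O p) (b : HO O q) (f : O p) (g : O q),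
    represents a f -> represents b g ->
    represents (ga_brk (nc_alg C) r a b) (obrk r f g);
  ind_cap : forall p n m (a : HO O p) (h : HM M n) (f : O p) (x : M n),
    represents a f -> represents h x ->
    represents (gm_cap (nc_mod C) m a h) (ccap M m f x);
  ind_lie : forall p n m (a : HO O p) (h : HM M n) (f : O p) (x : M n),
    represents a f -> represents h x ->
    represents (gm_lie (nc_mod C) m a h) (clie M m f x);
  ind_B : forall n m (h : HM M n) (x : M n), represents h x ->
    exists2 y : M m, represents (bv_B (nc_mod C) m h) y
                   & Mpi y = qmap (cB M m) (Mpi x)
}.

(* Main.v *)
(** All operations are suspended: rescaling the partial compositions, the
    actions and the rotation t by signs leaves only Koszul signs for the degrees
    p - 1, and turns b into mu.0 + ... + mu.(n-1) + mu.0 t, B into e.0 N with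
    N = 1 + t + ... + t^n, and L_f into the sum of all cyclic insertions of f.

    On the operad side the brace f{g, h} controls everything: the pre-Lie
    identity gives the Jacobi identity and the graded commutativity of the cup
    product mu{g, f}, and the formula for h{f, g}{l} with l = mu gives the
    Leibniz rule, with h{f, g} as homotopy.

    On the module side the identity T_i b = \sum_(a >= i) mu.a T_i +
    \sum_(a < i) mu.a T_(i+1) for T_i = 1 + ... + t^(i-1) moves b through all
    operators.  Up to sign S_f is e.0 A with A = \sum_i f.i T_i.  Since
    (1 - t) A is L_f - f.0 N and b e.0 = (1 - t) - e.0 b', the Cartan formula
    L_f = [B, iota_f] + [b, S_f] - S_(delta f) holds for all cochains f already
    on M, before normalisation; only [B, S_f] = 0 and B B = 0 need normalised
    chains.  So B induces a map on the homology of M, and its square vanishes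
    there because B B is the Lie derivative along the unit e, which the Cartan
    formula makes null-homotopic on cycles.

    Finally \sum_i (f o_i g).0 T_i is a homotopy for the relation between L_f
    and iota_g; the relation between L_f and L_g follows formally. *)

From HB Require Import structures.
Require Import Defs.
From mathcomp Require Import all_boot all_order all_algebra boolp zify.

Set Implicit Arguments.
Unset Strict Implicit.
Unset Printing Implicit Defensive.

Import GRing.Theory.
Local Open Scope ring_scope.

(** * Equalities in abelian groups and signs *)

(** Degrees cause most of the case distinctions. Operations have components between all degrees, the
    mismatched ones being 0, and an intermediate degree such as p + q - 1 is written as a truncated
    predecessor. Wherever truncation falsifies a degree, or a sign computed from it, the terms
    concerned are shown to vanish or to cancel, so that most identities can be stated for all
    degrees at once.

    The calculus is built on the homology of M and on the cohomology of all cochains. This works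
    because B, taken as e.0 N without a factor 1 - t, anticommutes with b already on M, and because
    the homotopies live there too; no comparison with the homology of the normalised complexes
    enters. The price is that B B is only shown to send cycles to boundaries.

    On homology the Lie derivative is [B, iota_f] by definition, and the Cartan formula serves to
    identify it with the map represented by L_f. *)

Section ZmodTactic.
Variable V : zmodType.

Inductive zexpr := ZAtom of nat | ZZero | ZOpp of zexpr | ZAdd of zexpr & zexpr.

Fixpoint zeval (s : seq V) e : V :=
  match e with
  | ZAtom n => nth 0 s n
  | ZZero => 0
  | ZOpp e => - zeval s e
  | ZAdd e1 e2 => zeval s e1 + zeval s e2
  end.

Fixpoint zcoef e (n : nat) : int :=
  match e with
  | ZAtom m => (m == n)%:R
  | ZZero => 0
  | ZOpp e => - zcoef e n
  | ZAdd e1 e2 => zcoef e1 n + zcoef e2 n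
  end.

(** An expression depends only on its integer coefficients, so [zmod_correct] can compare
    coefficients by computation. *)
Lemma zevalE s e : zeval s e = \sum_(n < size s) s`_n *~ zcoef e n.
Proof.
elim: e => [m||e IH|e1 IH1 e2 IH2] /=.
- have [lt_m|ge_m] := ltnP m (size s); last first.
    rewrite nth_default // big1 // => n _.
    by rewrite (gtn_eqF (leq_trans (ltn_ord n) ge_m)).
  rewrite (bigD1 (Ordinal lt_m)) //= eqxx big1 ?addr0 // => n ne_nm.
  by rewrite eq_sym -[m]/(val (Ordinal lt_m)) val_eqE (negPf ne_nm).
- by rewrite big1.
- by rewrite IH -sumrN; apply: eq_bigr => n _; rewrite mulrNz.
- by rewrite IH1 IH2 -big_split; apply: eq_bigr => n _; rewrite mulrzDr.
Qed.

Lemma zmod_correct s e1 e2 :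
  all (fun n => zcoef e1 n == zcoef e2 n) (iota 0 (size s)) ->
  zeval s e1 = zeval s e2.
Proof.
move=> /allP eq12; rewrite !zevalE; apply: eq_bigr => n _; congr (_ *~ _).
by apply/eqP/eq12; rewrite mem_iota /=.
Qed.

End ZmodTactic.

(** The second branch identifies atoms that agree only up to unification, for instance when a degree
    is displayed in two convertible forms. *)
Ltac zmod_index a s :=
  match s with
  | a :: _ => constr:(0%N)
  | ?b :: _ => let _ := match goal with _ => unify a b end in constr:(0%N)
  | _ :: ?s' => let n := zmod_index a s' in constr:(n.+1)
  end.

Ltac zmod_atoms e s :=
  match e with
  | @GRing.add _ ?a ?b => let s1 := zmod_atoms a s in zmod_atoms b s1
  | @GRing.opp _ ?a => zmod_atoms a s
  | @GRing.zero _ => s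
  | _ => match s with
         | _ => let _ := zmod_index e s in s
         | _ => constr:(e :: s)
         end
  end.

Ltac zmod_reify e s :=
  match e with
  | @GRing.add _ ?a ?b =>
      let ra := zmod_reify a s in let rb := zmod_reify b s in constr:(ZAdd ra rb)
  | @GRing.opp _ ?a => let ra := zmod_reify a s in constr:(ZOpp ra)
  | @GRing.zero _ => constr:(ZZero)
  | _ => let n := zmod_index e s in constr:(ZAtom n)
  end.

(* Decides equalities which hold in every abelian group. *)
Ltac zmod :=
  match goal with
  | |- @eq ?V ?a ?b =>
      let s0 := zmod_atoms a (@nil V) in
      let s := zmod_atoms b s0 in
      let ra := zmod_reify a s in
      let rb := zmod_reify b s in
      exact: (@zmod_correct _ s ra rb isT)
  end.

Lemma sgrE (R : pzRingType) n : (-1) ^+ n = (if odd n then -1 else 1) :> R.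
Proof. by rewrite -signr_odd; case: odd. Qed.


(** * The suspended operad *)

Section NatSums.
Context {V : zmodType}.
Implicit Types F G : nat -> V.

Lemma sum_shift F G a b a' b' : (b - a = b' - a')%N ->
    (forall i, (i < b - a)%N -> F (i + a)%N = G (i + a')%N) ->
  \sum_(a <= i < b) F i = \sum_(a' <= i < b') G i.
Proof.
move=> eq_len eqFG; rewrite -[a]add0n -[a']add0n !big_addn -eq_len.
by apply: eq_big_nat => i /andP[_ lt_i]; apply: eqFG.
Qed.

Lemma sum_nat0 F a b : (forall i, (a <= i < b)%N -> F i = 0) ->
  \sum_(a <= i < b) F i = 0.
Proof. by move=> F0; rewrite big_nat; apply: big1 => i; apply: F0. Qed.

Lemma sum_triangle (F : nat -> nat -> V) a n :
  \sum_(a <= i < n) \sum_(a <= j < i) F i j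
    = \sum_(a <= j < n) \sum_(j.+1 <= i < n) F i j.
Proof.
elim: n => [|n IHn]; first by rewrite !big_geq.
have [lt_na|le_an] := ltnP n a; first by rewrite !big_geq.
rewrite big_nat_recr //= IHn [in RHS]big_nat_recr //= [in RHS](big_geq (leqnn _)).
rewrite addr0 -big_split; apply: eq_big_nat => j /andP[_ lt_jn] /=.
by rewrite big_nat_recr.
Qed.

Lemma sum_split F a b c : (a <= b)%N -> (b <= c)%N ->
  \sum_(a <= i < c) F i = \sum_(a <= i < b) F i + \sum_(b <= i < c) F i.
Proof. by move=> ab bc; apply: big_cat_nat. Qed.

End NatSums.

Lemma linear_fun0 (k : comPzRingType) (U V : lmodType k) (f : U -> V) :
  linear f -> f 0 = 0.
Proof. by move=> lin; have := lin (-1) 0 0; rewrite addr0 !scaleN1r oppr0 addNr. Qed.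

Lemma eq_sign (R : pzRingType) m n : odd m = odd n -> (-1) ^+ m = (-1) ^+ n :> R.
Proof. by move=> eq_mn; rewrite -signr_odd eq_mn signr_odd. Qed.

(* Proves an equality of signs from the equations between degrees in the
   context, whose parities are compared by case analysis. *)
Ltac parity :=
  rewrite -?exprD; apply: eq_sign;
  repeat match goal with
  | H : @eq nat _ _ |- _ =>
      move/(congr1 odd): H; rewrite ?(oddD, oddM, oddS) /=
  | H : _ |- _ => clear H
  end;
  rewrite ?(oddD, oddM, oddS) /=;
  repeat match goal with |- context [odd ?x] => case: (odd x) => //= end.

Section SignedOperad.
Context {k : comPzRingType} (O : operad k).

(* The partial compositions of the operadic suspension, with positions numbered
   from 0: the only remaining signs are Koszul signs for the degrees p - 1.  The
   definition is locked to keep unification from seeing the scaling. *)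
Fact oc_key : unit. Proof. exact: tt. Qed.
Definition oc p q r i (f : O p) (g : O q) : O r :=
  locked_with oc_key ((-1) ^+ (q.+1 * i) *: ocomp O r i.+1 f g).

Lemma ocE p q r i (f : O p) (g : O q) :
  oc r i f g = (-1) ^+ (q.+1 * i) *: ocomp O r i.+1 f g.
Proof. by rewrite /oc unlock. Qed.

(** The Koszul sign of elements of shifted degrees p - 1 and q - 1. *)
Definition sg p q : k := (-1) ^+ (p.+1 * q.+1).

Lemma sgC p q : sg p q = sg q p.
Proof. by rewrite /sg mulnC. Qed.

Lemma sgK p q (V : lmodType k) (v : V) : sg p q *: (sg p q *: v) = v.
Proof. by rewrite scalerA -expr2 sqrr_sign scale1r. Qed.

Lemma oc_linear p q r i (f : O p) : linear (@oc p q r i f).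
Proof.
move=> a u v; rewrite !ocE (gb_linearr (ocomp_bilinear O i.+1)) scalerDr.
by rewrite !scalerA mulrC.
Qed.
HB.instance Definition _ p q r i f :=
  GRing.isLinear.Build k (O q) (O r) *:%R (@oc p q r i f) (@oc_linear p q r i f).

(** Flipping the arguments allows linearity in the first one to be registered as a structure, which
    [linearD], [linear_sum] and the like then find. The other flipped copies below, such as [cirl],
    [bracem], [bll] or [windingl], serve the same purpose. *)
Definition ocl p q r i g f := @oc p q r i f g.
Lemma ocl_linear p q r i (g : O q) : linear (@ocl p q r i g).
Proof.
move=> a u v; rewrite /ocl !ocE (gb_linearl (ocomp_bilinear O i.+1)) scalerDr.
by rewrite !scalerA mulrC.
Qed.
HB.instance Definition _ p q r i g :=
  GRing.isLinear.Build k (O p) (O r) *:%R (@ocl p q r i g) (@ocl_linear p q r i g).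

Lemma oclE p q r i (f : O p) (g : O q) : oc r i f g = ocl r i g f.
Proof. by []. Qed.

Lemma oc_deg p q r i (f : O p) (g : O q) : (p + q)%N <> r.+1 -> oc r i f g = 0.
Proof.
move=> /eqP neq; rewrite !ocE (gb_deg (ocomp_bilinear O i.+1)) ?scaler0 //.
Qed.

Lemma oc_out p q r i (f : O p) (g : O q) : (p <= i)%N -> oc r i f g = 0.
Proof. by move=> le_pi; rewrite !ocE ocomp_out ?scaler0 // ltnS le_pi. Qed.

Lemma ocompZl a p q r i (f : O p) (g : O q) :
  ocomp O r i (a *: f) g = a *: ocomp O r i f g.
Proof.
have lin := gb_linearl (ocomp_bilinear O i) p q r g.
by have := lin a f 0; rewrite !(addr0, linear_fun0 lin).
Qed.

Lemma ocompZr a p q r i (f : O p) (g : O q) :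
  ocomp O r i f (a *: g) = a *: ocomp O r i f g.
Proof.
have lin := gb_linearr (ocomp_bilinear O i) p q r f.
by have := lin a g 0; rewrite !(addr0, linear_fun0 lin).
Qed.

(** For nested insertions the suspension signs cancel completely. The output degree u is left free:
    when it does not match, both sides are 0. *)
Lemma oc_in p q r s t u i j (f : O p) (g : O q) (h : O r) :
    (p + q = s.+1)%N -> (q + r = t.+1)%N -> (i <= j < i + q)%N ->
  oc u j (oc s i f g) h = oc u i f (oc t (j - i) g h).
Proof.
move=> Hs Ht Hij; have [Hu|Hu] := eqVneq (s + r)%N u.+1; last first.
  by rewrite !(@oc_deg _ _ u) //; lia.
rewrite !ocE !ocompZl !ocompZr !scalerA.
rewrite (ocompA_in (t := t)) //; [|lia|lia].
rewrite subSS; congr (_ *: _).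
have [d ->] : exists d, j = (i + d)%N by exists (j - i)%N; lia.
rewrite addKn; parity.
Qed.
Arguments oc_in {p q r s t u i j f g h}.

Lemma oc_lt p q r s t u i j (f : O p) (g : O q) (h : O r) :
    (p + q = s.+1)%N -> (p + r = t.+1)%N -> (j < i)%N ->
  oc u j (oc s i f g) h = sg q r *: oc u (i + r).-1 (oc t j f h) g.
Proof.
move=> Hs Ht Hij; have [Hu|Hu] := eqVneq (s + r)%N u.+1; last first.
  by rewrite !(@oc_deg _ _ u) ?scaler0 //; lia.
rewrite !ocE /sg !ocompZl !scalerA.
rewrite (ocompA_lt (t := t)) //.
have -> : (i.+1 + r).-1 = (i + r).-1.+1 by lia.
have [d ->] : exists d, i = d.+1 by exists i.-1; lia.
rewrite addSn /=; congr (_ *: _); parity.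
Qed.
Arguments oc_lt {p q r s t u i j f g h}.

(** This is [oc_lt] read backwards, since the Koszul sign is symmetric and squares to 1. *)
Lemma oc_gt p q r s t u i j (f : O p) (g : O q) (h : O r) :
    (p + q = s.+1)%N -> (p + r = t.+1)%N -> (i + q <= j)%N ->
  oc u j (oc s i f g) h = sg q r *: oc u i (oc t (j - q).+1 f h) g.
Proof.
move=> Hs Ht Hij; rewrite (oc_lt (i := (j - q).+1) Ht Hs); last by lia.
by rewrite sgC sgK; congr (oc _ _ _ _); lia.
Qed.
Arguments oc_gt {p q r s t u i j f g h}.

Definition cir p q r (f : O p) (g : O q) : O r := \sum_(0 <= i < p) oc r i f g.

Lemma cir_linear p q r (f : O p) : linear (@cir p q r f).
Proof.
move=> a u v; rewrite scaler_sumr -big_split; apply: eq_bigr => i _ /=.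
by rewrite linearP.
Qed.
HB.instance Definition _ p q r f :=
  GRing.isLinear.Build k (O q) (O r) *:%R (@cir p q r f) (@cir_linear p q r f).

Definition cirl p q r g f := @cir p q r f g.
Lemma cirl_linear p q r (g : O q) : linear (@cirl p q r g).
Proof.
move=> a u v; rewrite scaler_sumr -big_split; apply: eq_bigr => i _ /=.
by rewrite !oclE linearP.
Qed.
HB.instance Definition _ p q r g :=
  GRing.isLinear.Build k (O p) (O r) *:%R (@cirl p q r g) (@cirl_linear p q r g).

Lemma cirlE p q r (f : O p) (g : O q) : cir r f g = cirl r g f.
Proof. by []. Qed.

Lemma cir0l p q r (g : O q) : cir r (0 : O p) g = 0.
Proof. by rewrite cirlE linear0. Qed.

Lemma cir_deg p q r (f : O p) (g : O q) : (p + q)%N <> r.+1 -> cir r f g = 0.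
Proof. by move=> Hr; rewrite /cir big1 // => i _; rewrite oc_deg. Qed.

Lemma cir_arity0 q r (f : O 0) (g : O q) : cir r f g = 0.
Proof. by rewrite /cir big_geq. Qed.

(* The brace h{f, g}, with f inserted to the left of g. *)
Definition brace p q r u (h : O r) (f : O p) (g : O q) : O u :=
  \sum_(0 <= i < r) \sum_(i + p <= j < (r + p).-1)
    oc u j (oc (r + p).-1 i h f) g.

Lemma braceE p q r s u (h : O r) (f : O p) (g : O q) : (r + p = s.+1)%N ->
  brace u h f g
    = \sum_(0 <= i < r) \sum_(i + p <= j < s) oc u j (oc s i h f) g.
Proof. by move=> Hs; rewrite /brace Hs. Qed.

(** Sort the terms by where [h] lands in f o_i g: inside [g] they form the nested product, to the
    right of [g] the brace f{g, h}, and to the left of [g], after exchanging the two insertions, the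
    brace f{h, g}. *)
Lemma cir_prelie p q r u (f : O p) (g : O q) (h : O r) :
  cir u (cir (p + q).-1 f g) h
    = cir u f (cir (q + r).-1 g h) + brace u f g h + sg q r *: brace u f h g.
Proof.
have [p0|p_gt0] := posnP p.
  (* For p = 0 every term vanishes; for p > 0 the degrees [(p + q).-1] and [(p + r).-1] are honest
     predecessors. *)
  by subst p; rewrite /brace !cir_arity0 cir0l !big_geq ?scaler0 ?addr0.
have [s Hs] : exists s, (p + q = s.+1)%N by exists (p + q).-1; lia.
have [w Hw] : exists w, (p + r = w.+1)%N by exists (p + r).-1; lia.
rewrite (braceE _ _ _ _ Hs) (braceE _ _ _ _ Hw) Hs /=.
rewrite [LHS]/cir.
under [LHS]eq_bigr do rewrite oclE /cir linear_sum /=.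
rewrite [LHS]exchange_big /=.
have split_i i : (0 <= i < p)%N ->
  \sum_(0 <= j < s) ocl u j h (oc s i f g)
    = \sum_(0 <= j < i) sg q r *: oc u (i + r).-1 (oc w j f h) g
      + oc u i f (cir (q + r).-1 g h)
      + \sum_(i + q <= j < s) oc u j (oc s i f g) h.
  move=> Hi; rewrite (sum_split _ (b := i)); [|lia|lia].
  rewrite (sum_split _ (a := i) (b := (i + q)%N)); [|lia|lia].
  rewrite addrA; congr (_ + _ + _).
    by apply: eq_big_nat => j Hj; rewrite -oclE (oc_lt Hs Hw).
  rewrite /cir linear_sum; apply: sum_shift => [|j Hj]; first by lia.
  rewrite -oclE (oc_in (t := (q + r).-1) Hs); try by lia.
  by rewrite addnK addn0.
rewrite (eq_big_nat _ _ split_i) !big_split /= sum_triangle.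
have -> : \sum_(0 <= j < p) \sum_(j.+1 <= i < p) sg q r *: oc u (i + r).-1 (oc w j f h) g
    = sg q r *: \sum_(0 <= i < p) \sum_(i + r <= j < w) oc u j (oc w i f h) g.
  rewrite scaler_sumr; apply: eq_big_nat => j Hj.
  rewrite scaler_sumr; apply: sum_shift => [|i Hi]; first by lia.
  by congr (_ *: oc _ _ _ _); lia.
rewrite -/(cir u f (cir (q + r).-1 g h)).
zmod.
Qed.

End SignedOperad.

Arguments oc_in {k O p q r s t u i j f g h}.
Arguments oc_lt {k O p q r s t u i j f g h}.
Arguments oc_gt {k O p q r s t u i j f g h}.

(** * Braces *)

Section Braces.
Context {k : comPzRingType} (O : operad k).

(** The inner sum of a brace, isolated so that one more circle product can first be pushed through
    it alone. *)
Definition ocge n q r c (x : O n) (g : O q) : O r :=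
  \sum_(c <= j < n) oc r j x g.

Lemma ocge_linear n q r c (x : O n) : linear (@ocge n q r c x).
Proof.
move=> a u v; rewrite scaler_sumr -big_split; apply: eq_bigr => i _ /=.
by rewrite linearP.
Qed.
HB.instance Definition _ n q r c x :=
  GRing.isLinear.Build k (O q) (O r) *:%R (@ocge n q r c x) (@ocge_linear n q r c x).

Definition ocgel n q r c g x := @ocge n q r c x g.
Lemma ocgel_linear n q r c (g : O q) : linear (@ocgel n q r c g).
Proof.
move=> a u v; rewrite scaler_sumr -big_split; apply: eq_bigr => i _ /=.
by rewrite !oclE linearP.
Qed.
HB.instance Definition _ n q r c g :=
  GRing.isLinear.Build k (O n) (O r) *:%R (@ocgel n q r c g) (@ocgel_linear n q r c g).

Lemma ocgelE n q r c (x : O n) (g : O q) : ocge r c x g = ocgel r c g x.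
Proof. by []. Qed.

Lemma brace_ocge p q r u (h : O r) (f : O p) (g : O q) :
  brace u h f g = \sum_(0 <= i < r) ocge u (i + p) (oc (r + p).-1 i h f) g.
Proof. by []. Qed.

Lemma brace_linear p q r u h f : linear (@brace _ O p q r u h f).
Proof.
move=> a v w; rewrite !brace_ocge scaler_sumr -big_split; apply: eq_bigr => i _ /=.
by rewrite linearP.
Qed.
HB.instance Definition _ p q r u h f :=
  GRing.isLinear.Build k (O q) (O u) *:%R (@brace _ O p q r u h f)
    (@brace_linear p q r u h f).

Definition bracem p q r u h g f := @brace _ O p q r u h f g.
Lemma bracem_linear p q r u h g : linear (@bracem p q r u h g).
Proof.
move=> a v w; rewrite /bracem !brace_ocge scaler_sumr -big_split.
by apply: eq_bigr => i _ /=; rewrite !ocgelE !linearP.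
Qed.
HB.instance Definition _ p q r u h g :=
  GRing.isLinear.Build k (O p) (O u) *:%R (@bracem p q r u h g)
    (@bracem_linear p q r u h g).

Definition bracel p q r u f g h := @brace _ O p q r u h f g.
Lemma bracel_linear p q r u f g : linear (@bracel p q r u f g).
Proof.
move=> a v w; rewrite /bracel !brace_ocge scaler_sumr -big_split.
by apply: eq_bigr => i _ /=; rewrite !oclE !ocgelE !linearP.
Qed.
HB.instance Definition _ p q r u f g :=
  GRing.isLinear.Build k (O r) (O u) *:%R (@bracel p q r u f g)
    (@bracel_linear p q r u f g).

Lemma bracemE p q r u (h : O r) (f : O p) (g : O q) : brace u h f g = bracem u h g f.
Proof. by []. Qed.

Lemma bracelE p q r u (h : O r) (f : O p) (g : O q) : brace u h f g = bracel u f g h.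
Proof. by []. Qed.

Lemma brace0l p q r u (f : O p) (g : O q) : brace u (0 : O r) f g = 0.
Proof. by rewrite bracelE linear0. Qed.

Lemma brace0m p q r u (h : O r) (g : O q) : brace u h (0 : O p) g = 0.
Proof. by rewrite bracemE linear0. Qed.

Lemma brace_arity0 p q u (h : O 0) (f : O p) (g : O q) : brace u h f g = 0.
Proof. by rewrite /brace big_geq. Qed.

Lemma brace_low p q r u (h : O r) (f : O p) (g : O q) :
  (r + p <= 1)%N -> brace u h f g = 0.
Proof.
move=> Hrp; rewrite /brace big1 // => i _; rewrite big_geq //; lia.
Qed.

(** Either [l] goes into [g], or into another input e of [x]. In the second case exchange the
    insertions: for e >= c, inserting [g] into x o_e l at all positions from c on also counts those
    inside [l], which the last term removes. *)
Lemma cir_ocge n q s a b v c (x : O n) (g : O q) (l : O s) :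
    (n + q = a.+1)%N -> (n + s = b.+1)%N -> (c <= n)%N ->
  cir v (ocge a c x g) l
    = ocge v c x (cir (q + s).-1 g l)
      + sg q s *: (\sum_(0 <= e < c) ocge v (c + s).-1 (oc b e x l) g
                   + \sum_(c <= e < n) ocge v c (oc b e x l) g
                   - ocge v c x (cir (s + q).-1 l g)).
Proof.
move=> Ha Hb le_cn.
pose Y j e := oc v j (oc b e x l) g.
have ->: cir v (ocge a c x g) l
    = \sum_(c <= j < n) (oc v j x (cir (q + s).-1 g l)
      + sg q s *: (\sum_(0 <= e < c) Y (j + s).-1 e + \sum_(c <= e < j) Y (j + s).-1 e
                     + \sum_(j.+1 <= e < n) Y j e)).
  rewrite cirlE /ocge linear_sum; apply: eq_big_nat => j Hj /=.
  rewrite -cirlE [LHS]/cir (sum_split _ (b := j)); [|lia|lia].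
  rewrite (sum_split _ (a := j) (b := (j + q)%N)); [|lia|lia].
  rewrite addrCA; congr (_ + _).
    rewrite linear_sum; apply: sum_shift => [|i Hi]; first by lia.
    rewrite (oc_in (t := (q + s).-1) Ha); try by lia.
    by rewrite addnK addn0.
  rewrite scalerDr !scaler_sumr -(sum_split _ (b := c)) //; last lia.
  rewrite scaler_sumr; congr (_ + _).
    by apply: eq_big_nat => e He; rewrite (oc_lt Ha Hb) //; lia.
  apply: sum_shift => [|e He]; first by lia.
  rewrite (oc_gt Ha Hb); last by lia.
  by congr (_ *: oc _ _ (oc _ _ _ _) _); lia.
rewrite big_split /= -scaler_sumr; congr (_ + _ *: _).
rewrite !big_split /= -!addrA; congr (_ + _).
  rewrite exchange_big /=; apply: eq_big_nat => e He.
  by apply: sum_shift => [|j Hj]; [lia|congr (oc _ _ _ _); lia].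
(* For each e >= c, the positions of [g] in x o_e l are now split into those left of [l], inside [l]
   and right of [l]. *)
rewrite [X in _ - X]/ocge -sumrB [X in X + _]sum_triangle -[X in _ + X]sum_triangle.
rewrite -big_split /=; apply: eq_big_nat => e He.
rewrite [in RHS]/ocge [in RHS](sum_split _ (b := e)); [|lia|lia].
rewrite [in RHS](sum_split _ (a := e) (b := (e + s)%N)); [|lia|lia].
have -> : \sum_(e <= j < e + s) oc v j (oc b e x l) g = oc v e x (cir (s + q).-1 l g).
  rewrite linear_sum; apply: sum_shift => [|j Hj]; first by lia.
  rewrite (oc_in (t := (s + q).-1) Hb); try by lia.
  by rewrite addnK addn0.
have -> : \sum_(e.+1 <= j < n) Y (j + s).-1 e = \sum_(e + s <= j < b) oc v j (oc b e x l) g.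
  by apply: sum_shift => [|j Hj]; [lia|congr (oc _ _ _ _); lia].
zmod.
Qed.

(** The product inserts [l] into [g], into [f] or into a free input of [h]. The last kind is (h o
    l){f, g} without the terms where [f] and [g] both lie in [l], or only one of them does; these
    account for the three subtracted terms. *)
Lemma cir_brace p q r s u v (h : O r) (f : O p) (g : O q) (l : O s) :
    v = ((r + p).-1 + q).-1 ->
  cir u (brace v h f g) l
    = brace u h f (cir (q + s).-1 g l)
      - sg q s *: brace u h f (cir (s + q).-1 l g)
      + sg q s *: brace u h (cir (p + s).-1 f l) g
      + sg q s *: (sg p s *: (brace u (cir (r + s).-1 h l) f g
                               - cir u h (brace ((s + p).-1 + q).-1 l f g)
                               - brace u h (cir (s + p).-1 l f) g)).
Proof.
move=> Hv; have [r0|r_gt0] := posnP r.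
  subst r; rewrite !brace_arity0 !cir_arity0 !cir0l brace0l.
  by rewrite !(scaler0, subr0, addr0).
have [ps0|ps_gt0] := posnP ((r + p).-1 + s).
  have [r1 p0 s0] : [/\ r = 1, p = 0 & s = 0]%N by split; lia.
  subst r p s v; rewrite !brace_low //.
  by rewrite cir0l !(linear0, scaler0, subr0, addr0).
have [a Ha] : exists a, (r + p = a.+1)%N by exists (r + p).-1; lia.
have [b Hb] : exists b, (a + s = b.+1)%N by exists (a + s).-1; lia.
have [d Hd] : exists d, (r + s = d.+1)%N by exists (r + s).-1; lia.
have Hbd : (d + p = b.+1)%N by lia.
have Hv' : v = (a + q).-1 by lia.
have [t Ht] : exists t, t = (p + s).-1 by exists (p + s).-1.
have Ht' : (s + p).-1 = t by lia.
rewrite Hd -Ht Ht' /=.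
pose G e i := ocge u (i + p) (oc b i (oc d e h l) f) g.
(* For p = s = 0 the degree t is truncated to 0, so [(r + t).-1] is not b; the elements [y] to which
   this is applied are then 0. *)
have deg_t (y : O t) c i : ((p + s)%N = 0 -> y = 0) ->
    ocge u c (oc (r + t).-1 i h y) g = ocge u c (oc b i h y) g.
  have [/[swap]/[apply] ->|ps] := posnP (p + s).
    by rewrite !linear0 !ocgelE !linear0.
  by have -> : (r + t).-1 = b by lia.
(* The position of [f] in h o_e l is right of [l], left of [l], or inside it; in the last case [g]
   lies inside [l] as well, or to its right. *)
have split_d : \sum_(0 <= i < d) ocge u (i + p) (oc b i (cir d h l) f) g
    = \sum_(0 <= i < r) \sum_(0 <= e < i) G e (i + s).-1
      + \sum_(0 <= i < r) \sum_(i.+1 <= e < r) G e i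
      + cir u h (brace (t + q).-1 l f g)
      + \sum_(0 <= i < r) ocge u (i + t) (oc b i h (cir t l f)) g.
  rewrite sum_triangle -[X in _ + X + _ + _]sum_triangle /cir -!big_split /=.
  under eq_bigr do rewrite oclE ocgelE !linear_sum /=.
  rewrite exchange_big /=; apply: eq_big_nat => e He.
  rewrite -/(G e _) (sum_split _ (b := e)); [|lia|lia].
  rewrite (sum_split _ (a := e) (b := (e + s)%N)); [|lia|lia].
  have -> : \sum_(e + s <= i < d) G e i = \sum_(e.+1 <= i < r) G e (i + s).-1.
    by apply: sum_shift => [|i Hi]; [lia|congr (G _ _); lia].
  have -> : \sum_(e <= i < e + s) G e i
      = oc u e h (brace (t + q).-1 l f g) + ocge u (e + t) (oc b e h (cir t l f)) g.
    rewrite ocgelE /brace /cir !linear_sum -big_split Ht' /=.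
    apply: sum_shift => [|i Hi]; first by lia.
    rewrite /G (oc_in (t := t) Hd) ?addnK ?addn0; [|lia|lia].
    rewrite -ocgelE {1}/ocge (sum_split _ (b := (e + t)%N)); [|lia|lia].
    congr (_ + _); rewrite linear_sum; apply: sum_shift => [|j Hj]; first by lia.
    rewrite (oc_in (t := (t + q).-1) (q := t)); [|lia|lia|lia].
    by congr (oc _ _ _ (oc _ _ _ _)); lia.
  zmod.
have sum_t (y : O t) : ((p + s)%N = 0 -> y = 0) ->
    \sum_(0 <= i < r) ocge u (i + t) (oc (r + t).-1 i h y) g
      = \sum_(0 <= i < r) ocge u (i + t) (oc b i h y) g.
  by move=> y0; apply: eq_bigr => i _; apply: deg_t.
(* Here r = 1 and p = q = 0, and v is truncated. The braces of [h] with [f] in front vanish, and the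
   three remaining terms cancel. *)
have [aq0|aq_gt0] := posnP (a + q).
  rewrite !(brace_low _ h f); [|lia..].
  have -> : cir t f l = 0 by rewrite /cir big_geq //; lia.
  rewrite brace0m cir0l !brace_ocge Hbd split_d sum_t; last first.
    by move=> ps0; rewrite /cir big_geq //; lia.
  rewrite -brace_ocge -Ht'.
  have -> : \sum_(0 <= i < r) \sum_(0 <= e < i) G e (i + s).-1 = 0.
    by apply: sum_nat0 => i Hi; rewrite big_geq //; lia.
  have -> : \sum_(0 <= i < r) \sum_(i.+1 <= e < r) G e i = 0.
    by apply: sum_nat0 => i Hi; rewrite big_geq //; lia.
  rewrite !(scaler0, oppr0, addr0, add0r, subr0).
  have XY0 (x y : O u) : x + y - x - y = 0 by zmod.
  by rewrite XY0 !scaler0.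
have Haq : (a + q = v.+1)%N by lia.
rewrite !brace_ocge Ha Hbd /=.
rewrite cirlE linear_sum /=.
have -> : \sum_(0 <= i < r) cirl u l (ocge v (i + p) (oc a i h f) g)
  = \sum_(0 <= i < r) (ocge u (i + p) (oc a i h f) (cir (q + s).-1 g l)
      - sg q s *: ocge u (i + p) (oc a i h f) (cir (s + q).-1 l g)
      + sg q s *: ocge u (i + t) (oc b i h (cir t f l)) g
      + sg q s *: (sg p s *: (\sum_(0 <= e < i) G e (i + s).-1
                              + \sum_(i.+1 <= e < r) G e i))).
  apply: eq_big_nat => i Hi; rewrite -cirlE (cir_ocge _ _ _ _ Haq Hb); last lia.
  rewrite (sum_split _ (a := 0) (b := i)); [|lia|lia].
  have -> : \sum_(0 <= e < i) ocge u (i + p + s).-1 (oc b e (oc a i h f) l) g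
      = sg p s *: \sum_(0 <= e < i) G e (i + s).-1.
    rewrite scaler_sumr; apply: eq_big_nat => e He.
    rewrite (oc_lt Ha Hd); last lia.
    by rewrite ocgelE linearZ /= -ocgelE /G; congr (_ *: ocge _ _ _ _); lia.
  have -> : \sum_(i <= e < i + p) ocge u (i + p + s).-1 (oc b e (oc a i h f) l) g
      = ocge u (i + t) (oc b i h (cir t f l)) g.
    rewrite ocgelE /cir 2!linear_sum /=; apply: sum_shift => [|e He]; first by lia.
    rewrite (oc_in (t := t) Ha) ?addnK ?addn0 -?ocgelE; [|lia|lia].
    by congr (ocge _ _ _ _); lia.
  have -> : \sum_(i + p <= e < a) ocge u (i + p) (oc b e (oc a i h f) l) g
      = sg p s *: \sum_(i.+1 <= e < r) G e i.
    rewrite scaler_sumr; apply: sum_shift => [|e He]; first by lia.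
    rewrite (oc_gt Ha Hd); last lia.
    rewrite ocgelE linearZ /= -ocgelE /G.
    by congr (_ *: ocge _ _ (oc _ _ (oc _ _ _ _) _) _); lia.
  rewrite !(scalerDr, scalerBr, scalerN); zmod.
rewrite !sum_t; [|by move=> ?; rewrite /cir big_geq //; lia..].
rewrite split_d !big_split /= !sumrN -!scaler_sumr big_split /= -brace_ocge -Ht'.
rewrite !(scalerDr, scalerBr, scalerN); zmod.
Qed.
End Braces.

(** * The Gerstenhaber identities *)

(* Evaluates all signs by case analysis on the parities of the degrees. *)
Ltac signs :=
  rewrite ?(scalerDr, scalerBr, scalerN, scalerA, scaler0) -?exprD ?sgrE;
  rewrite ?(oddD, oddM, oddS) /=;
  repeat match goal with |- context [odd ?x] => case: (odd x) => /= end;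
  rewrite ?(mul1r, mulr1, mulN1r, mulrN1, opprK, scale1r, scaleN1r);
  rewrite ?(mul1r, mulr1, mulN1r, mulrN1, opprK, scale1r, scaleN1r).

Lemma eq_of_subr (V : zmodType) (a b c d : V) : c = d -> a - b = c - d -> a = b.
Proof. by move=> -> /eqP; rewrite subrr subr_eq0 => /eqP. Qed.

Ltac zmod_from E :=
  first [apply: (eq_of_subr E); zmod | apply: (eq_of_subr (esym E)); zmod].

Section Gerstenhaber.
Context {k : comPzRingType} (O : mult_operad k).

Notation mu := (omu O).
Notation e := (ounit O).

Lemma ocircE p q r (f : O p) (g : O q) : ocirc r f g = cir r f g.
Proof. by rewrite /ocirc big_add1; apply: eq_bigr => i _; rewrite ocE. Qed.

Lemma obrkE p q r (f : O p) (g : O q) :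
  obrk r f g = cir r f g - sg p q *: cir r g f.
Proof. by rewrite /obrk !ocircE. Qed.

Lemma odeltaE p r (f : O p) :
  odelta O r f = cir r mu f - (-1) ^+ p.+1 *: cir r f mu.
Proof. by rewrite /odelta obrkE; congr (_ - _ *: _); rewrite /sg; parity. Qed.

(* Restated with variables for the intermediate degrees, so as to apply to terms
   whose degrees are equal only up to a proof. *)
Lemma cir_prelieE p q r s t u (f : O p) (g : O q) (h : O r) :
    s = (p + q).-1 -> t = (q + r).-1 ->
  cir u (cir s f g) h
    = cir u f (cir t g h) + brace u f g h + sg q r *: brace u f h g.
Proof. by move=> -> ->; apply: cir_prelie. Qed.

Lemma cir_braceE p q r s t1 t2 t3 t4 u v (h : O r) (f : O p) (g : O q) (l : O s) :
    v = ((r + p).-1 + q).-1 -> t1 = (q + s).-1 -> t2 = (p + s).-1 ->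
    t3 = (r + s).-1 -> t4 = (t2 + q).-1 ->
  cir u (brace v h f g) l
    = brace u h f (cir t1 g l) - sg q s *: brace u h f (cir t1 l g)
      + sg q s *: brace u h (cir t2 f l) g
      + sg q s *: (sg p s *: (brace u (cir t3 h l) f g
                               - cir u h (brace t4 l f g)
                               - brace u h (cir t2 l f) g)).
Proof.
move=> Hv -> -> -> ->; rewrite (cir_brace _ _ _ _ _ Hv).
by rewrite (addnC s q) (addnC s p).
Qed.

(** After suspension the two sides of the associativity law carry opposite signs. *)
Lemma cir_mu_mu r : cir r mu mu = 0 :> O r.
Proof.
have [->|Hr] := eqVneq r 3%N; last by rewrite cir_deg //; lia.
rewrite /cir big_nat_recr //= big_nat1 !ocE muln0 muln1 scale1r omuA.
by rewrite sgrE /= scaleN1r subrr.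
Qed.

Lemma oc_mu0_unit : oc 1 0 mu e = oid O :> O 1.
Proof. by rewrite !ocE scale1r omu1l. Qed.

Lemma oc_mu1_unit : oc 1 1 mu e = - oid O :> O 1.
Proof. by rewrite !ocE omu1r scaleN1r. Qed.

Lemma oc_1l p (f : O p) : oc p 0 (oid O : O 1) f = f.
Proof. by rewrite !ocE muln0 scale1r ocomp1l. Qed.

Lemma brace_mu p q r (f : O p) (g : O q) :
  brace r mu f g = oc r p (oc p.+1 0 mu f) g.
Proof.
rewrite /brace add2n big_nat_recr //= big_nat1 add0n add1n big_nat1.
by rewrite [X in _ + X]big_geq ?addr0.
Qed.

(** The order is reversed because the cup product puts [f] into the second input of mu. *)
Lemma ocupE p q r (f : O p) (g : O q) :
  ocup r f g = (-1) ^+ (p.+1 * q) *: brace r mu g f.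
Proof.
have Hp : (2 + p = p.+1.+1)%N by [].
have Hq : (2 + q = q.+1.+1)%N by [].
have -> : ocup r f g = (-1) ^+ p.+1 *: oc r 0 (oc p.+1 1 mu f) g.
  rewrite /ocup !ocE ocompZl !scalerA -[LHS]scale1r; congr (_ *: _).
  by rewrite -(expr0 (-1)); parity.
rewrite (oc_lt Hp Hq) // brace_mu scalerA /sg add1n; congr (_ *: _).
by parity.
Qed.

(** In mu{f, g} both inputs of mu are taken, so [l] can only go into [f] or [g]. Comparing this with
    the general [cir_braceE] yields [cir_mu_brace_mu] (for l = mu) and [brace_cir_mu]. *)
Lemma cir_brace_mu p q s t1 t2 u v (f : O p) (g : O q) (l : O s) :
    v = (p + q)%N -> t1 = (q + s).-1 -> t2 = (p + s).-1 ->
  cir u (brace v mu f g) l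
    = brace u mu f (cir t1 g l) + sg q s *: brace u mu (cir t2 f l) g.
Proof.
move=> -> -> ->; rewrite !brace_mu {1}/cir (sum_split _ (b := p)); [|lia|lia].
have Hp : (2 + p = p.+1.+1)%N by [].
have Hpq : (p.+1 + q = (p + q).+1)%N by lia.
rewrite addrC; congr (_ + _).
  rewrite /cir linear_sum; apply: sum_shift => [|i Hi]; first by lia.
  by rewrite (oc_in (t := (q + s).-1) Hpq) ?addnK ?addn0 //; lia.
have [p0|p_gt0] := posnP p.
  by rewrite /cir !big_geq ?p0 // linear0 oclE linear0 scaler0.
have Hps : (p.+1 + s = (p + s).-1.+2)%N by lia.
rewrite [X in _ = _ *: X]oclE /cir 2!linear_sum scaler_sumr /=; apply: sum_shift => [|i Hi]; first by lia.
rewrite !addn0 (oc_lt Hpq Hps); last lia.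
rewrite (oc_in (t := (p + s).-1) Hp); try by lia.
by rewrite subn0 -oclE; congr (_ *: oc _ _ _ _); lia.
Qed.

(** Frees the sign from the truncated degree s: if q + r = 0, the inner product is 0 and the sign is
    irrelevant. *)
Lemma sg_predr p q r s : s = (q + r).-1 -> forall (x : O q) (y : O r) t u (z : O t),
  sg p s *: cir u (cir s x y) z = (-1) ^+ (p.+1 * (q + r)) *: cir u (cir s x y) z.
Proof.
move=> Hs x y t u z; have [qr0|qr_gt0] := posnP (q + r).
  by rewrite (_ : cir s x y = 0) ?cir0l ?scaler0 // cir_deg //; lia.
by rewrite /sg (_ : s.+1 = (q + r)%N) //; lia.
Qed.

Lemma obrk_brkE p q r s u (f : O p) (g : O q) (h : O r) : s = (q + r).-1 ->
  obrk u f (obrk s g h)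
    = cir u f (cir s g h) - sg q r *: cir u f (cir s h g)
      - (-1) ^+ (p.+1 * (q + r))
          *: (cir u (cir s g h) f - sg q r *: cir u (cir s h g) f).
Proof.
move=> Hs; rewrite !obrkE linearB linearZ /=; congr (_ - _).
rewrite [X in sg _ _ *: X]cirlE linearB linearZ /= -!cirlE.
rewrite !scalerBr (sg_predr p Hs) !scalerA [sg p s * _]mulrC -!scalerA.
by rewrite sg_predr ?(addnC r q) // [in RHS]scalerA mulrC -scalerA addnC.
Qed.

Lemma obrkC p q r (f : O p) (g : O q) : obrk r f g = - (sg p q *: obrk r g f).
Proof. by rewrite !obrkE scalerBr (sgC q p) sgK; zmod. Qed.

(** Apply the pre-Lie identity to the six products (x o y) o z. Each brace x{y, z} arises twice,
    from (x o y) o z and from (x o z) o y, and the two occurrences cancel. *)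
Lemma obrk_jacobi p q r s t w u (f : O p) (g : O q) (h : O r) :
    s = (q + r).-1 -> t = (p + q).-1 -> w = (p + r).-1 ->
  obrk u f (obrk s g h)
    = obrk u (obrk t f g) h + sg p q *: obrk u g (obrk w f h).
Proof.
move=> Hs Ht Hw; rewrite [obrk u (obrk t f g) h]obrkC.
have -> : sg t r *: obrk u h (obrk t f g)
    = (-1) ^+ (r.+1 * (p + q)) *: obrk u h (obrk t f g).
  have [pq0|pq_gt0] := posnP (p + q).
    have -> : obrk t f g = 0 by rewrite obrkE !cir_deg ?scaler0 ?subr0 //; lia.
    by rewrite obrkE linear0 cir0l !(scaler0, subr0).
  by rewrite /sg mulnC (_ : t.+1 = (p + q)%N) //; lia.
have Hs' : s = (r + q).-1 by lia.
have Ht' : t = (q + p).-1 by lia.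
have Hw' : w = (r + p).-1 by lia.
rewrite !obrk_brkE //.
rewrite (cir_prelieE u g h f Hs Hw') (cir_prelieE u h g f Hs' Ht').
rewrite (cir_prelieE u f g h Ht Hs) (cir_prelieE u g f h Ht' Hw).
rewrite (cir_prelieE u f h g Hw Hs') (cir_prelieE u h f g Hw' Ht).
rewrite /sg; signs; zmod.
Qed.

(* The homotopy for the graded commutativity of the cup product. *)
Lemma odelta_cir p q s u (f : O p) (g : O q) : s = (p + q).-1 ->
  odelta O u (cir s f g)
    = cir u (odelta O p.+1 f) g + (-1) ^+ p.+1 *: cir u f (odelta O q.+1 g)
      - brace u mu f g - sg p q *: brace u mu g f.
Proof.
move=> Hs; rewrite !odeltaE.
have -> : (-1) ^+ s.+1 *: cir u (cir s f g) mu = (-1) ^+ (p + q) *: cir u (cir s f g) mu.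
  have [pq0|pq_gt0] := posnP (p + q).
    by rewrite (_ : cir s f g = 0) ?cir0l ?scaler0 // cir_deg //; lia.
  by rewrite (_ : s.+1 = (p + q)%N) //; lia.
have Hp : p.+1 = (p + 2).-1 by lia.
have Hq : q.+1 = (q + 2).-1 by lia.
rewrite [cir u (_ - _) g]cirlE !(linearB, linearZ) /= -!cirlE.
rewrite (cir_prelieE u f g mu Hs Hq) (cir_prelieE u f mu g Hp erefl).
rewrite (cir_prelieE (s := p.+1) u mu f g erefl Hs) /sg; signs; zmod.
Qed.

Lemma cir_mu_brace_mu p q v u (f : O p) (g : O q) : v = (p + q)%N ->
  cir u mu (brace v mu f g)
    = - (brace u mu (cir p.+1 mu f) g + (-1) ^+ p.+1 *: brace u mu f (cir q.+1 mu g)).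
Proof.
move=> Hv; have Hp : p.+1 = (p + 2).-1 by lia.
have Hq : q.+1 = (q + 2).-1 by lia.
have Hvq : v = ((2 + p).-1 + q).-1 by lia.
have := cir_brace_mu u f g mu Hv Hq Hp.
rewrite (cir_braceE (t4 := v) u mu f g mu Hvq Hq Hp erefl); last lia.
rewrite cir_mu_mu brace0l /sg; signs => E; zmod_from E.
Qed.

Lemma odelta_brace_mu p q v u (f : O p) (g : O q) : v = (p + q)%N ->
  odelta O u (brace v mu f g)
    = - (brace u mu (odelta O p.+1 f) g
         + (-1) ^+ p.+1 *: brace u mu f (odelta O q.+1 g)).
Proof.
move=> Hv; rewrite !odeltaE (cir_mu_brace_mu _ _ _ Hv).
have Hp : p.+1 = (p + 2).-1 by lia.
have Hq : q.+1 = (q + 2).-1 by lia.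
rewrite (cir_brace_mu u f g mu Hv Hq Hp) Hv.
rewrite [brace u mu (_ - _) g]bracemE !(linearB, linearZ) /= -!bracemE /sg.
signs; zmod.
Qed.

Lemma brace_cir_mu c p q d v t u (h : O c) (f : O p) (g : O q) :
    d = (c + p).-1 -> v = (d + q).-1 -> t = (c + q).-1 ->
  brace u (cir c.+1 mu h) f g
    = cir u mu (brace v h f g) + brace u mu (cir d h f) g
      + sg p c *: brace u mu f (cir t h g).
Proof.
move=> Hd Hv Ht; have Hd' : d = (p + c).-1 by lia.
have Ht' : t = (q + c).-1 by lia.
have Hw : (p + q)%N = ((2 + p).-1 + q).-1 by lia.
have := cir_brace_mu u f g h erefl Ht' Hd'.
rewrite (cir_braceE (t3 := c.+1) (t4 := v) u mu f g h Hw Ht' Hd') //.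
rewrite /sg; signs => E; zmod_from E.
Qed.

(* The brace h{f, g} is the homotopy for the Leibniz rule. *)
Lemma obrk_brace_mu c p q d v t w u (h : O c) (f : O p) (g : O q) :
    d = (c + p).-1 -> v = (d + q).-1 -> t = (c + q).-1 -> w = (p + q)%N ->
  obrk u h (brace w mu f g)
    = (-1) ^+ c.+1 *: brace u mu (obrk d h f) g
      + (-1) ^+ (c.+1 * p) *: brace u mu f (obrk t h g)
      - (-1) ^+ c *: odelta O u (brace v h f g)
      + (-1) ^+ c *: brace u (odelta O c.+1 h) f g
      - brace u h (odelta O p.+1 f) g
      + (-1) ^+ p *: brace u h f (odelta O q.+1 g).
Proof.
move=> Hd Hv Ht Hw; rewrite !obrkE !odeltaE.
(* The degree v is c + p + q - 2 unless a predecessor is truncated, and in that case the brace is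
   0. *)
have -> : (-1) ^+ v.+1 *: cir u (brace v h f g) mu
    = (-1) ^+ (c + p + q).+1 *: cir u (brace v h f g) mu.
  have [c0|c_gt0] := posnP c.
    by rewrite [brace v h f g](_ : _ = 0) ?cir0l ?scaler0 // /brace big_geq ?c0.
  have [dq0|dq_gt0] := posnP (d + q).
    by rewrite [brace v h f g]brace_low ?cir0l ?scaler0 //; lia.
  by congr (_ *: _); have Hcpq : (v.+2 = c + p + q)%N by [lia]; parity.
have Ht' : t = (q + c).-1 by lia.
have Hd' : d = (p + c).-1 by lia.
have Hp : p.+1 = (p + 2).-1 by lia.
have Hq : q.+1 = (q + 2).-1 by lia.
have Hc : c.+1 = (c + 2).-1 by lia.
have Hv' : v = ((c + p).-1 + q).-1 by lia.
have E := cir_braceE (t4 := w) u h f g mu Hv' Hq Hp Hc.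
rewrite E; last by lia.
rewrite (cir_brace_mu u f g h Hw Ht' Hd').
rewrite [brace u (_ - _) f g]bracelE.
rewrite [brace u mu (_ - _) g]bracemE [brace u h (_ - _) g]bracemE.
rewrite !(linearB, linearZ) /= -!bracemE -!bracelE.
rewrite (brace_cir_mu _ _ _ _ Hd Hv Ht).
rewrite /sg Hw; signs; zmod.
Qed.
End Gerstenhaber.

(** * Cyclic comp modules after suspension *)

Section SignedModule.
Context {k : comPzRingType} (O : operad k) (M : cyclic_comp_module O).

(** As for [oc], the actions are rescaled and locked. The rotation is rescaled by (-1)^n, which
    makes all faces enter b with coefficient 1. *)
Fact bl_key : unit. Proof. exact: tt. Qed.
Definition bl p n m i (f : O p) (x : M n) : M m :=
  locked_with bl_key ((-1) ^+ (p.+1 * i) *: bul M m i f x).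

Lemma blE p n m i (f : O p) (x : M n) :
  bl m i f x = (-1) ^+ (p.+1 * i) *: bul M m i f x.
Proof. by rewrite /bl unlock. Qed.

Definition rt n (x : M n) : M n := locked_with bl_key ((-1) ^+ n *: cyc M x).

Lemma rtE n (x : M n) : rt x = (-1) ^+ n *: cyc M x.
Proof. by rewrite /rt unlock. Qed.

Lemma bl_linear p n m i (f : O p) : linear (@bl p n m i f).
Proof.
move=> a u v; rewrite !blE (gb_linearr (bul_bilinear M i)) scalerDr.
by rewrite !scalerA mulrC.
Qed.
HB.instance Definition _ p n m i f :=
  GRing.isLinear.Build k (M n) (M m) *:%R (@bl p n m i f) (@bl_linear p n m i f).

Definition bll p n m i x f := @bl p n m i f x.
Lemma bll_linear p n m i (x : M n) : linear (@bll p n m i x).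
Proof.
move=> a u v; rewrite /bll !blE (gb_linearl (bul_bilinear M i)) scalerDr.
by rewrite !scalerA mulrC.
Qed.
HB.instance Definition _ p n m i x :=
  GRing.isLinear.Build k (O p) (M m) *:%R (@bll p n m i x) (@bll_linear p n m i x).

Lemma bllE p n m i (f : O p) (x : M n) : bl m i f x = bll m i x f.
Proof. by []. Qed.

Lemma rt_linear n : linear (@rt n).
Proof. by move=> a u v; rewrite !rtE cyc_linear scalerDr !scalerA mulrC. Qed.
HB.instance Definition _ n :=
  GRing.isLinear.Build k (M n) (M n) *:%R (@rt n) (@rt_linear n).

Lemma bulZl a p n m i (f : O p) (x : M n) : bul M m i (a *: f) x = a *: bul M m i f x.
Proof.
have lin := gb_linearl (bul_bilinear M i) p n m x.
by have := lin a f 0; rewrite !(addr0, linear_fun0 lin).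
Qed.

Lemma bulZr a p n m i (f : O p) (x : M n) : bul M m i f (a *: x) = a *: bul M m i f x.
Proof.
have lin := gb_linearr (bul_bilinear M i) p n m f.
by have := lin a x 0; rewrite !(addr0, linear_fun0 lin).
Qed.

Lemma cycZ a n (x : M n) : cyc M (a *: x) = a *: cyc M x.
Proof.
have lin := @cyc_linear k O M n.
by have := lin a x 0; rewrite !(addr0, linear_fun0 lin).
Qed.

Lemma bl_deg p n m i (f : O p) (x : M n) : n.+1 <> (p + m)%N -> bl m i f x = 0.
Proof. by move=> /eqP neq; rewrite !blE (gb_deg (bul_bilinear M i)) ?scaler0. Qed.

Lemma bl_out p n m i (f : O p) (x : M n) : (m < i)%N -> bl m i f x = 0.
Proof. by move=> lt_mi; rewrite !blE bul_out ?scaler0. Qed.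

Lemma bl_lt p q n l m s i j (f : O p) (g : O q) (x : M n) :
    (n.+1 = q + l)%N -> (n.+1 = p + s)%N -> (j < i)%N ->
  bl m i f (bl l j g x) = sg p q *: bl m j g (bl s (i + q).-1 f x).
Proof.
move=> Hl Hs Hij; have [Hm|Hm] := eqVneq l.+1 (p + m)%N; last first.
  by rewrite !(@bl_deg _ _ m) ?scaler0 //; lia.
have [le_im|lt_mi] := leqP i m; last first.
  by rewrite (bl_out _ _ lt_mi) (bl_out f x) ?linear0 ?scaler0 //; lia.
rewrite !blE !bulZr !scalerA (bulA_lt (s := s)) //; [|lia].
have [d Hd] : exists d, i = d.+1 by exists i.-1; lia.
by subst i; rewrite addSn /= /sg; congr (_ *: _); parity.
Qed.
Arguments bl_lt {p q n l m s i j f g x}.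

Lemma bl_in p q n l m s i j (f : O p) (g : O q) (x : M n) :
    (n.+1 = q + l)%N -> (p + q = s.+1)%N -> (i <= j < i + p)%N ->
  bl m i f (bl l j g x) = bl m i (oc s (j - i) f g) x.
Proof.
move=> Hl Hs Hij; have [Hm|Hm] := eqVneq l.+1 (p + m)%N; last first.
  by rewrite !(@bl_deg _ _ m) ?scaler0 //; lia.
have [le_im|lt_mi] := leqP i m; last by rewrite !(bl_out _ _ lt_mi).
rewrite !blE !ocE bulZl !bulZr !scalerA (bulA_in (s := s)) //; [|lia].
have [d Hd] : exists d, j = (i + d)%N by exists (j - i)%N; lia.
by subst j; rewrite addKn; congr (_ *: _); parity.
Qed.
Arguments bl_in {p q n l m s i j f g x}.

Lemma bl_gt p q n l m s i j (f : O p) (g : O q) (x : M n) :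
    (n.+1 = q + l)%N -> (n.+1 = p + s)%N -> (i + p <= j)%N ->
  bl m i f (bl l j g x) = sg p q *: bl m (j - p).+1 g (bl s i f x).
Proof.
move=> Hl Hs Hij; rewrite (bl_lt (i := (j - p).+1) Hs Hl); last by lia.
by rewrite sgC sgK; congr (bl _ _ _ (bl _ _ _ _)); lia.
Qed.
Arguments bl_gt {p q n l m s i j f g x}.

Lemma rt_bl p n m i (f : O p) (x : M n) :
  n.+1 = (p + m)%N -> (i < m)%N -> rt (bl m i f x) = bl m i.+1 f (rt x).
Proof.
move=> Hm lt_im; rewrite !rtE !blE cycZ bulZr !scalerA cyc_bul //.
by congr (_ *: _); clear lt_im; parity.
Qed.

Lemma iter_rt n j (x : M n) :
  iter j (@rt n) x = (-1) ^+ (n * j) *: iter j (cyc M) x.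
Proof.
elim: j => [|j IHj]; first by rewrite muln0 scale1r.
by rewrite /= IHj !rtE cycZ scalerA; congr (_ *: _); rewrite -exprD mulnS.
Qed.

Lemma iter_rt_full n (x : M n) : iter n.+1 (@rt n) x = x.
Proof.
rewrite iter_rt cyc_iter -[RHS]scale1r; congr (_ *: _).
by rewrite -(expr0 (-1)); parity.
Qed.

Lemma iter_rt_linear n j : linear (iter j (@rt n)).
Proof. by move=> a u v; elim: j => //= j ->; rewrite linearP. Qed.
HB.instance Definition _ n j :=
  GRing.isLinear.Build k (M n) (M n) *:%R (iter j (@rt n)) (@iter_rt_linear n j).

Lemma iter_rt_bl p n m i j (f : O p) (x : M n) :
  n.+1 = (p + m)%N -> (i + j <= m)%N ->
  iter j (@rt m) (bl m i f x) = bl m (i + j) f (iter j (@rt n) x).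
Proof.
move=> Hm; elim: j => [|j IHj] Hij; first by rewrite addn0.
by rewrite /= IHj ?rt_bl ?addnS //; lia.
Qed.

(** The axiom on t covers positions below m only. For the last one write x = t^m t^p x, pull t^m out
    of the action at 0, and use t^(m+1) = 1 on M m. *)
Lemma rt_bl_last p n m (f : O p) (x : M n) : n.+1 = (p + m)%N ->
  rt (bl m m f x) = bl m 0 f (iter p (@rt n) x).
Proof.
move=> Hm; rewrite -[x in LHS]iter_rt_full Hm addnC iterD.
have := iter_rt_bl (i := 0) f (iter p (@rt n) x) Hm (leqnn m).
by rewrite add0n => <-; rewrite -iterS iter_rt_full.
Qed.

Lemma bl_id n i (x : M n) : (i <= n)%N -> bl n i (oid O) x = x.
Proof. by move=> le_in; rewrite !blE bul1 // mul2n -signr_odd odd_double scale1r. Qed.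

(** The partial norm T_i; for i = n + 1 it is the norm N. *)
Definition rsum i n (x : M n) : M n := \sum_(0 <= j < i) iter j (@rt n) x.

Lemma rsum_linear i n : linear (@rsum i n).
Proof.
move=> a u v; rewrite /rsum scaler_sumr -big_split; apply: eq_bigr => j _ /=.
by rewrite linearP.
Qed.
HB.instance Definition _ i n :=
  GRing.isLinear.Build k (M n) (M n) *:%R (@rsum i n) (@rsum_linear i n).

Lemma rsum0 n (x : M n) : rsum 0 x = 0.
Proof. by rewrite /rsum big_geq. Qed.

Lemma rsumS i n (x : M n) : rsum i.+1 x = rsum i x + iter i (@rt n) x.
Proof. by rewrite /rsum big_nat_recr. Qed.

Lemma rt_rsum i n (x : M n) : rt (rsum i x) = rsum i.+1 x - x.
Proof.
rewrite /rsum linear_sum big_nat_recl // addrC addKr.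
by [].
Qed.

Lemma iter_rsum p m n (x : M n) :
  iter p (@rt n) (rsum m x) = rsum (p + m) x - rsum p x.
Proof.
elim: p => [|p IHp]; first by rewrite rsum0 subr0.
by rewrite /= IHp linearB /= !rt_rsum addSn; zmod.
Qed.

End SignedModule.

Arguments bl_lt {k O M p q n l m s i j f g x}.
Arguments bl_in {k O M p q n l m s i j f g x}.
Arguments bl_gt {k O M p q n l m s i j f g x}.

(** * Boundary, partial norms and cyclic insertions *)

Section Cyclic.
Context {k : comPzRingType} (O : mult_operad k) (M : cyclic_comp_module O).

Notation mu := (omu O).
Notation e := (ounit O).
Notation rti := (fun j n => iter j (@rt k O M n)).

HB.instance Definition _ n m :=
  GRing.isLinear.Build k (M n) (M m) *:%R (@cb k O M n m) (@cb_linear k O M n m).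

Lemma cb_deg n m (x : M n) : n <> m.+1 -> cb M m x = 0.
Proof.
move=> neq_nm; have deg := gb_deg (bul_bilinear M _) (p := 2).
rewrite /cb big1 => [|i _]; last by rewrite deg ?scaler0 //; apply/eqP; lia.
by rewrite deg ?scaler0 ?addr0 //; apply/eqP; lia.
Qed.

Lemma cbE n (x : M n.+1) :
  cb M n x = \sum_(0 <= a < n.+1) bl n a mu x + bl n 0 mu (rt x).
Proof.
rewrite /cb !blE !rtE bulZr muln0 scale1r; congr (_ + _).
by apply: eq_bigr => i _; rewrite blE; congr (_ *: _); parity.
Qed.

Lemma cBE n m (x : M n) : cB M m x = bl m 0 e (rsum n.+1 x).
Proof.
rewrite linear_sum /=; apply: eq_bigr => i _.
by rewrite iter_rt linearZ /= !blE muln0 scale1r mulnC.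
Qed.

Lemma cB_linear n m : linear (@cB k O M n m).
Proof. by move=> a u v; rewrite !cBE !linearP. Qed.
HB.instance Definition _ n m :=
  GRing.isLinear.Build k (M n) (M m) *:%R (@cB k O M n m) (@cB_linear n m).

(** Each rotation moves the faces up by one position. The face leaving the last position reenters at
    0 with t applied twice, as mu has arity 2, and so joins the second sum. *)
Lemma iter_rt_cb n i (x : M n.+1) : (i <= n)%N ->
  iter i (@rt _ _ M n) (cb M n x)
    = \sum_(i <= a < n.+1) bl n a mu (iter i (@rt _ _ M _) x)
      + \sum_(0 <= a < i.+1) bl n a mu (iter i.+1 (@rt _ _ M _) x).
Proof.
have Hn : n.+2 = (2 + n)%N by [].
elim: i => [|i IHi] lt_in; first by rewrite cbE big_nat1.
rewrite iterS IHi 1?ltnW // linearD !linear_sum /=.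
have -> : \sum_(i <= a < n.+1) rt (bl n a mu (rti i _ x))
    = \sum_(i.+1 <= a < n.+1) bl n a mu (rti i.+1 _ x) + bl n 0 mu (rti i.+2 _ x).
  rewrite big_nat_recr ?(ltnW lt_in) //= (rt_bl_last _ _ Hn); congr (_ + _).
  by apply: sum_shift => [|a Ha]; [lia|rewrite rt_bl ?addnS //; lia].
have -> : \sum_(0 <= a < i.+1) rt (bl n a mu (rt (rti i _ x)))
    = \sum_(0 <= a < i.+1) bl n a.+1 mu (rti i.+2 _ x).
  by apply: eq_big_nat => a Ha; rewrite rt_bl //; lia.
rewrite [X in _ = _ + X]big_nat_recl //=; zmod.
Qed.

(* Commutes the boundary with the partial norms; for i = n + 1 this is the
   identity between the norm and the two Hochschild boundaries. *)
Lemma rsum_cb n i (x : M n.+1) : (i <= n.+1)%N ->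
  rsum i (cb M n x)
    = \sum_(i <= a < n.+1) bl n a mu (rsum i x)
      + \sum_(0 <= a < i) bl n a mu (rsum i.+1 x).
Proof.
elim: i => [|i IHi] lt_in.
  by rewrite !rsum0 [X in _ + X]big_geq // addr0 big1 // => a _; rewrite linear0.
rewrite rsumS IHi 1?ltnW // iter_rt_cb //.
have add_sum a b c : \sum_(a <= j < b) bl n j mu (rsum c x)
      + \sum_(a <= j < b) bl n j mu (rti c _ x) = \sum_(a <= j < b) bl n j mu (rsum c.+1 x).
  by rewrite -big_split; apply: eq_bigr => j _; rewrite rsumS linearD.
rewrite -(add_sum 0%N i.+1 i.+1) addrACA (add_sum i) [LHS]addrA [RHS]addrA; congr (_ + _).
by rewrite big_ltn // [X in _ = _ + X]big_nat_recr //=; zmod.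
Qed.

(* Up to the extra degeneracy, the operator S. *)
Definition ins p n m (f : O p) (x : M n) : M m :=
  \sum_(0 <= i < m.+1) bl m i f (rsum i x).

Lemma ins_linear p n m (f : O p) : linear (@ins p n m f).
Proof.
move=> a u v; rewrite /ins scaler_sumr -big_split; apply: eq_bigr => j _ /=.
by rewrite !linearP.
Qed.
HB.instance Definition _ p n m f :=
  GRing.isLinear.Build k (M n) (M m) *:%R (@ins p n m f) (@ins_linear p n m f).

Definition insl p n m (x : M n) (f : O p) : M m := ins m f x.
Lemma insl_linear p n m (x : M n) : linear (@insl p n m x).
Proof.
move=> a u v; rewrite /insl /ins scaler_sumr -big_split; apply: eq_bigr => j _ /=.
by rewrite !bllE linearP.
Qed.
HB.instance Definition _ p n m x :=
  GRing.isLinear.Build k (O p) (M m) *:%R (@insl p n m x) (@insl_linear p n m x).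

Lemma insE p n m (f : O p) (x : M n) : ins m f x = insl m x f.
Proof. by []. Qed.

(** Move b through T_i with [rsum_cb]; then mu lies left of [f], inside it or right of it. The two
    double sums recur in [hochschild_ins] and cancel in [cb_ins]. *)
Lemma ins_cb p n l (f : O p) (x : M n.+1) : n.+1 = (p + l)%N ->
  ins l f (cb M n x)
    = ins l (cir p.+1 f mu) x
      + sg p 2 *: (\sum_(0 <= i < l.+1) \sum_(0 <= a < i)
                     bl l a mu (bl l.+1 i.+1 f (rsum i.+1 x))
                 + \sum_(0 <= i < l.+1) \sum_(i.+1 <= a < l.+1)
                     bl l a mu (bl l.+1 i f (rsum i x))).
Proof.
move=> Hn.
have Hn2 : n.+2 = (2 + n)%N by [].
have Hs : n.+2 = (p + l.+1)%N by lia.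
have Hp : (p + 2 = p.+2)%N by lia.
rewrite scalerDr !scaler_sumr {1 2}/ins -!big_split /=; apply: eq_big_nat => i Hi.
rewrite !scaler_sumr rsum_cb; last lia.
rewrite linearD [X in X + _ = _]linear_sum [X in _ + X = _]linear_sum /=.
have -> : \sum_(0 <= a < i) bl l i f (bl n a mu (rsum i.+1 x))
    = \sum_(0 <= a < i) sg p 2 *: bl l a mu (bl l.+1 i.+1 f (rsum i.+1 x)).
  apply: eq_big_nat => a Ha.
  by rewrite (bl_lt Hn2 Hs) ?addn2 //; lia.
rewrite (sum_split _ (a := i) (b := (i + p)%N)); [|lia|lia].
have -> : \sum_(i <= a < i + p) bl l i f (bl n a mu (rsum i x))
    = bl l i (cir p.+1 f mu) (rsum i x).
  rewrite bllE /cir linear_sum; apply: sum_shift => [|a Ha]; first lia.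
  by rewrite (bl_in Hn2 Hp) ?addnK ?addn0 //; lia.
have -> : \sum_(i + p <= a < n.+1) bl l i f (bl n a mu (rsum i x))
    = \sum_(i.+1 <= a < l.+1) sg p 2 *: bl l a mu (bl l.+1 i f (rsum i x)).
  apply: sum_shift => [|a Ha]; first lia.
  by rewrite (bl_gt Hn2 Hs) //; [congr (_ *: bl _ _ _ _)|]; lia.
zmod.
Qed.

(** The operator mu.a catches f.i in one of its inputs for i = a and i = a + 1. In the second case
    the weight T_(a+1) = T_a + t^a has an extra term; these terms add up to the rotations of the cap
    product. *)
Lemma hochschild_ins p n l (f : O p) (x : M n) : n = (p + l)%N ->
  \sum_(0 <= a < l.+1) bl l a mu (ins l.+1 f x)
    = ins l (cir p.+1 mu f) x + rsum l.+1 (bl l 0 (oc p.+1 1 mu f) x)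
      + \sum_(0 <= i < l.+1) \sum_(0 <= a < i) bl l a mu (bl l.+1 i.+1 f (rsum i.+1 x))
      + \sum_(0 <= i < l.+1) \sum_(i.+1 <= a < l.+1) bl l a mu (bl l.+1 i f (rsum i x)).
Proof.
move=> Hn; have Hs : n.+1 = (p + l.+1)%N by lia.
have H2p : (2 + p = p.+2)%N by [].
have Hl : n.+1 = (p.+1 + l)%N by lia.
rewrite sum_triangle -[X in _ + X]sum_triangle /ins [rsum _ (bl _ _ _ _)]/rsum.
rewrite -!big_split /=; apply: eq_big_nat => a Ha.
rewrite linear_sum (sum_split _ (b := a)) /=; [|lia|lia].
rewrite (sum_split _ (a := a) (b := a.+2)); [|lia|lia].
rewrite big_nat_recr //= big_nat1 !(bl_in Hs H2p); [|lia|lia].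
rewrite subnn subSnn rsumS linearD /= (iter_rt_bl _ _ Hl) add0n; last by lia.
have -> : \sum_(a.+2 <= i < l.+2) bl l a mu (bl l.+1 i f (rsum i x))
    = \sum_(a.+1 <= i < l.+1) bl l a mu (bl l.+1 i.+1 f (rsum i.+1 x)).
  by apply: sum_shift => [|i Hi]; [lia|rewrite !addnS].
have -> : cir p.+1 mu f = oc p.+1 0 mu f + oc p.+1 1 mu f.
  by rewrite /cir big_nat_recr //= big_nat1.
rewrite [bl l a (_ + _) _]bllE linearD /= -!bllE.
zmod.
Qed.

End Cyclic.

(** * The Cartan homotopy formula *)

Section Cartan.
Context {k : comPzRingType} (O : mult_operad k) (M : cyclic_comp_module O).

Notation mu := (omu O).
Notation e := (ounit O).
Notation rti := (fun j n => iter j (@rt k O M n)).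

Definition lie p n m (f : O p) (x : M n) : M m :=
  \sum_(1 <= i < m.+1) bl m i f x + bl m 0 f (rsum p x).

Lemma lie_deg p n m (f : O p) (x : M n) : n.+1 <> (p + m)%N -> lie m f x = 0.
Proof.
by move=> Hn; rewrite /lie bl_deg // addr0 big1 // => i _; rewrite bl_deg.
Qed.

Lemma clieE p n m (f : O p) (x : M n) : clie M m f x = (-1) ^+ p.+1 *: lie m f x.
Proof.
have [Hn|/eqP Hn] := eqVneq n.+1 (p + m)%N; last first.
  rewrite lie_deg // scaler0 /clie.
  have bul0 i (y : M n) : bul M m i f y = 0.
    by rewrite (gb_deg (bul_bilinear M i)) //; apply/eqP.
  by rewrite !big1 ?addr0 // => i _; rewrite bul0 scaler0.
rewrite /clie /lie scalerDr (_ : n.+1 - p = m)%N; last by lia.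
congr (_ + _).
  rewrite scaler_sumr; apply: eq_big_nat => i Hi.
  rewrite !blE scalerA; congr (_ *: _).
  have [d ->] : exists d, i = d.+1 by exists i.-1; lia.
  by parity.
rewrite big_add1 /= linear_sum scaler_sumr /=; apply: eq_bigr => i _.
by rewrite iter_rt !blE muln0 scale1r bulZr scalerA -exprD addnC.
Qed.

Lemma lie_linear p n m (f : O p) : linear (@lie p n m f).
Proof.
move=> a u v; rewrite /lie !linearP scalerDr scaler_sumr addrACA -big_split.
by congr (_ + _); apply: eq_bigr => i _; rewrite linearP.
Qed.
HB.instance Definition _ p n m f :=
  GRing.isLinear.Build k (M n) (M m) *:%R (@lie p n m f) (@lie_linear p n m f).

Lemma clie_linear p n m (f : O p) : linear (@clie k O M p n m f).
Proof. by move=> a u v; rewrite !clieE linearP scalerDr /= scalerA mulrC -scalerA. Qed.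
HB.instance Definition _ p n m f :=
  GRing.isLinear.Build k (M n) (M m) *:%R (@clie k O M p n m f) (@clie_linear p n m f).

(** Exchanging the two sums collects the rotations before f.i into T_i; the position i = 0 adds
    nothing because T_0 = 0. *)
Lemma cSE p n m (f : O p) (x : M n) :
  cS M m f x = (-1) ^+ p.+1 *: bl m 0 e (ins (n.+1 - p) f x).
Proof.
rewrite /cS; set q := (n.+1 - p)%N.
rewrite /ins [in RHS]big_nat_recl // rsum0 linear0 add0r big_add1 /=.
have -> : \sum_(0 <= i < q) bl q i.+1 f (rsum i.+1 x)
    = \sum_(0 <= j < q) \sum_(j <= i < q) bl q i.+1 f (rti j n x).
  transitivity (\sum_(0 <= i < q) (\sum_(0 <= j < i) bl q i.+1 f (rti j n x)
                                  + bl q i.+1 f (rti i n x))).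
    by apply: eq_bigr => i _; rewrite rsumS linearD linear_sum.
  rewrite big_split /= sum_triangle -big_split; apply: eq_big_nat => j Hj /=.
  by rewrite [in RHS]big_ltn; [apply: addrC|lia].
rewrite linear_sum scaler_sumr; apply: eq_bigr => j _ /=.
rewrite big_add1 /= linear_sum scaler_sumr; apply: eq_bigr => i _ /=.
rewrite iter_rt !blE !bulZr muln0 scale1r !scalerA; congr (_ *: _).
by parity.
Qed.

Lemma ccapE p n m (f : O p) (x : M n) :
  ccap M m f x = (-1) ^+ p.+1 *: bl m 0 (oc p.+1 1 mu f) x.
Proof.
rewrite /ccap !blE !ocE bulZl muln0 scale1r scalerA -[LHS]scale1r; congr (_ *: _).
by rewrite -(expr0 (-1)); parity.
Qed.

Definition ccapl p n m (x : M n) (f : O p) := ccap M m f x.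
Lemma ccapl_linear p n m (x : M n) : linear (@ccapl p n m x).
Proof.
move=> a u v; rewrite /ccapl !ccapE linearP bllE linearP scalerDr /=.
by rewrite scalerA mulrC -scalerA.
Qed.
HB.instance Definition _ p n m x :=
  GRing.isLinear.Build k (O p) (M m) *:%R (@ccapl p n m x) (@ccapl_linear p n m x).

Lemma ccaplE p n m (f : O p) (x : M n) : ccap M m f x = ccapl m x f.
Proof. by []. Qed.

Lemma ccap_linear p n m (f : O p) : linear (@ccap k O M p n m f).
Proof. by move=> a u v; rewrite !ccapE linearP scalerDr /= scalerA mulrC -scalerA. Qed.
HB.instance Definition _ p n m f :=
  GRing.isLinear.Build k (M n) (M m) *:%R (@ccap k O M p n m f) (@ccap_linear p n m f).

Lemma cS_linear p n m (f : O p) : linear (@cS k O M p n m f).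
Proof. by move=> a u v; rewrite !cSE !linearP. Qed.
HB.instance Definition _ p n m f :=
  GRing.isLinear.Build k (M n) (M m) *:%R (@cS k O M p n m f) (@cS_linear p n m f).

(** By the unit laws the first and the last face give 1 and -t; every other face slides past the
    unit with a sign. *)
Lemma cb_unit m (z : M m) :
  cb M m (bl m.+1 0 e z)
    = z - rt z - bl m 0 e (\sum_(0 <= a < m) bl m.-1 a mu z).
Proof.
have Hm : m.+1 = (0 + m.+1)%N by [].
have H2 : (2 + 0 = 2)%N by [].
rewrite cbE big_nat_recl // (bl_in Hm H2) // oc_mu0_unit bl_id //.
rewrite rt_bl // (bl_in Hm H2) // oc_mu1_unit.
rewrite [bl m 0 (- _) _]bllE linearN /= -bllE bl_id // addrAC; congr (_ + _).
rewrite linear_sum -sumrN; apply: eq_big_nat => a Ha /=.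
rewrite (bl_lt (s := m.-1) Hm) //; last by lia.
by rewrite addn0 /sg sgrE /= scaleN1r.
Qed.

(** Telescoping: t T_i = T_(i+1) - 1, and the last position wraps around to f.0 t^p T_m = f.0 (N -
    T_p). *)
Lemma ins_rt p n m (f : O p) (x : M n) : n.+1 = (p + m)%N ->
  ins m f x - rt (ins m f x) = lie m f x - bl m 0 f (rsum n.+1 x).
Proof.
move=> Hn; rewrite /lie /ins linear_sum big_nat_recl //= rsum0 linear0 add0r.
rewrite [X in _ - X]big_nat_recr //= (rt_bl_last _ _ Hn) iter_rsum -Hn linearB /=.
have -> : \sum_(0 <= i < m) rt (bl m i f (rsum i x))
    = \sum_(0 <= i < m) bl m i.+1 f (rsum i.+1 x) - \sum_(0 <= i < m) bl m i.+1 f x.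
  rewrite -sumrB; apply: eq_big_nat => i Hi.
  by rewrite (rt_bl _ _ Hn) ?rt_rsum ?linearB.
rewrite big_add1 /=; zmod.
Qed.

(** The unit in front of B fills the free input of mu in the cap product, so only [f] itself
    remains. *)
Lemma ccap_cB p n m (f : O p) (x : M n) : n.+1 = (p + m)%N ->
  ccap M m f (cB M n.+1 x) = bl m 0 f (rsum n.+1 x).
Proof.
move=> Hn; have Hp : (2 + p = p.+2)%N by [].
rewrite ccapE cBE (bl_in (s := p)) ?subn0; [|lia..].
rewrite (oc_lt Hp (t := 1%N)) // oc_mu0_unit addn0 oc_1l.
rewrite [bl m 0 (_ *: _) _]bllE linearZ /= -bllE scalerA -[RHS]scale1r; congr (_ *: _).
by rewrite -(expr0 (-1)) /sg; clear Hn; parity.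
Qed.

Lemma cb_ins p n l (f : O p) (x : M n) : n = (p + l)%N ->
  \sum_(0 <= a < l.+1) bl l a mu (ins l.+1 f x)
    = rsum l.+1 (bl l 0 (oc p.+1 1 mu f) x)
      + (-1) ^+ p.+1 *: ins l f (cb M n.-1 x)
      + ins l (odelta O p.+1 f) x.
Proof.
case: n x => [|n] x Hn; rewrite hochschild_ins // odeltaE.
  have l0 : l = 0%N by lia.
  subst l; rewrite cb_deg // linear0 scaler0 addr0 !big_nat1 !big_geq // !addr0.
  by rewrite addrC /ins !big_nat1 !rsum0 !linear0.
rewrite (ins_cb _ _ Hn) [ins l (_ - _) x]insE !(linearB, linearZ) /= -!insE.
rewrite /sg; signs; zmod.
Qed.

(* This holds before normalisation: the operator S inverts 1 - t up to the
   term coming from B. *)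
Lemma cartan_homotopy p n m (f : O p) (x : M n) : n.+1 = (p + m)%N ->
  clie M m f x
    = cB M m (ccap M (n - p) f x) - (-1) ^+ p *: ccap M m f (cB M n.+1 x)
      + (cb M m (cS M m.+1 f x) - (-1) ^+ p *: cS M m f (cb M n.-1 x))
      - cS M m (odelta O p.+1 f) x.
Proof.
move=> Hn; rewrite clieE ccap_cB // !cSE (_ : n.+1 - p = m)%N; last by lia.
rewrite [cb M m _]linearZ /= cb_unit.
have -> : ins m f x - rt (ins m f x) = lie m f x - bl m 0 f (rsum n.+1 x) by apply: ins_rt.
(* In output degree 0 all terms with S vanish, since only the weight T_0 = 0 occurs in them; L_f
   reduces to the term f.0 N. *)
case: m Hn => [|l] Hn.
  rewrite (_ : n.+1 - p.+1 = 0)%N; last by lia.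
  rewrite (_ : n.-1.+1 - p = 0)%N; last by lia.
  rewrite /ins !big_nat1 !rsum0 !linear0 big_geq // linear0 ccapE bl_deg; last by lia.
  rewrite linear0 linear0; signs; zmod.
rewrite cb_ins /=; last by lia.
have -> : bl l.+1 0 e (ins (n.-1.+1 - p) f (cb M n.-1 x))
    = bl l.+1 0 e (ins l f (cb M n.-1 x)).
  case: n x Hn => [|n] x Hn; first by rewrite cb_deg // !linear0.
  by rewrite (_ : n.+1 - p = l)%N //; lia.
rewrite (_ : n.+1 - p.+1 = l)%N; last by lia.
rewrite !linearD /= linearZ /= cBE (_ : n - p = l)%N; last by lia.
rewrite ccapE !linearZ /=.
signs; zmod.
Qed.
End Cartan.

(** * The differentials b and B *)

Section Homotopies.
Context {k : comPzRingType} (O : mult_operad k) (M : cyclic_comp_module O).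

Notation mu := (omu O).
Notation e := (ounit O).

Lemma oc_mu_mu r : oc r 0 mu mu = - oc r 1 mu mu :> O r.
Proof.
apply/eqP; rewrite -addr_eq0; apply/eqP.
by rewrite -[RHS](cir_mu_mu O r) /cir big_nat_recr //= big_nat1.
Qed.

Definition face m n i (x : M n) : M m :=
  if (i < n)%N then bl m i mu x else bl m 0 mu (rt x).

Lemma face_lt m n i (x : M n) : (i < n)%N -> face m i x = bl m i mu x.
Proof. by move=> lt_in; rewrite /face lt_in. Qed.

Lemma face_last m n (x : M n) : face m n x = bl m 0 mu (rt x).
Proof. by rewrite /face ltnn. Qed.

Lemma cb_face n (x : M n.+1) : cb M n x = \sum_(0 <= i < n.+2) face n i x.
Proof.
rewrite cbE [RHS]big_nat_recr //= face_last; congr (_ + _).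
by apply: eq_big_nat => i Hi; rewrite face_lt.
Qed.

Lemma face_linear m n i : linear (@face m n i).
Proof. by move=> a u v; rewrite /face; case: ifP => _; rewrite !linearP. Qed.
HB.instance Definition _ m n i :=
  GRing.isLinear.Build k (M n) (M m) *:%R (@face m n i) (@face_linear m n i).

(** The simplicial identity for faces, with the sign of the suspension. Neighbouring faces use
    associativity; those involving the last face use the rotation of mu.i, with wrap-around if both
    are last. *)
Lemma face_face n i j (x : M n.+2) : (i < j <= n.+2)%N ->
  face n i (face n.+1 j x) = - face n j.-1 (face n.+1 i x).
Proof.
move=> Hij; have Hn : n.+3 = (2 + n.+1)%N by [].
have H4 : (2 + 2 = 4)%N by [].
have sg22 : sg 2 2 = -1 :> k by rewrite /sg sgrE.
rewrite [face _ i x]face_lt; last by lia.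
have [lt_j|ge_j] := ltnP j n.+2.
  rewrite !face_lt; [|lia..].
  have [ltij|leji] := ltnP i.+1 j.
    rewrite (bl_gt Hn Hn); last by lia.
    by rewrite sg22 scaleN1r; congr (- bl _ _ _ _); lia.
  have -> : j = i.+1 by lia.
  rewrite (bl_in Hn H4); last by lia.
  rewrite subSnn (bl_in Hn H4) /= ?subnn; last by lia.
  by rewrite oc_mu_mu bllE [in RHS]bllE linearN opprK.
have -> : j = n.+2 by lia.
rewrite !face_last /=; have [lt_in|ge_in] := ltnP i n.+1.
  rewrite face_lt //; case: i Hij lt_in => [|i] Hij lt_in.
    rewrite rt_bl // (bl_in Hn H4) // (bl_in Hn H4) //= subnn subn0.
    by rewrite oc_mu_mu bllE [in RHS]bllE linearN.
  rewrite (bl_lt Hn Hn) // sg22 scaleN1r addn2 /= rt_bl //.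
have -> : i = n.+1 by lia.
rewrite face_last (rt_bl_last _ _ Hn) rt_bl //.
rewrite !(bl_in Hn H4) // !subn0 oc_mu_mu.
by rewrite [bl n 0 (- _) _]bllE linearN opprK.
Qed.

Lemma cb_cb n m (x : M n) : cb M m (cb M m.+1 x) = 0.
Proof.
have [Hn|/eqP Hn] := eqVneq n m.+2; last by rewrite (cb_deg (m := m.+1)) ?linear0.
subst n; rewrite [cb M m _]cb_face cb_face.
pose F i j := face m i (face m.+1 j x).
have -> : \sum_(0 <= i < m.+2) face m i (\sum_(0 <= j < m.+3) face m.+1 j x)
    = \sum_(0 <= i < m.+2) \sum_(0 <= j < i.+1) F i j
      + \sum_(0 <= i < m.+2) \sum_(i.+1 <= j < m.+3) F i j.
  rewrite -big_split; apply: eq_big_nat => i Hi /=.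
  by rewrite linear_sum (sum_split _ (b := i.+1)) //; lia.
have -> : \sum_(0 <= i < m.+2) \sum_(i.+1 <= j < m.+3) F i j
    = - \sum_(0 <= i < m.+3) \sum_(i.+1 <= j < m.+3) F j.-1 i.
  rewrite [in RHS]big_nat_recr //= [X in - (_ + X)]big_geq // addr0 -sumrN.
  apply: eq_big_nat => i Hi; rewrite -sumrN; apply: eq_big_nat => j Hj.
  by rewrite /F face_face //; lia.
rewrite -(sum_triangle (fun j i => F j.-1 i)) [X in _ - X]big_nat_recl //=.
by rewrite [\sum_(0 <= _ < 0) _]big_geq // add0r subrr.
Qed.

Lemma hochschild_norm n (x : M n.+1) :
  \sum_(0 <= a < n.+1) bl n a mu (rsum n.+2 x) = rsum n.+1 (cb M n x).
Proof. by rewrite rsum_cb // [X in X + _]big_geq // add0r. Qed.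

Lemma rt_norm n (x : M n) : rt (rsum n.+1 x) = rsum n.+1 x.
Proof. by rewrite rt_rsum rsumS iter_rt_full addrK. Qed.

(** In b e.0 N the part (1 - t) N is 0, and the other part is rewritten with the identity between
    Hochschild boundary and norm. *)
Lemma cb_cB n (x : M n) : cb M n (cB M n.+1 x) = - cB M n (cb M n.-1 x).
Proof.
rewrite cBE cb_unit rt_norm subrr sub0r cBE.
case: n x => [|n] x; first by rewrite big_geq // cb_deg // !linear0.
by rewrite hochschild_norm.
Qed.

(* B B is the Lie derivative along the unit, which is homotopic to 0. *)
Lemma cB_cB n (x : M n) : cB M n.+2 (cB M n.+1 x) = clie M n.+2 e (cB M n.+1 x).
Proof.
rewrite clieE /lie rsum0 linear0 addr0 sgrE /= scaleN1r.
rewrite (cBE _ (cB M n.+1 x)) /rsum linear_sum -sumrN /=.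
rewrite big_add1; apply: eq_big_nat => i Hi /=.
rewrite cBE (iter_rt_bl (i := 0)) ?add0n; [|lia..].
have -> : iter i (@rt _ _ M n) (rsum n.+1 x) = rsum n.+1 x.
  by elim: i {Hi} => //= i ->; rewrite rt_norm.
have Hn : n.+1 = (0 + n.+1)%N by [].
have Hn' : n.+1 = (0 + n.+1)%N by [].
rewrite (bl_gt Hn Hn') // subn0 /sg sgrE /= scaleN1r //.
Qed.

End Homotopies.

(** * The cap product *)

Section CapProduct.
Context {k : comPzRingType} (O : mult_operad k) (M : cyclic_comp_module O).

Notation mu := (omu O).
Notation e := (ounit O).

Lemma bl0_tail q n u (w : O q) (x : M n.+1) : n.+1 = (q + u)%N ->
  \sum_(q <= a < n.+1) bl u 0 w (bl n a mu x)
    = sg q 2 *: \sum_(1 <= a < u.+1) bl u a mu (bl u.+1 0 w x).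
Proof.
move=> Hn; have Hn2 : n.+2 = (2 + n)%N by [].
have Hu : n.+2 = (q + u.+1)%N by lia.
rewrite scaler_sumr; apply: sum_shift => [|a Ha]; first by lia.
by rewrite (bl_gt Hn2 Hu) //; [congr (_ *: bl _ _ _ _)|]; lia.
Qed.

(** The first face composes mu with [w] in its first input. The last one uses t (w.0 x) = w.1 (t x),
    so that [w] falls into the second input of mu. *)
Lemma cb_bl0 q n u (w : O q) (x : M n) : n = (q + u)%N ->
  cb M u (bl u.+1 0 w x)
    = \sum_(1 <= a < u.+1) bl u a mu (bl u.+1 0 w x)
      + bl u 0 (oc q.+1 0 mu w) x + bl u 0 (oc q.+1 1 mu w) (rt x).
Proof.
move=> Hn; have Hu : n.+1 = (q + u.+1)%N by lia.
have Hq : (2 + q = q.+2)%N by [].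
rewrite cbE big_ltn // (bl_in Hu Hq) // subnn (rt_bl _ _ Hu) // (bl_in Hu Hq) //.
by rewrite subn0 [X in X + _]addrC.
Qed.

(** By associativity the wrap-around faces before and after the cap product both become mu o (mu o
    f) acting on t x, and cancel. Faces beyond the inputs of the cap cancel as well; the rest is
    delta f in the second input of mu. *)
Lemma cb_ccap p n u (f : O p) (x : M n) : n = (p.+1 + u)%N ->
  cb M u (ccap M u.+1 f x) - (-1) ^+ p *: ccap M u f (cb M n.-1 x)
    = ccap M u (odelta O p.+1 f) x.
Proof.
case: n x => [//|n] x Hn.
have H2p : (2 + p = p.+2)%N by [].
have H22 : (2 + 2 = 4)%N by [].
have H3p : (2 + p.+1 = p.+3)%N by [].
have Hp2 : (p + 2 = p.+2)%N by lia.
have Hn2 : n.+2 = (2 + n)%N by [].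
have Hpp : (p.+1 + 2 = p.+3)%N by lia.
rewrite !ccapE linearZ /= (cb_bl0 _ _ Hn) /=.
have -> : bl u 0 (oc p.+1 1 mu f) (cb M n x)
    = \sum_(0 <= a < n.+1) bl u 0 (oc p.+1 1 mu f) (bl n a mu x)
      + bl u 0 (oc p.+2 0 (oc p.+1 1 mu f) mu) (rt x).
  by rewrite cbE linearD linear_sum /= (bl_in Hn2 Hpp).
rewrite (sum_split _ (a := 0) (b := p.+1)) ?(bl0_tail _ _ Hn) //; last by lia.
have -> : \sum_(0 <= a < p.+1) bl u 0 (oc p.+1 1 mu f) (bl n a mu x)
    = bl u 0 (oc p.+2 0 (oc p.+1 1 mu f) mu) x + bl u 0 (oc p.+2 1 mu (cir p.+1 f mu)) x.
  rewrite big_nat_recl // (bl_in Hn2 Hpp) // subn0; congr (_ + _).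
  rewrite bllE /cir 2!linear_sum /=; apply: eq_big_nat => a Ha.
  rewrite (bl_in Hn2 Hpp) // subn0 (oc_in H2p Hp2); last by lia.
  by rewrite subn1.
have -> : oc p.+2 0 (oc p.+1 1 mu f) mu
    = - (sg p 2 *: oc p.+2 1 mu (oc p.+1 1 mu f)).
  rewrite (oc_lt H2p H22) // -(oc_in (j := 2) H22 H2p) // oc_mu_mu.
  by rewrite oclE linearN scalerN.
have -> : oc p.+2 0 mu (oc p.+1 1 mu f) = - oc p.+2 1 mu (oc p.+1 0 mu f).
  by rewrite -(oc_in (j := 1) H22 H2p) // -(oc_in (j := 1) H22 H2p) // oc_mu_mu oclE linearN.
have -> : odelta O p.+1 f
    = oc p.+1 0 mu f + oc p.+1 1 mu f - (-1) ^+ p.+1 *: cir p.+1 f mu.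
  by rewrite odeltaE [cir p.+1 mu f]/cir big_nat_recr //= big_nat1.
rewrite !(linearB, linearD, linearN, linearZ) /=.
rewrite !bllE.
rewrite !(linearB, linearD, linearN, linearZ) /= -!bllE.
rewrite /sg; signs; zmod.
Qed.

Lemma ocomp_cap p q (f : O p) (g : O q) :
  ocomp O (p + q).+1 1 (ocomp O p.+1 2 mu f) (ocomp O q.+1 2 mu g)
    = ocomp O (p + q).+1 2 mu (ocup (p + q) f g).
Proof.
rewrite /ocup -(ocompA_in (s := p.+2) (j := 2)); [|lia..].
rewrite -(ocompA_in (s := p.+2) (j := 2)); [|lia..].
rewrite [ocomp O p.+2 1 _ mu](ocompA_lt (t := 3)); [|lia..].
rewrite -(ocompA_in (s := 3) (i := 2) (j := 3)); [|lia..].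
by rewrite /= omuA.
Qed.

Lemma ocomp_deg p q r i (f : O p) (g : O q) : (p + q)%N <> r.+1 -> ocomp O r i f g = 0.
Proof. by move=> /eqP neq; rewrite (gb_deg (ocomp_bilinear O i)). Qed.

Lemma ocupA p q r u (f : O p) (g : O q) (h : O r) :
  ocup u (ocup (p + q) f g) h = ocup u f (ocup (q + r) g h).
Proof.
have [Hu|Hu] := eqVneq (p + q + r)%N u; last by rewrite /ocup !(@ocomp_deg _ _ u) //; lia.
by rewrite {1}/ocup -ocomp_cap (ocompA_in (t := (q + r)%N)) //; lia.
Qed.

Lemma ocup1l p (f : O p) : ocup p e f = f.
Proof. by rewrite /ocup omu1r ocomp1l. Qed.

Lemma ocup1r p (f : O p) : ocup p f e = f.
Proof. by rewrite /ocup (ocompA_lt (t := 1%N)) ?addn0 //= ?omu1l ?ocomp1l //; lia. Qed.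

Lemma ccap_deg p n m (f : O p) (x : M n) : n <> (p + m)%N -> ccap M m f x = 0.
Proof. by move=> neq; rewrite /ccap (gb_deg (bul_bilinear M 0)) //; apply/eqP; lia. Qed.

Lemma ccap_cup p q n m (f : O p) (g : O q) (x : M n) :
  ccap M m (ocup (p + q) f g) x = ccap M m f (ccap M (n - q) g x).
Proof.
have [Hn|Hn] := eqVneq n (p + q + m)%N; last first.
  rewrite ccap_deg; last by lia.
  have [le_qn|lt_nq] := leqP q n; first by rewrite [RHS]ccap_deg //; lia.
  by rewrite [ccap M (n - q) g x]ccap_deg ?linear0 //; lia.
by rewrite /ccap (bulA_in (s := (p + q).+1)) //= ?ocomp_cap //; lia.
Qed.

Lemma ccap_unit n (x : M n) : ccap M n e x = x.
Proof. by rewrite /ccap omu1r bul1. Qed.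

End CapProduct.

(** * Lie derivatives and cap products *)

Section Mixed.
Context {k : comPzRingType} (O : mult_operad k) (M : cyclic_comp_module O).

Notation mu := (omu O).

(* The homotopy for the compatibility of Lie derivative and cap product. *)
Definition winding p q n u (f : O p) (g : O q) (x : M n) : M u :=
  \sum_(0 <= i < p) bl u 0 (oc (p + q).-1 i f g) (rsum i x).

Lemma winding_linear p q n u (f : O p) (g : O q) : linear (@winding p q n u f g).
Proof.
move=> a x y; rewrite /winding scaler_sumr -big_split; apply: eq_bigr => j _ /=.
by rewrite !linearP.
Qed.
HB.instance Definition _ p q n u f g :=
  GRing.isLinear.Build k (M n) (M u) *:%R (@winding p q n u f g) (@winding_linear p q n u f g).

Definition windingl p q n u (g : O q) (x : M n) (f : O p) : M u := winding u f g x.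
Lemma windingl_linear p q n u g x : linear (@windingl p q n u g x).
Proof.
move=> a v w; rewrite /windingl /winding scaler_sumr -big_split; apply: eq_bigr => j _ /=.
by rewrite !bllE !oclE !linearP.
Qed.
HB.instance Definition _ p q n u g x :=
  GRing.isLinear.Build k (O p) (M u) *:%R (@windingl p q n u g x) (@windingl_linear p q n u g x).

Definition windingm p q n u (f : O p) (x : M n) (g : O q) : M u := winding u f g x.
Lemma windingm_linear p q n u f x : linear (@windingm p q n u f x).
Proof.
move=> a v w; rewrite /windingm /winding scaler_sumr -big_split; apply: eq_bigr => j _ /=.
by rewrite !bllE !linearP.
Qed.
HB.instance Definition _ p q n u f x :=
  GRing.isLinear.Build k (O q) (M u) *:%R (@windingm p q n u f x) (@windingm_linear p q n u f x).

Lemma windinglE p q n u (f : O p) (g : O q) (x : M n) : winding u f g x = windingl u g x f.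
Proof. by []. Qed.
Lemma windingmE p q n u (f : O p) (g : O q) (x : M n) : winding u f g x = windingm u f x g.
Proof. by []. Qed.

(** After [rsum_cb], mu falls beyond the inputs of f o_i g, into an input of [f] right of [g], into
    [g], or into an input of [f] left of [g]. Only the last kind carries T_(i+1). *)
Lemma winding_cb p q s n u (f : O p) (g : O q) (x : M n.+1) :
    (p + q = s.+1)%N -> (n.+1 = s + u)%N ->
  winding u f g (cb M n x)
    = sg s 2 *: (\sum_(1 <= a < u.+1) bl u a mu (winding u.+1 f g x))
      + \sum_(0 <= i < p) \sum_(i + q <= a < s) bl u 0 (oc s.+1 a (oc s i f g) mu) (rsum i x)
      + \sum_(0 <= i < p) \sum_(i <= a < i + q) bl u 0 (oc s.+1 a (oc s i f g) mu) (rsum i x)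
      + \sum_(0 <= i < p) \sum_(0 <= a < i) bl u 0 (oc s.+1 a (oc s i f g) mu) (rsum i.+1 x).
Proof.
move=> Hs Hn.
have Hn2 : n.+2 = (2 + n)%N by [].
have Hs2 : (s + 2 = s.+2)%N by lia.
under eq_bigr do rewrite /winding linear_sum.
rewrite exchange_big /= scaler_sumr -!big_split /= /winding Hs /=.
apply: eq_big_nat => i Hi.
rewrite rsum_cb; last by lia.
rewrite linearD [X in X + _ = _]linear_sum [X in _ + X = _]linear_sum /=.
rewrite (sum_split _ (a := i) (b := (i + q)%N)); [|lia|lia].
rewrite (sum_split _ (a := (i + q)%N) (b := s)); [|lia|lia].
rewrite (bl0_tail _ _ Hn).
have E a b c : (b <= s)%N -> \sum_(a <= j < b) bl u 0 (oc s i f g) (bl n j mu (rsum c x))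
    = \sum_(a <= j < b) bl u 0 (oc s.+1 j (oc s i f g) mu) (rsum c x).
  move=> le_bs; apply: eq_big_nat => j Hj.
  by rewrite (bl_in Hn2 Hs2) ?subn0 //; lia.
rewrite !E; [zmod|lia..].
Qed.

Section Terms.
Variables (p q s n u : nat) (f : O p) (g : O q) (x : M n).
Hypothesis Hs : (p + q = s.+1)%N.
Hypothesis Hn : n = (s + u)%N.

(** The terms shared by the expansions below: in [P] and [Q] mu is outermost, in [E1], [E2], [E3] it
    is inserted into f o_i g, and in [F0], [F1] it is composed with [g] inside [f]. The sum [G]
    records the defect T_(i+1) - T_i = t^i. *)
Let tail := \sum_(1 <= a < u.+1) bl u a mu (winding u.+1 f g x).
Let P := \sum_(0 <= i < p) bl u 0 (oc s.+1 0 mu (oc s i f g)) (rsum i x).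
Let Q := \sum_(0 <= i < p) bl u 0 (oc s.+1 1 mu (oc s i f g)) (rsum i.+1 x).
Let E1 := \sum_(0 <= i < p) \sum_(i + q <= a < s) bl u 0 (oc s.+1 a (oc s i f g) mu) (rsum i x).
Let E2 := \sum_(0 <= i < p) \sum_(i <= a < i + q) bl u 0 (oc s.+1 a (oc s i f g) mu) (rsum i x).
Let E3 := \sum_(0 <= i < p) \sum_(0 <= a < i) bl u 0 (oc s.+1 a (oc s i f g) mu) (rsum i.+1 x).
Let F0 := \sum_(0 <= i < p) bl u 0 (oc s.+1 i f (oc q.+1 0 mu g)) (rsum i x).
Let F1 := \sum_(0 <= i < p) bl u 0 (oc s.+1 i f (oc q.+1 1 mu g)) (rsum i x).
Let G := \sum_(0 <= i < p) bl u 0 (oc s.+1 i f (oc q.+1 1 mu g)) (iter i (@rt _ _ M n) x).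

Lemma cb_wrap : cb M u (winding u.+1 f g x)
  = tail + P + Q - bl u 0 (oc s.+1 1 mu (cir s f g)) x.
Proof.
rewrite /tail /winding Hs linear_sum /=.
under eq_bigr do rewrite (cb_bl0 _ _ Hn) rt_rsum linearB.
rewrite !big_split /= sumrN.
have -> : \sum_(0 <= i < p) bl u 0 (oc s.+1 1 mu (oc s i f g)) x
    = bl u 0 (oc s.+1 1 mu (cir s f g)) x.
  by rewrite [RHS]bllE /cir !linear_sum.
rewrite exchange_big /=; under [X in _ = X + _ + _ - _]eq_bigr do rewrite linear_sum.
rewrite /P /Q; zmod.
Qed.

(** The last input of mu o f is the free input of mu when [f] is in the first one; there [g] gets
    weight T_p, the extra term. The free first input in the other case has weight T_0 = 0. *)
Lemma winding_cir_mu : winding u (cir p.+1 mu f) g x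
  = P + Q + sg p q *: bl u 0 (oc s.+1 0 (oc q.+1 1 mu g) f) (rsum p x).
Proof.
have H2p : (2 + p = p.+2)%N by [].
have H2q : (2 + q = q.+2)%N by [].
have -> : cir p.+1 mu f = oc p.+1 0 mu f + oc p.+1 1 mu f.
  by rewrite /cir big_nat_recr //= big_nat1.
rewrite windinglE linearD /= -!windinglE /winding addSn Hs /=.
rewrite [X in _ + X]big_nat_recl // rsum0 linear0 add0r.
rewrite [X in X + _]big_nat_recr //=.
rewrite (oc_gt H2p H2q) ?subnn; last by lia.
rewrite [bl u 0 (_ *: _) _]bllE linearZ /= -bllE addrAC; congr (_ + _ + _).
  apply: eq_big_nat => i Hi; rewrite (oc_in H2p Hs) ?subn0 //; lia.
apply: eq_big_nat => i Hi; rewrite (oc_in H2p Hs) ?subn1 //; lia.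
Qed.

Lemma winding_cir_mur : winding u (cir p.+1 f mu) g x = sg q 2 *: (E1 + E3) + F0 + F1 + G.
Proof.
have Hp2 : (p + 2 = p.+2)%N by lia.
have H2q : (2 + q = q.+2)%N by [].
rewrite windinglE /cir linear_sum /= /windingl /winding addSn Hs /=.
rewrite scalerDr /E1 /E3.
have -> : \sum_(0 <= i < p) \sum_(i + q <= a < s) bl u 0 (oc s.+1 a (oc s i f g) mu) (rsum i x)
   = \sum_(0 <= a < p) \sum_(0 <= i < a) bl u 0 (oc s.+1 (a + q).-1 (oc s i f g) mu) (rsum i x).
  rewrite sum_triangle; apply: eq_big_nat => i Hi.
  by apply: sum_shift => [|a Ha]; [lia|congr (bl _ _ (oc _ _ _ _) _); lia].
rewrite [X in _ *: _ + _ *: X]sum_triangle !scaler_sumr /F0 /F1 /G -!big_split /=.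
apply: eq_big_nat => a Ha.
rewrite (sum_split _ (b := a)); [|lia|lia].
rewrite (sum_split _ (a := a) (b := a.+2)); [|lia|lia].
rewrite big_nat_recr //= big_nat1 !(oc_in Hp2 H2q); [|lia|lia].
rewrite subnn subSnn rsumS linearD /=.
have -> : \sum_(0 <= i < a) bl u 0 (oc s.+1 i (oc p.+1 a f mu) g) (rsum i x)
  = sg q 2 *: \sum_(0 <= i < a) bl u 0 (oc s.+1 (a + q).-1 (oc s i f g) mu) (rsum i x).
  rewrite scaler_sumr; apply: eq_big_nat => i Hi.
  rewrite (oc_lt Hp2 Hs) 1?sgC; last by lia.
  by rewrite bllE linearZ.
have -> : \sum_(a.+2 <= i < p.+1) bl u 0 (oc s.+1 i (oc p.+1 a f mu) g) (rsum i x)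
  = sg q 2 *: \sum_(a.+1 <= i < p) bl u 0 (oc s.+1 a (oc s i f g) mu) (rsum i.+1 x).
  rewrite scaler_sumr; apply: sum_shift => [|i Hi]; first by lia.
  rewrite (oc_gt Hp2 Hs) 1?sgC; last by lia.
  rewrite bllE linearZ /= -bllE.
  by congr (_ *: bl _ _ (oc _ _ (oc _ _ _ _) _) (rsum _ _)); lia.
zmod.
Qed.

Lemma winding_mu_cir : winding u f (cir q.+1 mu g) x = F0 + F1.
Proof.
rewrite /winding addnS Hs /= /F0 /F1 -big_split; apply: eq_bigr => i _ /=.
by rewrite /cir big_nat_recr //= big_nat1 linearD bllE linearD.
Qed.

Lemma winding_cir_mu_r : winding u f (cir q.+1 g mu) x = E2.
Proof.
have Hq2 : (q + 2 = q.+2)%N by lia.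
rewrite /winding addnS Hs /= /E2; apply: eq_big_nat => i Hi.
rewrite bllE /cir !linear_sum; apply: sum_shift => [|a Ha] /=; first by lia.
by rewrite (oc_in Hs Hq2) ?addnK ?addn0 //; lia.
Qed.

(** The shared terms cancel. What survives are the three defects: from t T_i = T_(i+1) - 1 in the
    wrap-around face, from the free input of mu, and [G]. *)
Lemma winding_homotopy :
  cb M u (winding u.+1 f g x) - (-1) ^+ (p + q) *: winding u f g (cb M n.-1 x)
      - winding u (odelta O p.+1 f) g x - (-1) ^+ p.+1 *: winding u f (odelta O q.+1 g) x
    = - bl u 0 (oc s.+1 1 mu (cir s f g)) x
      - sg p q *: bl u 0 (oc s.+1 0 (oc q.+1 1 mu g) f) (rsum p x)
      + (-1) ^+ p.+1 *: G.
Proof.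
have -> : winding u f g (cb M n.-1 x) = sg s 2 *: tail + E1 + E2 + E3.
  rewrite /tail /E1 /E2 /E3; move: Hn x; case: n => [|n'] Hn' x'; last exact: winding_cb.
  (* In degree 0 the boundary vanishes, and p + q = 1 leaves no position for mu in the sums [E1],
     [E2], [E3]. *)
  have u0 : u = 0%N by lia.
  have s0 : s = 0%N by lia.
  rewrite cb_deg // linear0 u0 s0 [\sum_(1 <= _ < _) _]big_geq // scaler0 add0r.
  have zero (F : nat -> nat -> M 0) (l r : nat -> nat) :
      (forall i j, (i < p)%N -> (l i <= j)%N -> (r i <= j)%N) ->
      \sum_(0 <= i < p) \sum_(l i <= a < r i) F i a = 0.
    by move=> Hlr; apply: sum_nat0 => i Hi; apply: sum_nat0 => j Hj; have := Hlr i j; lia.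
  by rewrite !zero ?addr0 //; lia.
rewrite cb_wrap !odeltaE [winding u (_ - _) g x]windinglE [winding u f (_ - _) x]windingmE.
rewrite !(linearB, linearZ) /= -!windinglE -!windingmE winding_cir_mu winding_cir_mur.
rewrite winding_mu_cir winding_cir_mu_r.
have -> : sg s 2 = (-1) ^+ (p + q) :> k by rewrite /sg -Hs; apply: eq_sign; rewrite oddM andbT.
rewrite /sg; signs; zmod.
Qed.

End Terms.

(** At position 0 [f] meets the free input of mu, at positions 1 to q an input of [g], and beyond
    them it passes the cap product. The subtracted sum is the wrap-around part needed to complete
    the latter to a full Lie derivative. *)
Lemma lie_cap p q n u (f : O p) (g : O q) (x : M n) : n.+1 = (p + q + u)%N ->
  bl u 0 (oc q.+1 1 mu g) (lie (q + u) f x)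
    = bl u 0 (oc (p + q) 1 mu (cir (p + q).-1 g f)) x
      + bl u 0 (oc (p + q) 0 (oc q.+1 1 mu g) f) (rsum p x)
      + sg q.+1 p *:
          (lie u f (bl (n - q) 0 (oc q.+1 1 mu g) x)
            - \sum_(0 <= i < p) bl u 0 (oc (p + q) i f (oc q.+1 1 mu g)) (iter i (@rt _ _ M n) x)).
Proof.
move=> Hn; set nu := oc q.+1 1 mu g.
have Hm : n.+1 = (p + (q + u))%N by lia.
have Hqp : (q.+1 + p = (p + q).+1)%N by lia.
have Hpq : (p + q.+1 = (p + q).+1)%N by lia.
have H2q : (2 + q = q.+2)%N by [].
rewrite {1}/lie linearD [X in X + _ = _]linear_sum /= (bl_in Hm Hqp) // subnn.
rewrite (sum_split _ (b := q.+1)); [|lia|lia].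
have -> : \sum_(1 <= i < q.+1) bl u 0 nu (bl (q + u) i f x)
    = bl u 0 (oc (p + q) 1 mu (cir (p + q).-1 g f)) x.
  rewrite [RHS]bllE /cir !linear_sum big_add1; apply: eq_big_nat => i Hi /=.
  rewrite (bl_in Hm Hqp) ?subn0; [|lia].
  by rewrite (oc_in (t := (p + q).-1) H2q) ?subn1; [|lia..].
have [pu0|pu_gt0] := posnP (p + u).
  have [p0 u0] : p = 0%N /\ u = 0%N by lia.
  have -> : bl (n - q) 0 nu x = 0 by rewrite bl_deg //; lia.
  have -> : rsum p x = 0 by rewrite p0 rsum0.
  have lie0 : lie u f (0 : M (n - q)%N) = 0 by rewrite linear0.
  rewrite lie0 {lie0}.
  rewrite linear0 [X in _ - X](big_geq (n := p)) ?p0 // subr0 scaler0 addr0.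
  by rewrite !addr0 [X in _ + X]big_geq ?addr0 //; lia.
have Hl : n.+1 = (q.+1 + (n - q))%N by lia.
have -> : \sum_(q.+1 <= i < (q + u).+1) bl u 0 nu (bl (q + u) i f x)
    = sg q.+1 p *: \sum_(1 <= i < u.+1) bl u i f (bl (n - q) 0 nu x).
  rewrite scaler_sumr; apply: sum_shift => [|i Hi]; first by lia.
  by rewrite (bl_gt Hm Hl) //; [congr (_ *: bl _ _ _ _)|]; lia.
have <- : bl u 0 f (rsum p (bl (n - q) 0 nu x))
   = \sum_(0 <= i < p) bl u 0 (oc (p + q) i f nu) (iter i (@rt _ _ M n) x).
  rewrite [rsum _ (bl _ _ _ _)]/rsum linear_sum; apply: eq_big_nat => i Hi /=.
  by rewrite (iter_rt_bl _ _ Hl) ?(bl_in Hl Hpq) ?subn0 //; lia.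
rewrite /lie addrK; zmod.
Qed.

Lemma mixed_homotopy p q n u (f : O p) (g : O q) (x : M n) : n.+1 = (p + q + u)%N ->
  ccap M u g (clie M (q + u) f x) - ccap M u (obrk (q + p).-1 g f) x
      - (-1) ^+ (p.+1 * q) *: clie M u f (ccap M (n - q) g x)
    = (-1) ^+ (p * q) *:
        (cb M u (winding u.+1 f g x) - (-1) ^+ (p + q) *: winding u f g (cb M n.-1 x)
          - winding u (odelta O p.+1 f) g x - (-1) ^+ p.+1 *: winding u f (odelta O q.+1 g) x).
Proof.
move=> Hn.
have -> : cb M u (winding u.+1 f g x) - (-1) ^+ (p + q) *: winding u f g (cb M n.-1 x)
    - winding u (odelta O p.+1 f) g x - (-1) ^+ p.+1 *: winding u f (odelta O q.+1 g) x
  = - bl u 0 (oc (p + q) 1 mu (cir (p + q).-1 f g)) x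
    - sg p q *: bl u 0 (oc (p + q) 0 (oc q.+1 1 mu g) f) (rsum p x)
    + (-1) ^+ p.+1 *: \sum_(0 <= i < p)
        bl u 0 (oc (p + q) i f (oc q.+1 1 mu g)) (iter i (@rt _ _ M n) x).
  (* For p = 0 the windings of [f] are empty, and that of delta f has only the weight T_0 = 0; the
     right-hand side vanishes too. *)
  have [p0|p_gt0] := posnP p; last first.
    have Hs : (p + q = (p + q).-1.+1)%N by lia.
    by rewrite (winding_homotopy _ _ _ Hs) -?Hs; last by lia.
  have winding0 v w (y : M w) : winding v f g y = 0 by rewrite /winding big_geq ?p0.
  have -> : winding u f (odelta O q.+1 g) x = 0 by rewrite /winding big_geq ?p0.
  have -> : winding u (odelta O p.+1 f) g x = 0.
    rewrite /winding big_nat_recl // rsum0 linear0 add0r big_geq ?p0 //.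
  have -> : cir (p + q).-1 f g = 0 by rewrite /cir big_geq ?p0.
  have -> : rsum p x = 0 by rewrite p0 rsum0.
  rewrite !winding0 big_geq ?p0 // !linear0 bllE linear0.
  by rewrite !(scaler0, oppr0, addr0).
have ccap_cir (h : O p) (l : O q) (h' := cir (p + q).-1 h l) (l' := cir (p + q).-1 l h) :
    ccap M u h' x = (-1) ^+ (p + q) *: bl u 0 (oc (p + q) 1 mu h') x
    /\ ccap M u l' x = (-1) ^+ (p + q) *: bl u 0 (oc (p + q) 1 mu l') x.
  rewrite !ccapE; have [pq0|pq_gt0] := posnP (p + q); last first.
    by have -> : (p + q).-1.+1 = (p + q)%N by lia.
  have [-> ->] : h' = 0 /\ l' = 0 by rewrite /h' /l' !cir_deg //; lia.
  by rewrite !linear0 !bllE !linear0 ?scaler0.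
have [Efg Egf] := ccap_cir f g.
rewrite !clieE !linearZ /= ccapE lie_cap // (addnC q p).
rewrite obrkE [ccap M u (_ - _) x]ccaplE !(linearB, linearZ) /= -!ccaplE Efg Egf !ccapE !linearZ /=.
rewrite /sg; signs; zmod.
Qed.

End Mixed.

(** * Normalisation *)

Section Normalised.
Context {k : comPzRingType} (O : mult_operad k) (M : cyclic_comp_module O).

Notation mu := (omu O).
Notation e := (ounit O).
Notation D n := (degenerate M n).

Lemma bl_degenerate n i (y : M n) : (0 < i)%N -> bl n.+1 i e y \in D n.+1.
Proof.
case: i => // i _; have [lt_in|le_ni] := ltnP i n.+1; last first.
  by rewrite bl_out // rpred0.
rewrite inE; apply/asboolP.
exists (fun j : 'I_n.+1 => if j == Ordinal lt_in then (-1) ^+ (1 * i.+1) *: y else 0).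
rewrite (bigD1 (Ordinal lt_in)) //= eqxx bulZr blE big1 ?addr0 // => j /negPf ->.
by rewrite -(scale0r 0) bulZr scale0r.
Qed.

Lemma descends_linear (F : forall n m, M n -> M m) :
    (forall n m, linear (F n m)) ->
    (forall n m i (y : M n), (0 < i <= n.+1)%N -> F n.+1 m (bl n.+1 i e y) \in D m) ->
  descends F.
Proof.
move=> linF degF n m x; have F0 : F n m 0 = 0 by exact: linear_fun0.
case: n x F0 => [|n] x F0; rewrite inE => /asboolP[y ->].
  by rewrite big_ord0 F0 rpred0.
have FD u v : F n.+1 m (u + v) = F n.+1 m u + F n.+1 m v.
  by have := linF n.+1 m 1 u v; rewrite !scale1r.
have FZ a u : F n.+1 m (a *: u) = a *: F n.+1 m u.
  by have := linF n.+1 m a u 0; rewrite !addr0 F0 addr0.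
rewrite (big_morph (F n.+1 m) FD F0); apply: rpred_sum => j _.
have -> : bul M n.+1 j.+1 e (y j) = (-1) ^+ (1 * j.+1) *: bl n.+1 j.+1 e (y j).
  by rewrite blE scalerA -expr2 sqrr_sign scale1r.
by rewrite FZ rpredZ // degF //= ltn_ord.
Qed.

(** Up to sign e.0 e.i = e.(i+1) e.0, and position i + 1 is positive even if i = 0. *)
Lemma unit_unit_degenerate n i (y : M n) : bl n.+2 0 e (bl n.+1 i e y) \in D n.+2.
Proof.
have Hn : n.+1 = (0 + n.+1)%N by [].
by rewrite (bl_gt Hn Hn) // subn0 rpredZ // bl_degenerate.
Qed.

(** Rotation may bring the unit to position 0, where the chain need not be degenerate; this is
    harmless under e.0 or under f.0 with [f] normalised. *)
Lemma iter_rt_unit n i j (y : M n) : (i <= n.+1)%N ->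
  exists2 c, (c <= n.+1)%N & exists w : M n,
    iter j (@rt _ _ M _) (bl n.+1 i e y) = bl n.+1 c e w.
Proof.
move=> le_in; elim: j => [|j [c le_c [w IHj]]]; first by exists i => //; exists y.
have Hn : n.+1 = (0 + n.+1)%N by [].
rewrite iterS IHj; have [lt_c|ge_c] := ltnP c n.+1.
  by exists c.+1 => //; exists (rt w); rewrite (rt_bl _ _ Hn).
have -> : c = n.+1 by lia.
by exists 0%N => //; exists w; rewrite (rt_bl_last _ _ Hn).
Qed.

Lemma unit_rsum_degenerate n m i c (y : M n) : (i <= n.+1)%N ->
  bl m 0 e (rsum c (bl n.+1 i e y)) \in D m.
Proof.
move=> le_in; have [Hm|/eqP Hm] := eqVneq m n.+2; last by rewrite bl_deg ?rpred0 //; lia.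
subst m; rewrite linear_sum rpred_sum // => j _ /=.
by have [a _ [w ->]] := iter_rt_unit j y le_in; rewrite unit_unit_degenerate.
Qed.

Lemma normalised_oc p r i (f : O p) : normalised O f -> oc r i f e = 0.
Proof.
move=> nf; have [le_pi|lt_ip] := leqP p i; first exact: oc_out.
have [Hr|Hr] := eqVneq (p + 0)%N r.+1; last by apply: oc_deg; apply/eqP.
have -> : r = p.-1 by lia.
by rewrite ocE nf ?scaler0 //; lia.
Qed.

(** The unit lies inside [f], where normalisation gives 0, or it moves out to the left or to the
    right of [f]. *)
Lemma normalised_bl_unit p n m a i (f : O p) (y : M n) : normalised O f ->
  [\/ bl m a f (bl n.+1 i e y) = 0,
      exists2 l, m = l.+1 & (i < a)%N /\ exists w : M l,
        bl m a f (bl n.+1 i e y) = bl m i e w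
    | exists2 l, m = l.+1 & exists w : M l,
        bl m a f (bl n.+1 i e y) = bl m (i - p).+1 e w].
Proof.
move=> nf; have [Hm|/eqP Hm] := eqVneq n.+2 (p + m)%N; last first.
  by constructor 1; rewrite bl_deg.
have Hn : n.+1 = (0 + n.+1)%N by [].
have [lt_ma|le_am] := ltnP m a; first by constructor 1; rewrite bl_out.
have [lt_ia|le_ai] := ltnP i a.
  case: m Hm le_am => [|l] Hm le_am; first lia.
  have Hl : n.+1 = (p + l)%N by lia.
  constructor 2; exists l => //; split=> //.
  by exists (sg p 0 *: bl l (a + 0).-1 f y); rewrite (bl_lt Hn Hl) // linearZ.
have [lt_iap|le_api] := ltnP i (a + p).
  case: p f nf Hm lt_iap => [|p] f nf Hm lt_iap; first lia.
  constructor 1; rewrite (bl_in (s := p) Hn) ?addn0 //; last lia.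
  by rewrite normalised_oc // bllE linear0.
have [lt_ni|le_in] := ltnP n.+1 i.
  by constructor 1; rewrite (bl_out e y) ?linear0.
case: m Hm le_am => [|l] Hm le_am; first lia.
have Hl : n.+1 = (p + l)%N by lia.
constructor 3; exists l => //.
by exists (sg p 0 *: bl l a f y); rewrite (bl_gt Hn Hl) // linearZ.
Qed.

Lemma normalised_bl_degenerate p n m a i (f : O p) (y : M n) : normalised O f ->
  (a == 0) || (0 < i)%N -> bl m a f (bl n.+1 i e y) \in D m.
Proof.
move=> nf Hai; have [->|[l Hl [lt_ia [w ->]]]|[l Hl [w ->]]] := normalised_bl_unit m a i y nf.
- exact: rpred0.
- by subst m; apply: bl_degenerate; lia.
- by subst m; apply: bl_degenerate.
Qed.

Lemma normalised_unit_degenerate p n m a i (f : O p) (y : M n) : normalised O f ->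
  bl m.+1 0 e (bl m a f (bl n.+1 i e y)) \in D m.+1.
Proof.
move=> nf; have [->|[l Hl [lt_ia [w ->]]]|[l Hl [w ->]]] := normalised_bl_unit m a i y nf.
- by rewrite linear0 rpred0.
- by subst m; apply: unit_unit_degenerate.
- by subst m; apply: unit_unit_degenerate.
Qed.

(** Exactly two faces meet the unit, and they cancel by the unit laws; the others stay degenerate.
    For a unit in last position, the second of the two is the wrap-around face. *)
Lemma cb_descends : descends (fun n m x => cb M m x).
Proof.
apply: descends_linear => [n m|n m i y Hi]; first exact: linearP.
have [Hm|/eqP Hm] := eqVneq m n; last by rewrite cb_deg ?rpred0 //; lia.
subst m; have Hn : n.+1 = (0 + n.+1)%N by [].
have H2 : (2 + 0 = 2)%N by [].
have sg20 : sg 2 0 = -1 :> k by rewrite /sg sgrE.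
have lt_deg a (z : M n) : (0 < i < a)%N -> (a <= n)%N -> bl n a mu (bl n.+1 i e z) \in D n.
  case: n i y Hi Hn z => [|n] i y Hi Hn z Hia le_an; first lia.
  have Hl : n.+2 = (2 + n)%N by [].
  by rewrite (bl_lt Hn Hl) ?rpredZ ?bl_degenerate //; lia.
have gt_deg a c (z : M n) : (a + 2 <= c <= n.+1)%N -> bl n a mu (bl n.+1 c e z) \in D n.
  case: n i y Hi Hn lt_deg z => [|n] i y Hi Hn _ z Hca; first lia.
  have Hl : n.+2 = (2 + n)%N by [].
  by rewrite (bl_gt Hn Hl) ?rpredZ ?bl_degenerate //; lia.
have eq_i (z : M n) a : (a <= n)%N -> bl n a mu (bl n.+1 a e z) = z.
  by move=> le_an; rewrite (bl_in Hn H2) ?subnn ?oc_mu0_unit ?bl_id //; lia.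
have eq_i1 (z : M n) a : (a <= n)%N -> bl n a mu (bl n.+1 a.+1 e z) = - z.
  move=> le_an; rewrite (bl_in Hn H2) ?subSnn ?oc_mu1_unit; [|lia].
  by rewrite bllE linearN /= -bllE bl_id.
case: i Hi lt_deg => // i Hi lt_deg; rewrite cbE.
rewrite (sum_split _ (a := 0) (b := i)); [|lia|lia].
rewrite [X in _ + X + _]big_ltn ?eq_i1; [|lia..].
rewrite -!addrA rpredD //.
  by rewrite big_nat rpred_sum // => a Ha; apply: gt_deg; lia.
have [lt_in|ge_in] := ltnP i n.
  rewrite big_ltn ?eq_i; [|lia..].
  rewrite -!addrA addKr rpredD //.
    by rewrite big_nat rpred_sum // => a Ha; apply: lt_deg; lia.
  by rewrite (rt_bl _ _ Hn) //; apply: gt_deg; lia.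
have -> : i = n by lia.
by rewrite big_geq // add0r (rt_bl_last _ _ Hn) eq_i //= addNr rpred0.
Qed.

(** Position i = 0 is included in order to show that B S_f is degenerate, S_f beginning with e.0. *)
Lemma cB_unit_degenerate n m i (y : M n) : (i <= n.+1)%N ->
  cB M m (bl n.+1 i e y) \in D m.
Proof. by move=> le_in; rewrite cBE unit_rsum_degenerate. Qed.

Lemma cB_descends : descends (fun n m x => cB M m x).
Proof.
apply: descends_linear => [n m|n m i y Hi]; first exact: linearP.
by rewrite cB_unit_degenerate //; lia.
Qed.

Section Cochain.
Variables (p : nat) (f : O p).
Hypothesis nf : normalised O f.

Lemma ccap_descends : descends (fun n m x => ccap M m f x).
Proof.
apply: descends_linear => [n m|n m i y Hi]; first exact: linearP.
rewrite ccapE rpredZ //.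
have [Hm|/eqP Hm] := eqVneq n.+1 (p + m)%N; last by rewrite bl_deg ?rpred0 //; lia.
have Hn : n.+1 = (0 + n.+1)%N by [].
have [lt_ip|le_pi] := ltnP i p.+1.
  rewrite (bl_in (s := p) Hn) ?subn0; [|lia..].
  case: p f nf Hm lt_ip => [|q] g ng Hm lt_ip; first lia.
  have H2q : (2 + q.+1 = q.+3)%N by [].
  rewrite (oc_in (t := q) H2q) ?addn0 //; last by lia.
  by rewrite normalised_oc // linear0 bllE linear0 rpred0.
case: m Hm => [|l] Hm; first lia.
have Hl : n.+1 = (p.+1 + l)%N by lia.
by rewrite (bl_gt Hn Hl) ?rpredZ ?bl_degenerate //; lia.
Qed.

Lemma unit_ins_degenerate n m i (y : M n) : (i <= n.+1)%N ->
  bl m.+1 0 e (ins m f (bl n.+1 i e y)) \in D m.+1.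
Proof.
move=> le_in; rewrite linear_sum rpred_sum // => a _ /=.
rewrite 2!linear_sum rpred_sum // => j _ /=.
have [c _ [w ->]] := iter_rt_unit j y le_in.
exact: normalised_unit_degenerate.
Qed.

(** Position i = 0 is included in order to treat S_f B, as B begins with e.0. *)
Lemma cS_unit_degenerate n m i (y : M n) : (i <= n.+1)%N ->
  cS M m f (bl n.+1 i e y) \in D m.
Proof.
move=> le_in; rewrite cSE rpredZ //.
have [->|/eqP Hm] := eqVneq m (n.+2 - p).+1; first exact: unit_ins_degenerate.
by rewrite bl_deg ?rpred0 //; lia.
Qed.

Lemma cS_descends : descends (fun n m x => cS M m f x).
Proof.
apply: descends_linear => [n m|n m i y Hi]; first exact: linearP.
by rewrite cS_unit_degenerate //; lia.
Qed.

Lemma clie_descends : descends (fun n m x => clie M m f x).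
Proof.
apply: descends_linear => [n m|n m i y Hi]; first exact: linearP.
rewrite clieE rpredZ // rpredD //.
  by rewrite big_nat rpred_sum // => a Ha; apply: normalised_bl_degenerate => //; lia.
rewrite linear_sum rpred_sum // => j _ /=.
have [|c _ [w ->]] := iter_rt_unit (i := i) j y; first lia.
exact: normalised_bl_degenerate.
Qed.

Lemma sum_delta (V : zmodType) n i (v : V) :
  \sum_(0 <= a < n) (if a == i then v else 0) = if (i < n)%N then v else 0.
Proof.
elim: n => [|n IHn]; first by rewrite big_geq.
rewrite big_nat_recr //= IHn ltnS [(i <= n)%N]leq_eqVlt (eq_sym n).
by have [->|] := eqVneq i n; rewrite ?ltnn ?add0r ?addr0.
Qed.

Lemma oc_id i : (i < p)%N -> oc p i f (oid O) = f.
Proof.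
move=> lt_ip; rewrite ocE ocomp1r //.
by rewrite mul2n -signr_odd odd_double scale1r.
Qed.

(** Only terms where the unit meets mu survive. In f o_a mu these are a = i and a = i - 1, with
    opposite signs; at the ends i = p and i = 0 the missing partner comes from mu with [f] in its
    first or second input. *)
Lemma odelta_normalised : normalised O (odelta O p.+1 f).
Proof.
move=> i Hi; case: i Hi => // i Hi.
suff Ei : oc p i (odelta O p.+1 f) e = 0.
  move: Ei; rewrite ocE => /(congr1 (fun z => (-1) ^+ (1 * i) *: z)).
  by rewrite scaler0 scalerA -expr2 sqrr_sign scale1r.
have H2p : (2 + p = p.+2)%N by [].
have Hp2 : (p + 2 = p.+2)%N by lia.
have H20 : (2 + 0 = 2)%N by [].
have sgp0 : sg p 0 = (-1) ^+ p.+1 :> k by rewrite /sg muln1.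
have E0 : oc p i (oc p.+1 0 mu f) e = if (i == p)%N then - ((-1) ^+ p.+1 *: f) else 0.
  have [->|ne_ip] := eqVneq i p.
    rewrite (oc_gt H2p H20) ?subnn // oc_mu1_unit.
    by rewrite oclE linearN /= -oclE oc_1l sgp0 scalerN.
  case: p f nf Hi ne_ip {Hp2 sgp0} H2p => [|q] g ng Hi ne_iq H2q; first lia.
  by rewrite (oc_in (t := q) H2q) ?addn0 ?normalised_oc ?linear0 //; lia.
have E1 : oc p i (oc p.+1 1 mu f) e = if (i == 0)%N then (-1) ^+ p.+1 *: f else 0.
  have [->|ne_i0] := eqVneq i 0%N.
    by rewrite (oc_lt H2p H20) // oc_mu0_unit oc_1l sgp0.
  case: p f nf Hi {Hp2 sgp0 E0} H2p => [|q] g ng Hi H2q; first lia.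
  by rewrite (oc_in (t := q) H2q) ?addn0 ?normalised_oc ?linear0 //; lia.
have Ea a : (a < p)%N -> oc p i (oc p.+1 a f mu) e
    = (if a == i then f else 0) - (if a.+1 == i then f else 0).
  move=> lt_ap; have [eq_ai|ne_ai] := eqVneq a i.
    subst a; rewrite (oc_in Hp2 H20) ?subnn ?oc_mu0_unit; [|lia].
    by rewrite oc_id // (_ : (i.+1 == i) = false) ?subr0 //; lia.
  have [<-|ne_ai1] := eqVneq a.+1 i.
    rewrite (oc_in Hp2 H20) ?subSnn ?oc_mu1_unit; [|lia].
    by rewrite linearN /= oc_id // sub0r.
  case: p f nf Hi lt_ap {sgp0 E0 E1 H2p} Hp2 => [|q] g ng Hi lt_ap Hq2; first lia.
  have Hq0 : (q.+1 + 0 = q.+1)%N by lia.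
  have [lt_ia|lt_ai] := ltnP i a.
    by rewrite (oc_lt Hq2 Hq0) // normalised_oc // oclE linear0 scaler0 subr0.
  rewrite (oc_gt Hq2 Hq0) ?normalised_oc //; last lia.
  by rewrite oclE linear0 scaler0 subr0.
have -> : odelta O p.+1 f
    = oc p.+1 0 mu f + oc p.+1 1 mu f - (-1) ^+ p.+1 *: cir p.+1 f mu.
  by rewrite odeltaE [cir p.+1 mu f]/cir big_nat_recr //= big_nat1.
rewrite oclE !(linearB, linearD, linearZ) /= -!oclE E0 E1.
have -> : oc p i (cir p.+1 f mu) e
    = (if (i < p)%N then f else 0) - (if (0 < i)%N then f else 0).
  rewrite oclE /cir linear_sum (eq_big_nat _ _ (F2 := fun a =>
    (if a == i then f else 0) - (if a.+1 == i then f else 0))); last first.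
    by move=> a /andP[_ lt_ap]; apply: Ea.
  rewrite sumrB sum_delta; congr (_ - _).
  case: (i) Hi => [|j] Hj; first by rewrite big1.
  under eq_bigr do rewrite eqSS.
  by rewrite sum_delta ifT //; lia.
have [eq_ip|ne_ip] := eqVneq i p.
  rewrite eq_ip ltnn sub0r; have [p0|p_gt0] := posnP p.
    by rewrite !oppr0 scaler0 addr0 addNr.
  by rewrite addr0 opprK addNr.
have -> : (i < p)%N by lia.
have [_|i_gt0] := posnP i; first by rewrite subr0 add0r scalerN subrr.
by rewrite addr0 add0r subrr oppr0 scaler0.
Qed.

End Cochain.
End Normalised.

(** * The homotopy formula on the total normalised complex *)

Section Total.
Context {k : comPzRingType} (O : mult_operad k) (M : cyclic_comp_module O).

Notation D n := (degenerate M n).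

Lemma MpiP n (x y : M n) : x - y \in D n -> Mpi x = Mpi y.
Proof. by move=> Dxy; apply/qpiP. Qed.

Lemma MpiD n (x y : M n) : Mpi (x + y) = Mpi x + Mpi y.
Proof. exact: qpiD. Qed.

Lemma MpiZ n a (x : M n) : Mpi (a *: x) = a *: Mpi x.
Proof. by symmetry; exact: qpi_scale. Qed.

Lemma MpiN n (x : M n) : Mpi (- x) = - Mpi x.
Proof. by rewrite -scaleN1r MpiZ scaleN1r. Qed.

Lemma qmap_Mpi (F : forall n m, M n -> M m) n m (x : M n) :
    (forall n m, linear (F n m)) -> descends F ->
  qmap (F n m) (Mpi x) = Mpi (F n m x).
Proof.
move=> linF descF; apply: MpiP.
have := linF n m (-1) x (repr (Mpi x : quotmod (@degenerate k O M n))).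
rewrite !scaleN1r addrC => <-; apply: descF.
by rewrite addrC; apply/qpiP; rewrite reprK.
Qed.

Lemma cB_deg n m (x : M n) : m <> n.+1 -> cB M m x = 0.
Proof. by move=> Hm; rewrite cBE bl_deg //; lia. Qed.

Lemma clie_deg p n m (f : O p) (x : M n) : n.+1 <> (p + m)%N -> clie M m f x = 0.
Proof. by move=> Hn; rewrite clieE lie_deg ?scaler0. Qed.

Lemma cS_deg p n m (f : O p) (x : M n) : n.+2 <> (p + m)%N -> cS M m f x = 0.
Proof.
move=> Hn; rewrite cSE; have [le_pn|lt_np] := leqP p n.+1.
  by rewrite bl_deg ?scaler0 //; lia.
rewrite (_ : n.+1 - p = 0)%N; last lia.
by rewrite /ins big_nat1 rsum0 !linear0.
Qed.

Lemma cB_cS_degenerate p n l m (f : O p) (x : M n) : cB M m (cS M l f x) \in D m.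
Proof.
rewrite cSE linearZ rpredZ //=.
have [->|/eqP Hl] := eqVneq l (n.+1 - p).+1; first exact: cB_unit_degenerate.
by rewrite bl_deg ?linear0 ?rpred0 //; lia.
Qed.

Lemma cS_cB_degenerate p n l m (f : O p) (x : M n) : normalised O f ->
  cS M m f (cB M l x) \in D m.
Proof.
move=> nf; rewrite cBE; have [->|/eqP Hl] := eqVneq l n.+1.
  exact: cS_unit_degenerate.
by rewrite bl_deg ?linear0 ?rpred0 //; lia.
Qed.

(** Lift the family to M and sort by degree: [b, iota_f] cancels against iota of delta f, the part
    [B, iota_f] + [b, S_f] - S of delta f is L_f by [cartan_homotopy], and [B, S_f] is
    degenerate. *)
Lemma total_homotopy p (f : O p) (x : Mtot M) m : normalised O f ->
  tlie M f x m
    = op_sub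
        (op_sub
           (op_comm p (op_add (tB M) (tb M)) (op_add (tcap M f) (tS M f)))
           (tcap M (odelta O p.+1 f)))
        (tS M (odelta O p.+1 f)) x m.
Proof.
move=> nf; have ndf := odelta_normalised nf.
have [X EX] : exists X : forall n, M n, forall n, x n = Mpi (X n).
  exists (fun n => repr (x n : quotmod (@degenerate k O M n))) => n.
  by rewrite /Mpi reprK.
have qcb n l (y : M n) : qmap (cb M l) (Mpi y) = Mpi (cb M l y).
  by apply: (qmap_Mpi (F := fun n m x => cb M m x)); [exact: cb_linear|exact: cb_descends].
have qcB n l (y : M n) : qmap (cB M l) (Mpi y) = Mpi (cB M l y).
  by apply: (qmap_Mpi (F := fun n m x => cB M m x)); [exact: cB_linear|exact: cB_descends].
have qccap q (g : O q) n l (y : M n) : normalised O g ->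
    qmap (ccap M l g) (Mpi y) = Mpi (ccap M l g y).
  move=> ng; apply: (qmap_Mpi (F := fun n m x => ccap M m g x)) => [? ?|].
    exact: ccap_linear.
  exact: ccap_descends.
have qcS q (g : O q) n l (y : M n) : normalised O g ->
    qmap (cS M l g) (Mpi y) = Mpi (cS M l g y).
  move=> ng; apply: (qmap_Mpi (F := fun n m x => cS M m g x)) => [? ?|].
    exact: cS_linear.
  exact: cS_descends.
have qclie n l (y : M n) : qmap (clie M l f) (Mpi y) = Mpi (clie M l f y).
  apply: (qmap_Mpi (F := fun n m x => clie M m f x)) => [? ?|].
    exact: clie_linear.
  exact: clie_descends.
rewrite /op_sub /op_comm /op_add /tlie /tB /tb /tcap /tS !EX.
rewrite !(qclie, qcb, qcB, qccap, qcS) //.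
rewrite -[Mpi (ccap M m.-1 f _) + _]MpiD -[Mpi (ccap M m.+1 f _) + _]MpiD.
rewrite -[Mpi (cB M (p + m) _) + _]MpiD -[Mpi (cB M (p + m).-2 _) + _]MpiD.
rewrite !(qcb, qcB, qccap, qcS) //.
rewrite -[Mpi (ccap M m f _) + Mpi (cS M m f _)]MpiD -[_ *: Mpi _]MpiZ.
rewrite -!MpiN -!MpiD; apply: MpiP.
rewrite [cB M m (_ + _)]linearD [cb M m (_ + _)]linearD.
rewrite [ccap M m f (_ + _)]linearD [cS M m f (_ + _)]linearD /=.
have E0 : cb M m (ccap M m.+1 f (X (p + m.+1)%N))
      - (-1) ^+ p *: ccap M m f (cb M (p + m) (X (p + m).+1))
    = ccap M m (odelta O p.+1 f) (X (p + m).+1).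
  by rewrite addnS (cb_ccap (n := (p + m).+1)).
have E1 : clie M m f (X (p + m).-1)
    = cB M m (ccap M m.-1 f (X (p + m.-1)%N))
      - (-1) ^+ p *: ccap M m f (cB M (p + m) (X (p + m).-1))
      + (cb M m (cS M m.+1 f (X (p + m.+1).-2))
         - (-1) ^+ p *: cS M m f (cb M (p + m).-2 (X (p + m).-2.+1)))
      - cS M m (odelta O p.+1 f) (X (p + m).-1).
  (* For p + m = 0 the source degree p + m - 1 is truncated to 0, and every term is 0 for reasons of
     degree. *)
  rewrite addnS /=; have [pm0|pm_gt0] := posnP (p + m).
    rewrite clie_deg; last lia.
    rewrite [cB M m _]cB_deg ?[cB M (p + m) _]cB_deg ?linear0; [|lia..].
    rewrite !cS_deg ?linear0; [|lia..].
    by rewrite !(scaler0, oppr0, addr0).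
  rewrite (cartan_homotopy (m := m)); last by lia.
  have -> : (p + m).-1.+1 = (p + m)%N by lia.
  have -> : cB M m (ccap M ((p + m).-1 - p) f (X (p + m).-1))
      = cB M m (ccap M m.-1 f (X (p + m.-1)%N)).
    have [m0|m_gt0] := posnP m; first by rewrite !cB_deg //; lia.
    have -> : (p + m.-1 = (p + m).-1)%N by lia.
    by have -> : ((p + m).-1 - p = m.-1)%N by lia.
  suff -> : cS M m f (cb M (p + m).-2 (X (p + m).-1))
      = cS M m f (cb M (p + m).-2 (X (p + m).-2.+1)) by [].
  have [pm1|pm_gt1] := leqP (p + m) 1; first by rewrite !cS_deg //; lia.
  by have -> : (p + m).-2.+1 = (p + m).-1 by lia.
rewrite E1 -E0; set A := cB M m (cS _ _ _ _); set B := cS M m f (cB _ _ _).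
have DA : A \in D m by exact: cB_cS_degenerate.
have DB : B \in D m by exact: cS_cB_degenerate.
suff : - A + (-1) ^+ p *: B \in D m.
  congr (_ \in D m). rewrite ?(scalerDr, scalerN); zmod.
by rewrite rpredD ?rpredN ?rpredZ.
Qed.

End Total.

(** * Subquotients and formal Batalin-Vilkovisky modules *)

Lemma submodB (k : comPzRingType) (V : lmodType k) (W : submodClosed V) x y :
  x \in W -> y \in W -> x - y \in W.
Proof. by move=> Wx Wy; rewrite -scaleN1r rpredD ?rpredZ. Qed.

Lemma submodBC (k : comPzRingType) (V : lmodType k) (W : submodClosed V) x y :
  x - y \in W -> y - x \in W.
Proof. by move=> Wxy; rewrite -opprB -[- (x - y)]scaleN1r rpredZ. Qed.

Section Represents.
Local Open Scope quotient_scope.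
Context {k : comPzRingType} {V : lmodType k} {Z B : submodClosed V}.
Implicit Types (h : subquot Z B) (x y : V).

Lemma represents_in h x : represents h x -> x \in Z.
Proof. by case=> [[z Zz] /= <- _]. Qed.

Lemma represents_eq h h' x y :
  represents h x -> represents h' y -> x - y \in B -> h = h'.
Proof.
case=> z <- <- [z' <- <-] Bxy; apply/qpiP; rewrite inE raddfB //.
Qed.

Lemma represents_diff h x y : represents h x -> represents h y -> x - y \in B.
Proof. by case=> z <- <- [z' <-] /esym/qpiP; rewrite inE raddfB. Qed.

Lemma represents_class x : x \in Z -> represents (subq_class Z B x) x.
Proof.
move=> Zx; exists (SubqSub Zx) => //; congr (\pi_(quotmod _) _).
by apply: val_inj; rewrite insubdK.
Qed.

Lemma represents_repr h : represents h (subq_repr h).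
Proof. by exists (repr (h : quotmod (subq_den B))); rewrite ?reprK. Qed.

Lemma represents_mod h x y : represents h x -> y \in Z -> x - y \in B -> represents h y.
Proof.
move=> hx Zy Bxy; rewrite (represents_eq hx (represents_class Zy) Bxy).
exact: represents_class.
Qed.

Lemma represents_linear a h h' x y : represents h x -> represents h' y ->
  represents (a *: h + h') (a *: x + y).
Proof.
case=> z <- <- [z' <- <-]; exists (a *: z + z'); first by rewrite raddfD.
by rewrite qpiD; congr (_ + _); symmetry; apply: qpi_scale.
Qed.

Lemma represents0 : represents (0 : subquot Z B) 0.
Proof.
exists 0; first exact: raddf0.
exact: (raddf0 (\pi_(Quotient.quot (submod_zmod (subq_den (Z := Z) B))))).
Qed.

Lemma representsD h h' x y : represents h x -> represents h' y ->
  represents (h + h') (x + y).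
Proof. by move=> hx hy; have := represents_linear 1 hx hy; rewrite !scale1r. Qed.

Lemma representsZ a h x : represents h x -> represents (a *: h) (a *: x).
Proof. by move=> hx; have := represents_linear a hx represents0; rewrite !addr0. Qed.

Lemma representsN h x : represents h x -> represents (- h) (- x).
Proof. by move=> hx; rewrite -!scaleN1r; apply: representsZ. Qed.

Lemma representsB h h' x y : represents h x -> represents h' y ->
  represents (h - h') (x - y).
Proof. by move=> hx hy; apply: representsD => //; apply: representsN. Qed.

End Represents.

Section Induced.
Context {k : comPzRingType} {U V W : lmodType k}.
Context {ZU BU : submodClosed U} {ZV BV : submodClosed V} {ZW BW : submodClosed W}.

(** The choice of representative keeps this convertible to [Hmap]; [induced_represents] shows that
    the choice is immaterial. *)
Definition induced (F : U -> V) (h : subquot ZU BU) : subquot ZV BV :=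
  subq_class ZV BV (F (subq_repr h)).

Definition induced2 (F : U -> V -> W) (h : subquot ZU BU) (h' : subquot ZV BV) :
  subquot ZW BW := subq_class ZW BW (F (subq_repr h) (subq_repr h')).

Section Unary.
Variable F : U -> V.
Hypothesis linF : linear F.
Hypothesis FZ : forall x, x \in ZU -> F x \in ZV.
Hypothesis FB : forall x, x \in ZU -> x \in BU -> F x \in BV.

Lemma induced_represents (h : subquot ZU BU) x :
  represents h x -> represents (induced F h) (F x).
Proof.
move=> hx; have hr := represents_repr h.
apply: (@represents_mod _ _ _ _ _ (F (subq_repr h))).
- by apply: represents_class; apply: FZ; apply: represents_in hr.
- by apply: FZ; apply: represents_in hx.
have -> : F (subq_repr h) - F x = F (subq_repr h - x).
  by have := linF (-1) x (subq_repr h); rewrite !scaleN1r ![- _ + _]addrC => ->.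
apply: FB.
  exact: submodB (represents_in hr) (represents_in hx).
exact: represents_diff hr hx.
Qed.

Lemma induced_linear : linear (induced F).
Proof.
move=> a h h'; have hr := represents_repr h; have hr' := represents_repr h'.
apply: represents_eq (induced_represents (represents_linear a hr hr'))
  (represents_linear a (induced_represents hr) (induced_represents hr')) _.
by rewrite linF subrr rpred0.
Qed.

End Unary.

Section Binary.
Variable F : U -> V -> W.
Hypothesis linFl : forall y, linear (F^~ y).
Hypothesis linFr : forall x, linear (F x).
Hypothesis FZ : forall x y, x \in ZU -> y \in ZV -> F x y \in ZW.
Hypothesis FBl : forall x y, x \in ZU -> x \in BU -> y \in ZV -> F x y \in BW.
Hypothesis FBr : forall x y, x \in ZU -> y \in ZV -> y \in BV -> F x y \in BW.

Lemma induced2_represents (h : subquot ZU BU) (h' : subquot ZV BV) x y :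
  represents h x -> represents h' y -> represents (induced2 F h h') (F x y).
Proof.
move=> hx hy; have hr := represents_repr h; have hr' := represents_repr h'.
set x' := subq_repr h in hr; set y' := subq_repr h' in hr'.
have Zx := represents_in hx; have Zy := represents_in hy.
have Zx' := represents_in hr; have Zy' := represents_in hr'.
apply: (@represents_mod _ _ _ _ _ (F x' y')).
- by apply: represents_class; apply: FZ.
- exact: FZ.
have -> : F x' y' - F x y = F (x' - x) y' + F x (y' - y).
  have := linFl y' (-1) x x'; have := linFr x (-1) y y'.
  rewrite !scaleN1r ![- _ + _]addrC => -> ->.
  by rewrite addrA subrK.
apply: rpredD; first by apply: FBl (submodB _ _) (represents_diff hr hx) _.
by apply: FBr _ (submodB _ _) (represents_diff hr' hy).
Qed.

Lemma induced2_linearl h' : linear ((induced2 F)^~ h').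
Proof.
move=> a h1 h2; have h1r := represents_repr h1; have h2r := represents_repr h2.
have hr' := represents_repr h'.
apply: represents_eq (induced2_represents (represents_linear a h1r h2r) hr')
  (represents_linear a (induced2_represents h1r hr') (induced2_represents h2r hr')) _.
by rewrite linFl subrr rpred0.
Qed.

Lemma induced2_linearr h : linear (induced2 F h).
Proof.
move=> a h1 h2; have h1r := represents_repr h1; have h2r := represents_repr h2.
have hr := represents_repr h.
apply: represents_eq (induced2_represents hr (represents_linear a h1r h2r))
  (represents_linear a (induced2_represents hr h1r) (induced2_represents hr h2r)) _.
by rewrite linFr subrr rpred0.
Qed.

End Binary.
End Induced.

(* If B has square 0, then the bracket relation for the operators [B, cap] is a
   formal consequence of their compatibility with the cap product, because B
   commutes with [B, cap] up to sign. *)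
Section BVModule.
Context {k : comPzRingType} {V Om : nat -> lmodType k}.
Variables (A : gerstenhaber_algebra V).
Variable cap : forall p n m : nat, V p -> Om n -> Om m.
Variable dif : forall n m : nat, Om n -> Om m.
Hypothesis cap_bilinear : graded_bilinear (fun p n m => n == p + m)%N cap.
Hypothesis dif_linear : graded_linear (fun n m => m == n.+1) dif.
Arguments cap {p n} m _ _.
Arguments dif {n} m _.

(** With the Cartan formula as definition, the axiom [bv_lie] holds by reflexivity. *)
Definition cartan_lie p n m (f : V p) (x : Om n) : Om m :=
  dif m (cap (n - p)%N f x) - (-1) ^+ p *: cap m f (dif n.+1 x).
Local Notation clie := cartan_lie.

Hypothesis difdif : forall n m (x : Om n), dif m (dif n.+1 x) = 0.
Hypothesis cap1 : forall n (x : Om n), cap n (ga_one A) x = x.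
Hypothesis capA : forall p q n m (f : V p) (g : V q) (x : Om n),
  cap m (ga_cup A (p + q)%N f g) x = cap m f (cap (n - q)%N g x).
Hypothesis mixed : forall p q n m (f : V p) (g : V q) (x : Om n),
  cap m g (clie (n.+1 - p)%N f x)
    = cap m (ga_brk A (q + p).-1 g f) x
      + (-1) ^+ (p.+1 * q) *: clie m f (cap (n - q)%N g x).

Let capr p n m f := gb_linearr cap_bilinear p n m f.

HB.instance Definition _ p n m f :=
  GRing.isLinear.Build k (Om n) (Om m) *:%R (@cap p n m f) (@capr p n m f).
HB.instance Definition _ n m :=
  GRing.isLinear.Build k (Om n) (Om m) *:%R (@dif n m) (@gl_linear _ _ _ _ _ dif_linear n m).

Lemma cap_deg p n m (f : V p) (x : Om n) : n <> (p + m)%N -> cap m f x = 0.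
Proof. by move=> /eqP Hn; apply: (gb_deg cap_bilinear). Qed.

Lemma cap0l p n m (x : Om n) : cap m (0 : V p) x = 0.
Proof. exact: linear_fun0 (gb_linearl cap_bilinear p n m x). Qed.

Lemma dif_deg n m (x : Om n) : m <> n.+1 -> dif m x = 0.
Proof. by move=> /eqP Hn; apply: (gl_deg dif_linear). Qed.

Lemma cartan_lie_linear p n m (f : V p) : linear (@cartan_lie p n m f).
Proof.
move=> a x y; rewrite /cartan_lie !linearP /= !(scalerDr, scalerBr, opprD, opprK).
rewrite scalerN; zmod.
Qed.
HB.instance Definition _ p n m f :=
  GRing.isLinear.Build k (Om n) (Om m) *:%R (@cartan_lie p n m f) (@cartan_lie_linear p n m f).

Lemma cartan_lie_deg p n m (f : V p) (x : Om n) : n.+1 <> (p + m)%N -> clie m f x = 0.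
Proof.
move=> Hn; rewrite /clie [cap m f _]cap_deg // scaler0 subr0.
have [le_pn|lt_np] := leqP p n; first by rewrite dif_deg //; lia.
by rewrite [cap _ f x]cap_deg ?linear0 //; lia.
Qed.

(* Total operators on families, for which no degree has to be truncated. *)
Let T := forall n, Om n.
Let tdif (y : T) : T := fun m => dif m (y m.-1).
Let tcap p (f : V p) (y : T) : T := fun m => cap m f (y (p + m)%N).
Let tlie p (f : V p) (y : T) : T := fun m => clie m f (y (p + m).-1).

Lemma tlieE p (f : V p) y m : tlie f y m = tdif (tcap f y) m - (-1) ^+ p *: tcap f (tdif y) m.
Proof.
rewrite /tlie /tdif /tcap; have [pm0|pm_gt0] := posnP (p + m).
  rewrite cartan_lie_deg; last lia.
  by rewrite !dif_deg ?linear0 ?scaler0 ?subr0 ?addr0 //; lia.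
rewrite /cartan_lie (_ : (p + m).-1.+1 = p + m)%N; last lia.
congr (_ - _); have [m0|m_gt0] := posnP m; first by rewrite !dif_deg //; lia.
have -> : ((p + m).-1 - p = m.-1)%N by lia.
by have -> : ((p + m).-1 = p + m.-1)%N by lia.
Qed.

Lemma tmixed p q (f : V p) (g : V q) y m :
  tcap g (tlie f y) m
    = tcap (ga_brk A (q + p).-1 g f) y m + (-1) ^+ (p.+1 * q) *: tlie f (tcap g y) m.
Proof.
rewrite /tcap /tlie; have [n Hn] : exists n, n = (p + (q + m)).-1 by eexists.
rewrite -Hn.
have [pqm0|pqm_gt0] := posnP (p + q + m).
  rewrite !cartan_lie_deg; [|lia..].
  rewrite linear0 scaler0 addr0 (gb_deg (ga_brk_bilinear A)); last by apply/eqP; lia.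
  by rewrite cap0l.
have := mixed m f g (y n); rewrite (_ : n.+1 - p = q + m)%N; last lia.
move=> ->; congr (_ + _ *: _).
  have [qp0|qp_gt0] := posnP (q + p); last first.
    by have -> : ((q + p).-1 + m = n)%N by lia.
  rewrite (gb_deg (ga_brk_bilinear A)) ?cap0l //; apply/eqP; lia.
have [pm0|pm_gt0] := posnP (p + m); first by rewrite !cartan_lie_deg //; lia.
have -> : (n - q = (p + m).-1)%N by lia.
by have -> : (n = q + (p + m).-1)%N by lia.
Qed.

Lemma tdif_tdif (y : T) m : tdif (tdif y) m = 0.
Proof.
rewrite /tdif; have [m0|m_gt0] := posnP m; first by rewrite dif_deg //; lia.
have [m1|m_gt1] := posnP m.-1; first by rewrite [dif m.-1 _]dif_deg ?linear0 //; lia.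
have : dif m (dif m.-2.+1 (y m.-2)) = 0 by [].
by have -> : m.-2.+1 = m.-1 by lia.
Qed.

Lemma tlie_brk p q (f : V p) (g : V q) y m :
  tlie (ga_brk A (p + q).-1 f g) y m
    = tlie f (tlie g y) m - (-1) ^+ (p.+1 * q.+1) *: tlie g (tlie f y) m.
Proof.
have brk0 : (p + q)%N = 0%N -> ga_brk A (p + q).-1 f g = 0.
  by move=> pq0; rewrite (gb_deg (ga_brk_bilinear A)) //; apply/eqP; lia.
(* The mixed relation read as iota of {f, g} = [iota_f, L_g]; the goal is then the commutator of
   this with the differential. *)
have mixE z j : tcap (ga_brk A (p + q).-1 f g) z j
    = tcap f (tlie g z) j - (-1) ^+ (q.+1 * p) *: tlie g (tcap f z) j.
  by rewrite tmixed addrK.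
have -> : tlie (ga_brk A (p + q).-1 f g) y m
    = tdif (tcap (ga_brk A (p + q).-1 f g) y) m
      + (-1) ^+ (p + q) *: tcap (ga_brk A (p + q).-1 f g) (tdif y) m.
  rewrite tlieE; have [pq0|pq_gt0] := posnP (p + q).
    by rewrite (brk0 pq0) /tdif /tcap !cap0l linear0 !scaler0 subr0 addr0.
  congr (_ + _); rewrite -scaleNr; congr (_ *: _).
  by rewrite -{2}(prednK pq_gt0) exprS mulN1r.
rewrite mixE {1}/tdif mixE linearB linearZ /=.
rewrite -[dif m (tcap f (tlie g y) m.-1)]/(tdif (tcap f (tlie g y)) m).
rewrite -[dif m (tlie g (tcap f y) m.-1)]/(tdif (tlie g (tcap f y)) m).
(* As the differential squares to 0, composing it with L_h on either side leaves, up to sign, only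
   the term B iota_h B. *)
have tdif_lie r (h : V r) z j : tdif (tlie h z) j = - ((-1) ^+ r *: tdif (tcap h (tdif z)) j).
  rewrite {1}/tdif tlieE linearB linearZ /=.
  rewrite -[dif j (tdif _ _)]/(tdif (tdif (tcap h z)) j) tdif_tdif sub0r.
  by [].
have tlie_dif r (h : V r) z j : tlie h (tdif z) j = tdif (tcap h (tdif z)) j.
  rewrite tlieE {2}/tcap tdif_tdif linear0 scaler0 subr0 //.
rewrite [tlie f (tlie g y) m]tlieE.
have -> : tcap f (tdif (tlie g y)) m = - ((-1) ^+ q *: tcap f (tdif (tcap g (tdif y))) m).
  by rewrite /tcap tdif_lie linearN linearZ.
have -> : tlie g (tlie f y) m
    = tdif (tcap g (tdif (tcap f y))) m - (-1) ^+ p *: tlie g (tcap f (tdif y)) m.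
  by rewrite {1}/tlie tlieE linearB linearZ /= -tlie_dif.
rewrite tdif_lie.
have -> : tcap f (tlie g (tdif y)) m = tcap f (tdif (tcap g (tdif y))) m.
  by rewrite /tcap tlie_dif.
signs; zmod.
Qed.

(** The family concentrated in degree n with value [x]. Acting by the unit moves [x] to degree j
    without a cast: it gives [x] for j = n and 0 otherwise. *)
Let single n (x : Om n) : T := fun j => cap j (ga_one A) x.

Lemma tlie_single p n m (f : V p) (x : Om n) : tlie f (single x) m = clie m f x.
Proof.
rewrite /tlie; have [Hn|Hn] := eqVneq n (p + m).-1.
  by subst n; rewrite /single cap1.
rewrite /single cap_deg ?linear0; last by lia.
by rewrite cartan_lie_deg //; lia.
Qed.

Lemma cartan_lie_brk p q n m (f : V p) (g : V q) (x : Om n) :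
  clie m (ga_brk A (p + q).-1 f g) x
    = clie m f (clie (n.+1 - q)%N g x)
      - (-1) ^+ (p.+1 * q.+1) *: clie m g (clie (n.+1 - p)%N f x).
Proof.
rewrite -tlie_single tlie_brk.
have tlie2 r s (h : V r) (l : V s) :
    tlie h (tlie l (single x)) m = clie m h (clie (n.+1 - s)%N l x).
  rewrite {1}/tlie tlie_single; have [->//|Hj] := eqVneq (r + m).-1 (n.+1 - s)%N.
  rewrite [LHS](_ : _ = 0); last by rewrite [clie _ l x]cartan_lie_deg ?linear0 //; lia.
  by rewrite cartan_lie_deg //; lia.
by rewrite !tlie2.
Qed.

Lemma cartan_lie_linearl p n m (x : Om n) : linear (fun f : V p => clie m f x).
Proof.
have l1 := gb_linearl cap_bilinear p n (n - p)%N x.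
have l2 := gb_linearl cap_bilinear p n.+1 m (dif n.+1 x).
move=> a f g; rewrite /clie l1 l2 linearP /=.
rewrite !(scalerDr, scalerBr) opprD !scalerA mulrC; zmod.
Qed.

Lemma cartan_lie_bilinear : graded_bilinear (fun p n m => n.+1 == p + m)%N
  (@cartan_lie).
Proof.
split=> [p n m f x /eqP Hn|p n m x|p n m f].
- exact: cartan_lie_deg.
- exact: cartan_lie_linearl.
- exact: cartan_lie_linear.
Qed.

Definition cartan_gm : gerstenhaber_module A Om :=
  @GerstenhaberModule k V A Om (@cap) (@cartan_lie)
    cap_bilinear cartan_lie_bilinear capA cap1 cartan_lie_brk mixed.

Definition cartan_bv : bv_module A Om :=
  @BVModule k V A Om cartan_gm (@dif) dif_linear difdif (fun p n m f x => erefl).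

End BVModule.

(** * The calculus on homology *)

Section Cohomology.
Context {k : comPzRingType} (O : mult_operad k).

Notation mu := (omu O).
Notation e := (ounit O).

HB.instance Definition _ p r :=
  GRing.isLinear.Build k (O p) (O r) *:%R (@odelta k O p r) (@odelta_linear k O p r).

Lemma odelta_obrk p r (f : O p) : odelta O r f = obrk r mu f.
Proof. by []. Qed.

Lemma odelta_deg p r (f : O p) : r <> p.+1 -> odelta O r f = 0.
Proof.
by move=> Hr; rewrite odeltaE !cir_deg ?scaler0 ?subr0 //; lia.
Qed.

Lemma cocycle_odelta p r (f : O p) : f \in cocycles O p -> odelta O r f = 0.
Proof.
rewrite inE => /eqP df; have [->//|/eqP Hr] := eqVneq r p.+1.
exact: odelta_deg.
Qed.

Lemma odelta_coboundary p r (f : O p) : odelta O r f \in @coboundaries k O r.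
Proof.
have [Hr|/eqP Hr] := eqVneq r p.+1; last by rewrite odelta_deg ?rpred0.
by subst r; rewrite inE; apply/asboolP; exists f.
Qed.

(** Coboundaries are defined through [n.-1]. In degree 0 this leaves only 0, so a coboundary is 0 or
    lies in a successor degree. *)
Lemma coboundary_ind (P : forall p, O p -> Prop) :
    (forall p, P p 0) -> (forall p (f : O p), P p.+1 (odelta O p.+1 f)) ->
  forall p (f : O p), f \in @coboundaries k O p -> P p f.
Proof.
move=> P0 Pd [|p] f; rewrite inE => /asboolP[g ->] //.
by rewrite odelta_deg.
Qed.

Lemma cir_linearl p q r (g : O q) : linear (fun f : O p => cir r f g).
Proof. exact: cirl_linear. Qed.

Lemma obrk_linearr p q r (f : O p) : linear (@obrk k O p q r f).
Proof.
move=> a u v; rewrite !obrkE linearP cir_linearl /=.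
by rewrite !scalerDr scalerN !scalerA mulrC; zmod.
Qed.

Lemma obrk_linearl p q r (g : O q) : linear (fun f : O p => obrk r f g).
Proof.
move=> a u v; rewrite !obrkE linearP cir_linearl /=.
by rewrite !scalerDr scalerN !scalerA mulrC; zmod.
Qed.

Lemma obrk_deg p q r (f : O p) (g : O q) : (p + q)%N <> r.+1 -> obrk r f g = 0.
Proof. by move=> Hr; rewrite obrkE !cir_deg ?scaler0 ?subr0 //; lia. Qed.

Lemma ocup_linearr p q r (f : O p) : linear (@ocup k O p q r f).
Proof. by move=> a u v; rewrite /ocup (gb_linearr (ocomp_bilinear O 1)). Qed.

Lemma ocup_linearl p q r (g : O q) : linear (fun f : O p => ocup r f g).
Proof.
move=> a u v; rewrite /ocup (gb_linearr (ocomp_bilinear O 2)).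
by rewrite (gb_linearl (ocomp_bilinear O 1)).
Qed.

Lemma ocup_deg p q r (f : O p) (g : O q) : r <> (p + q)%N -> ocup r f g = 0.
Proof. by move=> Hr; rewrite /ocup ocomp_deg //; lia. Qed.

HB.instance Definition _ p q r f :=
  GRing.isLinear.Build k (O q) (O r) *:%R (@obrk k O p q r f) (@obrk_linearr p q r f).
HB.instance Definition _ p q r f :=
  GRing.isLinear.Build k (O q) (O r) *:%R (@ocup k O p q r f) (@ocup_linearr p q r f).

Lemma ocup0l p q r (g : O q) : ocup r (0 : O p) g = 0.
Proof. exact: linear_fun0 (@ocup_linearl p q r g). Qed.

Lemma obrk0l p q r (g : O q) : obrk r (0 : O p) g = 0.
Proof. exact: linear_fun0 (@obrk_linearl p q r g). Qed.

Lemma odelta_ocup p q r u (f : O p) (g : O q) : r = (p + q)%N ->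
  odelta O u (ocup r f g)
    = ocup u (odelta O p.+1 f) g + (-1) ^+ p *: ocup u f (odelta O q.+1 g).
Proof.
move=> Hr; rewrite !ocupE linearZ /= odelta_brace_mu; last by lia.
signs; zmod.
Qed.

(** The differential is the bracket with mu, so this is an instance of the Jacobi identity. *)
Lemma odelta_obrk_brk p q r u (f : O p) (g : O q) : r = (p + q).-1 ->
  odelta O u (obrk r f g)
    = obrk u (odelta O p.+1 f) g + (-1) ^+ p.+1 *: obrk u f (odelta O q.+1 g).
Proof.
move=> Hr; rewrite odelta_obrk (obrk_jacobi (t := p.+1) (w := q.+1) u mu f g Hr) //.
by congr (_ + _ *: _); rewrite /sg; apply: eq_sign; rewrite oddM.
Qed.

Lemma odelta_unit r : odelta O r e = 0.
Proof.
have [->|/eqP Hr] := eqVneq r 1%N; last exact: odelta_deg.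
rewrite odeltaE cir_arity0 scaler0 subr0 /cir big_nat_recr //= big_nat1.
by rewrite oc_mu0_unit oc_mu1_unit subrr.
Qed.

Lemma ocup_cocycle p q r (f : O p) (g : O q) :
  f \in cocycles O p -> g \in cocycles O q -> ocup r f g \in cocycles O r.
Proof.
move=> Zf Zg; have [Hr|/eqP Hr] := eqVneq r (p + q)%N; last by rewrite ocup_deg ?rpred0.
by rewrite inE odelta_ocup // !cocycle_odelta // ocup0l linear0 scaler0 addr0.
Qed.

Lemma ocup_coboundaryl p q r (f : O p) (g : O q) :
  f \in @coboundaries k O p -> g \in cocycles O q -> ocup r f g \in @coboundaries k O r.
Proof.
move: p f; apply: coboundary_ind => [p|p f] Zg; first by rewrite ocup0l rpred0.
have := odelta_ocup r f g erefl; rewrite (cocycle_odelta _ Zg) linear0 scaler0 addr0 => <-.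
exact: odelta_coboundary.
Qed.

Lemma ocup_coboundaryr p q r (f : O p) (g : O q) :
  f \in cocycles O p -> g \in @coboundaries k O q -> ocup r f g \in @coboundaries k O r.
Proof.
move=> Zf; move: q g; apply: coboundary_ind => [q|q g]; first by rewrite linear0 rpred0.
have := odelta_ocup r f g erefl; rewrite (cocycle_odelta _ Zf) ocup0l add0r.
move/(congr1 (fun z => (-1) ^+ p *: z)); rewrite scalerA -expr2 sqrr_sign scale1r => <-.
by rewrite rpredZ // odelta_coboundary.
Qed.

Lemma obrk_cocycle p q r (f : O p) (g : O q) :
  f \in cocycles O p -> g \in cocycles O q -> obrk r f g \in cocycles O r.
Proof.
move=> Zf Zg; have [Hr|/eqP Hr] := eqVneq (p + q)%N r.+1; last by rewrite obrk_deg ?rpred0.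
rewrite inE odelta_obrk_brk; last by lia.
by rewrite !cocycle_odelta // obrk0l linear0 scaler0 addr0.
Qed.

Lemma obrk_coboundaryl p q r (f : O p) (g : O q) :
  f \in @coboundaries k O p -> g \in cocycles O q -> obrk r f g \in @coboundaries k O r.
Proof.
move: p f; apply: coboundary_ind => [p|p f] Zg; first by rewrite obrk0l rpred0.
have := odelta_obrk_brk r f g erefl; rewrite (cocycle_odelta _ Zg) linear0 scaler0 addr0 => <-.
exact: odelta_coboundary.
Qed.

Lemma obrk_coboundaryr p q r (f : O p) (g : O q) :
  f \in cocycles O p -> g \in @coboundaries k O q -> obrk r f g \in @coboundaries k O r.
Proof.
move=> Zf Bg; rewrite obrkC -scaleN1r !rpredZ //; exact: obrk_coboundaryl.
Qed.

Lemma ocup_comm p q r (f : O p) (g : O q) :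
    f \in cocycles O p -> g \in cocycles O q ->
  ocup r f g - (-1) ^+ (p * q) *: ocup r g f \in @coboundaries k O r.
Proof.
move=> Zf Zg; have := odelta_cir r f g erefl.
rewrite (cocycle_odelta _ Zf) (cocycle_odelta _ Zg) cir0l linear0 scaler0 addr0 sub0r => E.
suff -> : ocup r f g - (-1) ^+ (p * q) *: ocup r g f
    = (-1) ^+ p *: odelta O r (cir (p + q).-1 f g).
  by rewrite rpredZ // odelta_coboundary.
rewrite E !ocupE /sg; signs; zmod.
Qed.

Lemma ocup_leibniz c p q u (h : O c) (f : O p) (g : O q) :
    h \in cocycles O c -> f \in cocycles O p -> g \in cocycles O q ->
  obrk u h (ocup (p + q) f g)
    - (ocup u (obrk (c + p).-1 h f) g
       + (-1) ^+ (c.+1 * p) *: ocup u f (obrk (c + q).-1 h g)) \in @coboundaries k O u.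
Proof.
move=> Zh Zf Zg.
have Hw : (p + q = q + p)%N by lia.
(* The cup product of [f] and [g] is mu{g, f} up to sign, so the two arguments are exchanged and the
   homotopy is h{g, f}. *)
have := obrk_brace_mu (v := ((c + q).-1 + p).-1) u h g f erefl erefl erefl Hw.
rewrite (cocycle_odelta _ Zf) (cocycle_odelta _ Zg) (cocycle_odelta _ Zh).
rewrite brace0m brace0l !(linear0, scaler0, addr0, subr0) => E.
set R := (X in _ - X).
suff -> : obrk u h (ocup (p + q) f g) - R
    = - ((-1) ^+ (p.+1 * q + c) *: odelta O u (brace ((c + q).-1 + p).-1 h g f)).
  by rewrite -scaleN1r !rpredZ // odelta_coboundary.
rewrite /R {R} !ocupE linearZ /= E.
have -> : (-1) ^+ ((c + p).-1.+1 * q) *: brace u mu g (obrk (c + p).-1 h f)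
    = (-1) ^+ ((c + p) * q) *: brace u mu g (obrk (c + p).-1 h f).
  have [cp0|cp_gt0] := posnP (c + p); last by rewrite prednK.
  by rewrite obrk_deg ?linear0 ?scaler0 //; lia.
have -> : (-1) ^+ (p.+1 * (c + q).-1) *: brace u mu (obrk (c + q).-1 h g) f
    = (-1) ^+ (p.+1 * (c + q).+1) *: brace u mu (obrk (c + q).-1 h g) f.
  have [cq0|cq_gt0] := posnP (c + q).
    by rewrite obrk_deg ?brace0m ?scaler0 //; lia.
  by congr (_ *: _); apply: eq_sign; rewrite !oddM -{2}(prednK cq_gt0) /= negbK.
signs; zmod.
Qed.

Section Induced.
Variables p q r : nat.

Definition hcup : HO O p -> HO O q -> HO O r := induced2 (@ocup k O p q r).
Definition hbrk : HO O p -> HO O q -> HO O r := induced2 (@obrk k O p q r).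

Let cupBl (f : O p) (g : O q) : f \in cocycles O p -> f \in @coboundaries k O p ->
  g \in cocycles O q -> ocup r f g \in @coboundaries k O r.
Proof. by move=> _; apply: ocup_coboundaryl. Qed.
Let cupBr (f : O p) (g : O q) : f \in cocycles O p -> g \in cocycles O q ->
  g \in @coboundaries k O q -> ocup r f g \in @coboundaries k O r.
Proof. by move=> Zf _; apply: ocup_coboundaryr. Qed.
Let brkBl (f : O p) (g : O q) : f \in cocycles O p -> f \in @coboundaries k O p ->
  g \in cocycles O q -> obrk r f g \in @coboundaries k O r.
Proof. by move=> _; apply: obrk_coboundaryl. Qed.
Let brkBr (f : O p) (g : O q) : f \in cocycles O p -> g \in cocycles O q ->
  g \in @coboundaries k O q -> obrk r f g \in @coboundaries k O r.
Proof. by move=> Zf _; apply: obrk_coboundaryr. Qed.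

Definition hcup_represents := induced2_represents
  (@ocup_linearl p q r) (@ocup_linearr p q r) (@ocup_cocycle p q r) cupBl cupBr.
Definition hbrk_represents := induced2_represents
  (@obrk_linearl p q r) (@obrk_linearr p q r) (@obrk_cocycle p q r) brkBl brkBr.
Definition hcup_linearl := induced2_linearl
  (@ocup_linearl p q r) (@ocup_linearr p q r) (@ocup_cocycle p q r) cupBl cupBr.
Definition hcup_linearr := induced2_linearr
  (@ocup_linearl p q r) (@ocup_linearr p q r) (@ocup_cocycle p q r) cupBl cupBr.
Definition hbrk_linearl := induced2_linearl
  (@obrk_linearl p q r) (@obrk_linearr p q r) (@obrk_cocycle p q r) brkBl brkBr.
Definition hbrk_linearr := induced2_linearr
  (@obrk_linearl p q r) (@obrk_linearr p q r) (@obrk_cocycle p q r) brkBl brkBr.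

End Induced.

Lemma hcup_bilinear : graded_bilinear (fun p q r => r == p + q)%N hcup.
Proof.
split=> [p q r a b /eqP Hr|p q r b|p q r a]; last first.
- exact: hcup_linearr.
- exact: hcup_linearl.
apply: represents_eq (hcup_represents r (represents_repr a) (represents_repr b)) represents0 _.
by rewrite ocup_deg // subrr rpred0.
Qed.

Lemma hbrk_bilinear : graded_bilinear (fun p q r => p + q == r.+1)%N hbrk.
Proof.
split=> [p q r a b /eqP Hr|p q r b|p q r a]; last first.
- exact: hbrk_linearr.
- exact: hbrk_linearl.
apply: represents_eq (hbrk_represents r (represents_repr a) (represents_repr b)) represents0 _.
by rewrite obrk_deg // subrr rpred0.
Qed.

Definition hone : HO O 0 := subq_class (cocycles O 0) (@coboundaries k O 0) e.

Lemma hone_represents : represents hone e.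
Proof. by apply: represents_class; rewrite inE odelta_unit. Qed.

(** Kept transparent: the products of this structure have to reduce to [hcup] and [hbrk] when the
    module axioms are checked. *)
Definition hgerstenhaber : gerstenhaber_algebra (HO O).
Proof.
apply: (@GerstenhaberAlgebra k (HO O) hone hcup hbrk hcup_bilinear hbrk_bilinear).
- move=> p q r u a b c.
  have [ra rb rc] := And3 (represents_repr a) (represents_repr b) (represents_repr c).
  apply: represents_eq (hcup_represents u (hcup_represents _ ra rb) rc)
    (hcup_represents u ra (hcup_represents _ rb rc)) _.
  by rewrite ocupA subrr rpred0.
- move=> p a; have ra := represents_repr a.
  apply: represents_eq (hcup_represents p hone_represents ra) ra _.
  by rewrite ocup1l subrr rpred0.
- move=> p a; have ra := represents_repr a.
  apply: represents_eq (hcup_represents p ra hone_represents) ra _.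
  by rewrite ocup1r subrr rpred0.
- move=> p q r a b; have ra := represents_repr a; have rb := represents_repr b.
  apply: represents_eq (hcup_represents r ra rb) (representsZ _ (hcup_represents r rb ra)) _.
  exact: ocup_comm (represents_in ra) (represents_in rb).
- move=> p q r a b; have ra := represents_repr a; have rb := represents_repr b.
  apply: represents_eq (hbrk_represents r ra rb)
    (representsN (representsZ _ (hbrk_represents r rb ra))) _.
  by rewrite [obrk r (subq_repr a) _]obrkC subrr rpred0.
- move=> p q r u a b c.
  have [ra rb rc] := And3 (represents_repr a) (represents_repr b) (represents_repr c).
  apply: represents_eq (hbrk_represents u ra (hbrk_represents _ rb rc))
    (representsD (hbrk_represents u (hbrk_represents _ ra rb) rc)
      (representsZ _ (hbrk_represents u rb (hbrk_represents _ ra rc)))) _.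
  by rewrite (obrk_jacobi u _ _ _ erefl erefl erefl) subrr rpred0.
move=> d p q u c a b.
have [rc ra rb] := And3 (represents_repr c) (represents_repr a) (represents_repr b).
apply: represents_eq (hbrk_represents u rc (hcup_represents _ ra rb))
  (representsD (hcup_represents u (hbrk_represents _ rc ra) rb)
    (representsZ _ (hcup_represents u ra (hbrk_represents _ rc rb)))) _.
exact: ocup_leibniz (represents_in rc) (represents_in ra) (represents_in rb).
Defined.

End Cohomology.

(** * Cap product and B on cycles and boundaries *)

Section Homology.
Context {k : comPzRingType} (O : mult_operad k) (M : cyclic_comp_module O).


Lemma cycleP n m (x : M n) : x \in @cycles k O M n -> cb M m x = 0.
Proof.
rewrite inE => /eqP bx; have [->//|/eqP Hm] := eqVneq m n.-1.
by rewrite cb_deg //; lia.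
Qed.

Lemma cb_cycle n m (x : M n) : cb M m x \in @cycles k O M m.
Proof.
rewrite inE; case: m => [|m]; last by rewrite cb_cb.
by rewrite cb_deg.
Qed.

Lemma cb_boundary n m (x : M n) : cb M m x \in @boundaries k O M m.
Proof.
have [Hn|/eqP Hn] := eqVneq n m.+1; last by rewrite cb_deg ?rpred0.
by subst n; rewrite inE; apply/asboolP; exists x.
Qed.

Lemma ccap_cycle p n m (f : O p) (x : M n) :
  f \in cocycles O p -> x \in @cycles k O M n -> ccap M m f x \in @cycles k O M m.
Proof.
move=> Zf Zx; rewrite inE; case: m => [|m]; first by rewrite cb_deg.
have [Hn|/eqP Hn] := eqVneq n (p.+1 + m)%N; last first.
  by rewrite ccap_deg ?linear0 //; lia.
have := cb_ccap f x Hn; rewrite (cycleP _ Zx) (cocycle_odelta _ Zf) [RHS]ccaplE.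
by rewrite !(linear0, scaler0, oppr0, addr0, subr0) => ->.
Qed.

Lemma ccap_boundaryl p n m (f : O p) (x : M n) :
  f \in @coboundaries k O p -> x \in @cycles k O M n -> ccap M m f x \in @boundaries k O M m.
Proof.
move: p f; apply: coboundary_ind => [p|p f] Zx; first by rewrite ccaplE linear0 rpred0.
have [Hn|/eqP Hn] := eqVneq n (p.+1 + m)%N; last by rewrite ccap_deg ?rpred0.
rewrite -(cb_ccap f x Hn) (cycleP _ Zx) !(linear0, scaler0, oppr0, addr0, subr0).
exact: cb_boundary.
Qed.

Lemma ccap_boundaryr p n m (f : O p) (x : M n) :
  f \in cocycles O p -> x \in @boundaries k O M n -> ccap M m f x \in @boundaries k O M m.
Proof.
move=> Zf; rewrite inE => /asboolP[y ->].
have [Hn|/eqP Hn] := eqVneq n.+1 (p.+1 + m)%N; last by rewrite ccap_deg ?rpred0 //; lia.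
have := cb_ccap f y Hn; rewrite (cocycle_odelta _ Zf) [RHS]ccaplE linear0 => /eqP.
rewrite subr_eq0 => /eqP /(congr1 (fun z => (-1) ^+ p *: z)).
rewrite scalerA -expr2 sqrr_sign scale1r /= => <-.
by rewrite rpredZ // cb_boundary.
Qed.

Lemma cB_cycle n m (x : M n) : x \in @cycles k O M n -> cB M m x \in @cycles k O M m.
Proof.
move=> Zx; have [->|/eqP Hm] := eqVneq m n.+1; last by rewrite cB_deg ?rpred0.
by rewrite inE /= cb_cB (cycleP _ Zx) linear0 oppr0.
Qed.

Lemma cB_boundary n m (x : M n) : x \in @boundaries k O M n -> cB M m x \in @boundaries k O M m.
Proof.
rewrite inE => /asboolP[y ->].
have [->|/eqP Hm] := eqVneq m n.+1; last by rewrite cB_deg ?rpred0.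
have := cb_cB y => /= /(congr1 -%R); rewrite opprK => <-.
by rewrite -scaleN1r rpredZ // cb_boundary.
Qed.

End Homology.

(** * The calculus on the homology of M *)

Section Calculus.
Context {k : comPzRingType} (O : mult_operad k) (M : cyclic_comp_module O).

Notation e := (ounit O).

Lemma boundary_cycle n (x : M n) : x \in @boundaries k O M n -> x \in @cycles k O M n.
Proof. by move=> /asboolP[y ->]; apply: cb_cycle. Qed.

Lemma cS_linearl p n m (x : M n) : linear (fun f : O p => cS M m f x).
Proof.
by move=> a f g; rewrite !cSE !insE !linearP.
Qed.

(** For a cocycle and a cycle, all that remains of the correction in the Cartan formula is the
    boundary b S_f x. *)
Lemma cartan_boundary p n m (f : O p) (x : M n) :
    f \in cocycles O p -> x \in @cycles k O M n ->
  clie M m f x - (cB M m (ccap M (n - p) f x) - (-1) ^+ p *: ccap M m f (cB M n.+1 x))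
    \in @boundaries k O M m.
Proof.
move=> Zf Zx; have [Hn|/eqP Hn] := eqVneq n.+1 (p + m)%N; last first.
  rewrite clie_deg // [ccap M m f _]ccap_deg //.
  have -> : cB M m (ccap M (n - p) f x) = 0.
    have [le_pn|lt_np] := leqP p n; first by rewrite cB_deg //; lia.
    by rewrite ccap_deg ?linear0 //; lia.
  by rewrite !(scaler0, subr0) rpred0.
rewrite (cartan_homotopy f x Hn) (cocycle_odelta _ Zf) (cycleP _ Zx).
rewrite (linear_fun0 (@cS_linearl p.+1 n m x)) linear0 scaler0 !subr0.
by rewrite addrC addKr cb_boundary.
Qed.

(** By the Cartan formula L_f x is a boundary plus terms built from operators that preserve cycles,
    so no separate formula for [b, L_f] is required. *)
Lemma clie_cycle p n m (f : O p) (x : M n) :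
  f \in cocycles O p -> x \in @cycles k O M n -> clie M m f x \in @cycles k O M m.
Proof.
move=> Zf Zx; rewrite -[clie M m f x](subrK
  (cB M m (ccap M (n - p) f x) - (-1) ^+ p *: ccap M m f (cB M n.+1 x))).
apply: rpredD; first exact: boundary_cycle (cartan_boundary _ Zf Zx).
apply: submodB; first by apply: cB_cycle; apply: ccap_cycle.
by rewrite rpredZ //; apply: ccap_cycle => //; apply: cB_cycle.
Qed.

(** Since iota_e is the identity, [B, iota_e] = 0, and the Cartan formula for the cocycle e makes
    L_e of the cycle B x a boundary. *)
Lemma cB_cB_boundary n m (x : M n) : x \in @cycles k O M n ->
  cB M m (cB M n.+1 x) \in @boundaries k O M m.
Proof.
move=> Zx; have [->|/eqP Hm] := eqVneq m n.+2; last by rewrite cB_deg ?rpred0.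
rewrite cB_cB; have Ze : e \in cocycles O 0 by rewrite inE odelta_unit.
have := cartan_boundary n.+2 Ze (cB_cycle n.+1 Zx).
by rewrite subn0 !ccap_unit scale1r subrr subr0.
Qed.

Lemma mixed_boundary p q n m (f : O p) (g : O q) (x : M n) :
    f \in cocycles O p -> g \in cocycles O q -> x \in @cycles k O M n ->
  ccap M m g (clie M (n.+1 - p) f x)
    - (ccap M m (obrk (q + p).-1 g f) x
        + (-1) ^+ (p.+1 * q) *: clie M m f (ccap M (n - q) g x))
    \in @boundaries k O M m.
Proof.
move=> Zf Zg Zx; have [Hn|/eqP Hn] := eqVneq n.+1 (p + q + m)%N; last first.
  have -> : ccap M m g (clie M (n.+1 - p) f x) = 0.
    have [le_pn|lt_np] := leqP p n.+1; first by rewrite ccap_deg //; lia.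
    by rewrite clie_deg ?linear0 //; lia.
  have -> : ccap M m (obrk (q + p).-1 g f) x = 0.
    have [qp0|qp_gt0] := posnP (q + p); last by rewrite ccap_deg //; lia.
    by rewrite obrk_deg ?ccaplE ?linear0 //; lia.
  have -> : clie M m f (ccap M (n - q) g x) = 0.
    have [le_qn|lt_nq] := leqP q n; first by rewrite clie_deg //; lia.
    by rewrite ccap_deg ?linear0 //; lia.
  by rewrite scaler0 addr0 subr0 rpred0.
have := mixed_homotopy f g x Hn.
rewrite (cycleP _ Zx) (cocycle_odelta _ Zf) (cocycle_odelta _ Zg).
rewrite [winding m 0 g x]windinglE [winding m f 0 x]windingmE !(linear0, scaler0, oppr0, addr0, subr0).
rewrite (_ : q + m = n.+1 - p)%N; last lia.
rewrite opprD addrA => ->.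
by rewrite rpredZ // cb_boundary.
Qed.

Section Induced.
Variables p n m : nat.

Definition hcap : HO O p -> HM M n -> HM M m := induced2 (@ccap k O M p n m).
Definition hdif : HM M n -> HM M m := induced (@cB k O M n m).

Let ccap_linearl (x : M n) : linear (fun f : O p => ccap M m f x).
Proof. exact: ccapl_linear. Qed.
Let capBl (f : O p) (x : M n) : f \in cocycles O p -> f \in @coboundaries k O p ->
  x \in @cycles k O M n -> ccap M m f x \in @boundaries k O M m.
Proof. by move=> _; apply: ccap_boundaryl. Qed.
Let capBr (f : O p) (x : M n) : f \in cocycles O p -> x \in @cycles k O M n ->
  x \in @boundaries k O M n -> ccap M m f x \in @boundaries k O M m.
Proof. by move=> Zf _; apply: ccap_boundaryr. Qed.
Let cBB (x : M n) : x \in @cycles k O M n -> x \in @boundaries k O M n ->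
  cB M m x \in @boundaries k O M m.
Proof. by move=> _; apply: cB_boundary. Qed.

Definition hcap_represents := induced2_represents
  ccap_linearl (@ccap_linear k O M p n m) (@ccap_cycle k O M p n m) capBl capBr.
Definition hcap_linearl := induced2_linearl
  ccap_linearl (@ccap_linear k O M p n m) (@ccap_cycle k O M p n m) capBl capBr.
Definition hcap_linearr := induced2_linearr
  ccap_linearl (@ccap_linear k O M p n m) (@ccap_cycle k O M p n m) capBl capBr.
Definition hdif_represents := induced_represents
  (@cB_linear k O M n m) (@cB_cycle k O M n m) cBB.
Definition hdif_linear := induced_linear
  (@cB_linear k O M n m) (@cB_cycle k O M n m) cBB.

End Induced.

Lemma hcap_bilinear : graded_bilinear (fun p n m => n == p + m)%N hcap.
Proof.
split=> [p n m a h /eqP Hn|p n m h|p n m a]; last first.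
- exact: hcap_linearr.
- exact: hcap_linearl.
apply: represents_eq (hcap_represents m (represents_repr a) (represents_repr h)) represents0 _.
by rewrite ccap_deg // subrr rpred0.
Qed.

Lemma hdif_graded : graded_linear (fun n m => m == n.+1) hdif.
Proof.
split=> [n m h /eqP Hm|n m]; last exact: hdif_linear.
apply: represents_eq (hdif_represents m (represents_repr h)) represents0 _.
by rewrite cB_deg // subrr rpred0.
Qed.

Lemma hdif_hdif n m (h : HM M n) : hdif m (hdif n.+1 h) = 0.
Proof.
have rh := represents_repr h.
apply: represents_eq (hdif_represents m (hdif_represents _ rh)) represents0 _.
by rewrite subr0 cB_cB_boundary // (represents_in rh).
Qed.

Lemma hcap_one n (h : HM M n) : hcap n (ga_one (hgerstenhaber O)) h = h.
Proof.
have rh := represents_repr h.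
apply: represents_eq (hcap_represents n (hone_represents O) rh) rh _.
by rewrite ccap_unit subrr rpred0.
Qed.

Lemma hcap_cup p q n m (a : HO O p) (b : HO O q) (h : HM M n) :
  hcap m (ga_cup (hgerstenhaber O) (p + q)%N a b) h = hcap m a (hcap (n - q)%N b h).
Proof.
have [ra rb rh] := And3 (represents_repr a) (represents_repr b) (represents_repr h).
apply: represents_eq (hcap_represents m (hcup_represents _ ra rb) rh)
  (hcap_represents m ra (hcap_represents _ rb rh)) _.
by rewrite ccap_cup subrr rpred0.
Qed.

(** Identifies the Lie derivative defined by the Cartan formula on homology with the one given on
    chains. *)
Lemma hlie_represents p n m (a : HO O p) (h : HM M n) f x :
  represents a f -> represents h x ->
  represents (cartan_lie hcap hdif m a h) (clie M m f x).
Proof.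
move=> ra rh; have Zf := represents_in ra; have Zx := represents_in rh.
apply: (represents_mod (representsB (hdif_represents m (hcap_represents _ ra rh))
  (representsZ _ (hcap_represents m ra (hdif_represents _ rh))))).
  exact: clie_cycle.
exact: submodBC (cartan_boundary _ Zf Zx).
Qed.

Lemma hcap_mixed p q n m (a : HO O p) (b : HO O q) (h : HM M n) :
  hcap m b (cartan_lie hcap hdif (n.+1 - p)%N a h)
    = hcap m (ga_brk (hgerstenhaber O) (q + p).-1 b a) h
      + (-1) ^+ (p.+1 * q) *: cartan_lie hcap hdif m a (hcap (n - q)%N b h).
Proof.
have [ra rb rh] := And3 (represents_repr a) (represents_repr b) (represents_repr h).
apply: represents_eq (hcap_represents m rb (hlie_represents _ ra rh))
  (representsD (hcap_represents m (hbrk_represents _ rb ra) rh)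
    (representsZ _ (hlie_represents m ra (hcap_represents _ rb rh)))) _.
exact: mixed_boundary (represents_in ra) (represents_in rb) (represents_in rh).
Qed.

Definition hcalculus : nc_calculus (HO O) (HM M) :=
  NcCalculus (cartan_bv hcap_bilinear hdif_graded hdif_hdif hcap_one hcap_cup hcap_mixed).

Lemma hcalculus_induced : induced_calculus hcalculus.
Proof.
split.
- by move=> p q r a b f g; apply: hcup_represents.
- by move=> p q r a b f g; apply: hbrk_represents.
- by move=> p n m a h f x; apply: hcap_represents.
- by move=> p n m a h f x; apply: hlie_represents.
(* B has the same formula on M and on Mbar, so B x itself represents the class in question. *)
move=> n m h x rh; exists (cB M m x); first exact: hdif_represents.
symmetry; apply: (qmap_Mpi (F := fun n m x => cB M m x)).
  exact: cB_linear.
exact: cB_descends.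
Qed.

Lemma Hmap_represents n m (F : M n -> M m) (h : HM M n) x :
    linear F -> (forall x, x \in @cycles k O M n -> F x \in @cycles k O M m) ->
    (forall x, x \in @boundaries k O M n -> F x \in @boundaries k O M m) ->
  represents h x -> represents (Hmap F h) (F x).
Proof. by move=> linF FZ FB; apply: induced_represents => // y _; apply: FB. Qed.

Lemma Hmap_clie p n m (f : O p) (h : HM M n) : f \in cocycles O p ->
  Hmap (clie M m f) h
    = hdif m (Hmap (ccap M (n - p)%N f) h) - (-1) ^+ p *: Hmap (ccap M m f) (hdif n.+1 h).
Proof.
move=> Zf; have rh := represents_repr h.
have cap_rep n' m' (h' : HM M n') x : represents h' x ->
    represents (Hmap (ccap M m' f) h') (ccap M m' f x).
  apply: Hmap_represents; first exact: ccap_linear.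
    by move=> y; apply: ccap_cycle.
  by move=> y; apply: ccap_boundaryr.
apply: represents_eq (represents_class (clie_cycle m Zf (represents_in rh)))
  (representsB (hdif_represents m (cap_rep _ _ _ _ rh))
    (representsZ _ (cap_rep _ m _ _ (hdif_represents _ rh)))) _.
exact: cartan_boundary Zf (represents_in rh).
Qed.

End Calculus.

Theorem theorem1p5 (k : comPzRingType) (O : mult_operad k)
    (M : cyclic_comp_module O) :
  [/\ descends (fun n m x => cb M m x),
      descends (fun n m x => cB M m x),
      forall p (f : O p), normalised O f ->
        [/\ normalised O (odelta O p.+1 f),
            descends (fun n m x => ccap M m f x),
            descends (fun n m x => cS M m f x),
            descends (fun n m x => clie M m f x)
          & forall x : Mtot M, finsupp x -> forall m,
              tlie M f x m
              = op_sub
                  (op_sub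
                     (op_comm p (op_add (tB M) (tb M))
                                (op_add (tcap M f) (tS M f)))
                     (tcap M (odelta O p.+1 f)))
                  (tS M (odelta O p.+1 f)) x m]
    & exists C : nc_calculus (HO O) (HM M),
        induced_calculus C /\
        forall p (f : O p), normalised O f -> f \in cocycles O p ->
          forall n m (h : HM M n),
            Hmap (clie M m f) h
            = bv_B (nc_mod C) m (Hmap (ccap M (n - p)%N f) h)
              - (-1) ^+ p *: Hmap (ccap M m f) (bv_B (nc_mod C) n.+1 h)].
Proof.
split; first exact: cb_descends.
- exact: cB_descends.
- move=> p f nf; split.
  + exact: odelta_normalised.
  + exact: ccap_descends.
  + exact: cS_descends.
  + exact: clie_descends.
  + by move=> x _ m; apply: total_homotopy.
exists (hcalculus M); split; first exact: hcalculus_induced.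
by move=> p f _ Zf n m h; apply: Hmap_clie.
Qed.
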